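(* Let $V=\mathbb{C}^m$ be equipped with a non-degenerate symmetric bilinear form $(\;,\;)$, and let $G=\mathrm{SO}(V)$. Let $\mathcal{T}$ be the full tensor subcategory of finite dimensional representations of $G$ generated by $V$ under tensor product. Let $\widetilde{\mathcal{B}}(m)$ be the enhanced Brauer category over $R=\mathbb{C}$ associated with the integer $m$ and the parameter $\delta=m$. There is an equivalence of categories $\mathcal{F}:\widetilde{\mathcal{B}}(m)\to\mathcal{T}$ defined by $\mathcal{F}(r)=V^{\otimes r}$ for $r\in\mathbb{N}$; $\mathcal{F}(I)=\mathrm{id}:V\to V$; $\mathcal{F}(X):V\otimes V\to V\otimes V$ is interchange of tensor factors; $\mathcal{F}(A):V\otimes V\to\mathbb{C}$ is the map $v\otimes w\mapsto(v,w)$; $\mathcal{F}(U):1\mapsto\check C$; and $\mathcal{F}(\Delta_m)=\Lambda$.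
   Context: Here $\mathbb{N}=\{0,1,2,\dots\}$, $m\ge 2$, and $\mathcal{T}$ has objects $V^{\otimes r}$ ($r\in\mathbb{N}$) and morphisms $\mathrm{Hom}_G(V^{\otimes i},V^{\otimes j})$. Let $e_1,\dots,e_m$ be an orthonormal basis of $V$. Then $\check C=\sum_{i=1}^m e_i\otimes e_i\in V\otimes V$, and $\Lambda=e_1\wedge\dots\wedge e_m=A_m(e_1\otimes\dots\otimes e_m)\in V^{\otimes m}$, where $A_m=(m!)^{-1}\sum_{\sigma\in\mathrm{Sym}_m}\varepsilon(\sigma)\sigma$, with $\mathrm{Sym}_m$ permuting tensor factors and $\varepsilon$ the sign character; $\Lambda$ is regarded as the homomorphism $\mathbb{C}\to V^{\otimes m}$, $1\mapsto\Lambda$. It is harmonic, i.e. every contraction of two tensor factors of $\Lambda$ by the form $(\;,\;)$ is zero. The enhanced Brauer category $\widetilde{\mathcal{B}}(\delta)$ (for a commutative ring $R$, $\delta\in R$ and a fixed integer $m\ge2$) is the $R$-linear tensor category with object set $\mathbb{N}$ (tensor product of objects being addition), with an involution $^*$ which fixes objects and reflects morphisms, viewed as diagrams, in a horizontal line (so it reverses the direction of morphisms), and with morphisms generated under composition, tensor product and the duality $^*$ by $I=\mathrm{id}_1:1\to1$, $U:0\to2$, $A=U^*:2\to0$, $X:2\to2$ and one further generator $\Delta_m:0\to m$, subject to the following relations. (1) The relations of the usual Brauer category with parameter $\delta$: $X\circ X=I\otimes I$; $(X\otimes I)(I\otimes X)(X\otimes I)=(I\otimes X)(X\otimes I)(I\otimes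 X)$; $A\circ X=A$; $X\circ U=U$; $A\circ U=\delta$; $(A\otimes I)(I\otimes X)=(I\otimes A)(X\otimes I)$; $(I\otimes X)(U\otimes I)=(X\otimes I)(I\otimes U)$; $(A\otimes I)(I\otimes U)=I=(I\otimes A)(U\otimes I)$. (2) (Harmonicity) For each integer $r$ with $0\le r\le m-2$, $(I^{\otimes r}\otimes A\otimes I^{\otimes(m-r-2)})\circ\Delta_m=0$. (3) For each integer $r$ with $0\le r\le m-2$, $(I^{\otimes r}\otimes X\otimes I^{\otimes(m-r-2)})\circ\Delta_m=-\Delta_m$. (4) $\Delta_m\circ\Delta_m^*=\Sigma_m$. Here $\Delta_m^*:m\to0$ is the reflection of $\Delta_m$, and $\Sigma_r=\sum_{\pi\in\mathrm{Sym}_r}\varepsilon(\pi)\pi:r\to r$ is the total antisymmetriser, where the simple transposition $s_i$ is identified with $I^{\otimes(i-1)}\otimes X\otimes I^{\otimes(r-i-1)}$.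
   Formalization: F(Δ_m) is taken to be m!·Λ, since Λ itself contradicts relation (4); and the enhanced Brauer category is given two further relations: every morphism slides through a crossing strand (X is a natural symmetry), and * on 0→n is bending by caps; without them F is not faithful. *)

(* Defs.v *)
From Stdlib Require Import RelationClasses.
From mathcomp Require Export all_boot all_fingroup all_algebra reals complex.

Set Implicit Arguments.
Unset Strict Implicit.
Unset Printing Implicit Defensive.

Import GRing.Theory.
Local Open Scope ring_scope.

(* Categories whose Hom-sets are presented as a type together with an
   equivalence relation [heq], i.e. the Hom-set is the quotient hom / heq.   *)

Record category := Category {
  obj :> Type;
  hom : obj -> obj -> Type;
  heq : forall x y, hom x y -> hom x y -> Prop;
  idm : forall x, hom x x;
  compm : forall x y z, hom y z -> hom x y -> hom x z;
  heq_equiv : forall x y, Equivalence (@heq x y);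
  compm_heq : forall x y z (f f' : hom y z) (g g' : hom x y),
    heq f f' -> heq g g' -> heq (compm f g) (compm f' g');
  compm_idl : forall x y (f : hom x y), heq (compm (idm y) f) f;
  compm_idr : forall x y (f : hom x y), heq (compm f (idm x)) f;
  compmA : forall x y z t (f : hom z t) (g : hom y z) (h : hom x y),
    heq (compm f (compm g h)) (compm (compm f g) h)
}.

Arguments heq {c x y} f g.
Arguments idm {c} x.
Arguments compm {c x y z} f g.

Record is_functor (C D : category) (fo : C -> D)
    (fm : forall x y : C, hom x y -> hom (fo x) (fo y)) : Prop := IsFunctor {
  fm_heq : forall x y (f f' : hom x y), heq f f' -> heq (fm x y f) (fm x y f');
  fm_id : forall x, heq (fm x x (idm x)) (idm (fo x));
  fm_comp : forall x y z (f : hom y z) (g : hom x y),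
    heq (fm x z (compm f g)) (compm (fm y z f) (fm x y g))
}.

Record functor (C D : category) := Functor {
  fobj :> C -> D;
  fmor : forall x y : C, hom x y -> hom (fobj x) (fobj y);
  functorP : is_functor fmor
}.

Arguments fmor {C D} f {x y}.

Lemma is_functor_id (C : category) :
  @is_functor C C id (fun x y (f : hom x y) => f).
Proof. by split=> // *; apply: (@Equivalence_Reflexive _ _ (heq_equiv _ _)). Qed.

Lemma is_functor_comp (C D E : category) (G : functor D E) (F : functor C D) :
  @is_functor C E (fun x => G (F x)) (fun x y (f : hom x y) => fmor G (fmor F f)).
Proof.
have [Fh Fi Fc] := functorP F; have [Gh Gi Gc] := functorP G.
split=> [x y f f' /Fh/Gh //|x|x y z f g].
  exact: (@Equivalence_Transitive _ _ (heq_equiv _ _) _ _ _ (Gh _ _ _ _ (Fi x)) (Gi _)).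
exact: (@Equivalence_Transitive _ _ (heq_equiv _ _) _ _ _
          (Gh _ _ _ _ (Fc _ _ _ f g)) (Gc _ _ _ _ _)).
Qed.

Definition functor_id (C : category) := Functor (is_functor_id C).

Definition functor_comp (C D E : category) (G : functor D E) (F : functor C D) :=
  Functor (is_functor_comp G F).

Record nat_iso (C D : category) (F G : functor C D) := NatIso {
  ni_mor : forall x, hom (F x) (G x);
  ni_inv : forall x, hom (G x) (F x);
  ni_natural : forall x y (f : hom x y),
    heq (compm (ni_mor y) (fmor F f)) (compm (fmor G f) (ni_mor x));
  ni_morK : forall x, heq (compm (ni_inv x) (ni_mor x)) (idm (F x));
  ni_invK : forall x, heq (compm (ni_mor x) (ni_inv x)) (idm (G x))
}.

Definition is_equivalence (C D : category) (F : functor C D) : Prop :=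
  exists G : functor D C,
    inhabited (nat_iso (functor_comp G F) (functor_id C)) /\
    inhabited (nat_iso (functor_comp F G) (functor_id D)).

Section EnhancedBrauer.

Variables (K : comNzRingType) (m : nat).

(* Formal K-linear expressions in the generators; [gDs] is the reflection of
   [gD] and [Idn n] is the n-fold tensor power of the identity of 1.         *)

Inductive term : nat -> nat -> Type :=
| Idn n : term n n
| gU : term 0 2
| gA : term 2 0
| gX : term 2 2
| gD : term 0 m
| gDs : term m 0
| Comp i j k : term j k -> term i j -> term i k
| Tens i j k l : term i j -> term k l -> term (i + k) (j + l)
| Zero i j : term i j
| Add i j : term i j -> term i j -> term i j
| Scale i j : K -> term i j -> term i j.

Fixpoint star i j (t : term i j) : term j i :=
  match t with
  | Idn n => Idn n
  | gU => gA
  | gA => gU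
  | gX => gX
  | gD => gDs
  | gDs => gD
  | Comp _ _ _ f g => Comp (star g) (star f)
  | Tens _ _ _ _ f g => Tens (star f) (star g)
  | Zero i j => Zero j i
  | Add _ _ f g => Add (star f) (star g)
  | Scale _ _ a f => Scale a (star f)
  end.

(* Transport along equalities of objects, as for [castmx].                   *)
Definition castt i j i' j' (ei : i = i') (ej : j = j') (t : term i j) :
    term i' j' :=
  let: erefl in _ = j'' := ej return term i' j'' in
  let: erefl in _ = i'' := ei return term i'' j in t.

(* The simple transposition of the strands a and a+1 among n = a + 2 + k.    *)
Definition simple n a k (e : (a + (2 + k))%N = n) : term n n :=
  castt e e (Tens (Idn a) (Tens gX (Idn k))).

(* [lift s t]: the diagram t is a product of simple transpositions that
   represents the permutation s; (s * s')%g is "s, then s'".                 *)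
Inductive lift n : 'S_n -> term n n -> Prop :=
| lift1 : lift 1%g (Idn n)
| liftM (a b : 'I_n) k (e : (a + (2 + k))%N = n) (s : 'S_n) (t : term n n) :
    b = a.+1 :> nat -> lift s t ->
    lift (s * tperm a b)%g (Comp (simple e) t).

(* The first strand crosses the n others, from left to right.                *)
Fixpoint cross n : term (1 + n) (n + 1) :=
  match n with
  | 0 => Idn 1
  | n.+1 => Comp (Tens (Idn 1) (cross n)) (Tens gX (Idn n))
  end.

(* The n caps that join the a-th strand to the (n+a)-th strand, a < n.       *)
Fixpoint caps n : term (n + n) 0 :=
  match n with
  | 0 => Idn 0
  | n.+1 =>
    Comp (caps n)
      (Comp (Tens (Idn n) (Tens gA (Idn n)))
         (castt erefl (esym (addnA n 1 n.+1)) (Tens (cross n) (Idn n.+1))))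
  end.

Variable delta : K.

Local Notation I := (Idn 1).
Local Infix "∘" := Comp (at level 40, left associativity).
Local Infix "⊗" := Tens (at level 35, right associativity).

Reserved Notation "f ~ g" (at level 70).

Inductive eqv : forall i j, term i j -> term i j -> Prop :=
| eqv_refl i j (f : term i j) : f ~ f
| eqv_sym i j (f g : term i j) : f ~ g -> g ~ f
| eqv_trans i j (f g h : term i j) : f ~ g -> g ~ h -> f ~ h
| eqv_Comp i j k (f f' : term j k) (g g' : term i j) :
    f ~ f' -> g ~ g' -> f ∘ g ~ f' ∘ g'
| eqv_Tens i j k l (f f' : term i j) (g g' : term k l) :
    f ~ f' -> g ~ g' -> f ⊗ g ~ f' ⊗ g'
| eqv_Add i j (f f' g g' : term i j) :
    f ~ f' -> g ~ g' -> Add f g ~ Add f' g'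
| eqv_Scale i j a (f f' : term i j) : f ~ f' -> Scale a f ~ Scale a f'
| eqv_star i j (f f' : term i j) : f ~ f' -> star f ~ star f'
| eqv_AddA i j (f g h : term i j) : Add f (Add g h) ~ Add (Add f g) h
| eqv_AddC i j (f g : term i j) : Add f g ~ Add g f
| eqv_Add0 i j (f : term i j) : Add (Zero i j) f ~ f
| eqv_AddN i j (f : term i j) : Add (Scale (-1) f) f ~ Zero i j
| eqv_ScaleA i j a b (f : term i j) : Scale a (Scale b f) ~ Scale (a * b) f
| eqv_Scale1 i j (f : term i j) : Scale 1 f ~ f
| eqv_ScaleDl i j a b (f : term i j) :
    Scale (a + b) f ~ Add (Scale a f) (Scale b f)
| eqv_ScaleDr i j a (f g : term i j) :
    Scale a (Add f g) ~ Add (Scale a f) (Scale a g)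
| eqv_CompA i j k l (f : term k l) (g : term j k) (h : term i j) :
    f ∘ (g ∘ h) ~ (f ∘ g) ∘ h
| eqv_Comp1l i j (f : term i j) : Idn j ∘ f ~ f
| eqv_Comp1r i j (f : term i j) : f ∘ Idn i ~ f
| eqv_CompDl i j k (f g : term j k) (h : term i j) :
    Add f g ∘ h ~ Add (f ∘ h) (g ∘ h)
| eqv_CompDr i j k (f : term j k) (g h : term i j) :
    f ∘ Add g h ~ Add (f ∘ g) (f ∘ h)
| eqv_CompZl i j k a (f : term j k) (g : term i j) :
    Scale a f ∘ g ~ Scale a (f ∘ g)
| eqv_CompZr i j k a (f : term j k) (g : term i j) :
    f ∘ Scale a g ~ Scale a (f ∘ g)
| eqv_TensA i j i' j' i'' j'' (f : term i j) (g : term i' j')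
      (h : term i'' j'') :
    castt (addnA i i' i'') (addnA j j' j'') (f ⊗ (g ⊗ h)) ~ (f ⊗ g) ⊗ h
| eqv_Tens1l i j (f : term i j) : Idn 0 ⊗ f ~ f
| eqv_Tens1r i j (f : term i j) : castt (addn0 i) (addn0 j) (f ⊗ Idn 0) ~ f
| eqv_Tens11 i j : Idn i ⊗ Idn j ~ Idn (i + j)
| eqv_TensComp i j k i' j' k' (f : term j k) (g : term i j)
      (f' : term j' k') (g' : term i' j') :
    (f ∘ g) ⊗ (f' ∘ g') ~ (f ⊗ f') ∘ (g ⊗ g')
| eqv_TensDl i j k l (f g : term i j) (h : term k l) :
    Add f g ⊗ h ~ Add (f ⊗ h) (g ⊗ h)
| eqv_TensDr i j k l (f : term i j) (g h : term k l) :
    f ⊗ Add g h ~ Add (f ⊗ g) (f ⊗ h)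
| eqv_TensZl i j k l a (f : term i j) (g : term k l) :
    Scale a f ⊗ g ~ Scale a (f ⊗ g)
| eqv_TensZr i j k l a (f : term i j) (g : term k l) :
    f ⊗ Scale a g ~ Scale a (f ⊗ g)
(* X is the symmetry of the tensor category, hence natural (diagrams slide
   through a strand), and the duality star is the one given by A and U (the
   reflection of a diagram 0 -> n is obtained by bending its end points down).
   For diagrams built from I, U, A, X these follow from the relations below;
   for gD they do not.                                                        *)
| eqv_slide i j (f : term i j) : cross j ∘ (I ⊗ f) ~ (f ⊗ I) ∘ cross i
| eqv_bend n (f : term 0 n) : star f ~ caps n ∘ (f ⊗ Idn n)
| eqv_XX : gX ∘ gX ~ I ⊗ I
| eqv_braid :
    (gX ⊗ I) ∘ (I ⊗ gX) ∘ (gX ⊗ I) ~ (I ⊗ gX) ∘ (gX ⊗ I) ∘ (I ⊗ gX)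
| eqv_AX : gA ∘ gX ~ gA
| eqv_XU : gX ∘ gU ~ gU
| eqv_AU : gA ∘ gU ~ Scale delta (Idn 0)
| eqv_slideA : (gA ⊗ I) ∘ (I ⊗ gX) ~ (I ⊗ gA) ∘ (gX ⊗ I)
| eqv_slideU : (I ⊗ gX) ∘ (gU ⊗ I) ~ (gX ⊗ I) ∘ (I ⊗ gU)
| eqv_zigzagl : (gA ⊗ I) ∘ (I ⊗ gU) ~ I
| eqv_zigzagr : (I ⊗ gA) ∘ (gU ⊗ I) ~ I
| eqv_harmonic r k (e : (r + (2 + k))%N = m) :
    (Idn r ⊗ gA ⊗ Idn k) ∘ castt erefl (esym e) gD ~ Zero 0 (r + (0 + k))
| eqv_alternating r k (e : (r + (2 + k))%N = m) :
    simple e ∘ gD ~ Scale (-1) gD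
(* By eqv_XX and eqv_braid the right-hand side does not depend, up to ~, on
   the chosen lifts w.                                                        *)
| eqv_antisym (w : 'S_m -> term m m) :
    (forall s, lift s (w s)) ->
    gD ∘ star gD ~
      \big[@Add m m/Zero m m]_(s : 'S_m) Scale ((-1) ^+ odd_perm s) (w s)
where "f ~ g" := (eqv f g).

Lemma eqv_equiv i j : Equivalence (@eqv i j).
Proof.
split; [exact: eqv_refl | exact: eqv_sym | by move=> f g h; exact: eqv_trans].
Qed.

Definition enhanced_brauer : category :=
  Category eqv_equiv eqv_Comp eqv_Comp1l eqv_Comp1r eqv_CompA.

End EnhancedBrauer.

Arguments Idn {K m} n.
Arguments gU {K m}.
Arguments gA {K m}.
Arguments gX {K m}.
Arguments gD {K m}.
Arguments gDs {K m}.

Section TensorPowers.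

Variables (C : fieldType) (m : nat).

Local Notation V := 'cV[C]_m.

(* The r-th tensor power of V = C^m, in coordinates: x t is the coefficient
   of the tensor product of the t(0)-th, ..., t(r-1)-th standard basis vectors. *)
Definition tpow (r : nat) : Type := {ffun {ffun 'I_r -> 'I_m} -> C^o}.

Definition pure r (v : 'I_r -> V) : tpow r :=
  [ffun t : {ffun 'I_r -> 'I_m} => \prod_(a < r) v a (t a) 0].

Definition unit_tensor : tpow 0 := [ffun=> 1].

Definition pure2 (v w : V) : tpow 2 := pure (tnth [tuple v; w]).

Definition tens r s (x : tpow r) (y : tpow s) : tpow (r + s) :=
  [ffun t : {ffun 'I_(r + s) -> 'I_m} =>
     x [ffun a => t (lshift s a)] * y [ffun a => t (rshift r a)]].

(* sigma moves the a-th tensor factor to place sigma a. *)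
Definition tperm_act r (sigma : 'S_r) (x : tpow r) : tpow r :=
  [ffun t : {ffun 'I_r -> 'I_m} => x [ffun a => t (sigma a)]].

Definition antisymmetrise r (x : tpow r) : tpow r :=
  (r`!%:R)^-1 *: \sum_(sigma : 'S_r) (-1) ^+ odd_perm sigma *: tperm_act sigma x.

(* The diagonal action of a matrix: pure v is sent to pure (g *m v).         *)
Definition tact r (g : 'M[C]_m) (x : tpow r) : tpow r :=
  [ffun t : {ffun 'I_r -> 'I_m} =>
     \sum_(u : {ffun 'I_r -> 'I_m}) (\prod_(a < r) g (t a) (u a)) * x u].

Variable form : {symmetric V}.

Definition SO (g : 'M[C]_m) : Prop :=
  (forall v w : V, form (g *m v) (g *m w) = form v w) /\ \det g = 1.

Record SOhom (i j : nat) := SOHom {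
  sohom :> {linear tpow i -> tpow j};
  sohomP : forall g, SO g -> forall x, sohom (tact g x) = tact g (sohom x)
}.

Definition SOhom_id i : SOhom i i :=
  @SOHom i i [the {linear tpow i -> tpow i} of idfun] (fun g _ x => erefl).

Lemma SOhom_comp_subproof i j k (f : SOhom j k) (g : SOhom i j) h (Sh : SO h) x :
  (f \o g) (tact h x) = tact h ((f \o g) x).
Proof. by rewrite /= !sohomP. Qed.

Definition SOhom_comp i j k (f : SOhom j k) (g : SOhom i j) : SOhom i k :=
  @SOHom i k [the {linear tpow i -> tpow k} of f \o g] (SOhom_comp_subproof f g).

Definition SOhom_eq i j (f g : SOhom i j) : Prop := f =1 g.

Lemma SOhom_eq_equiv i j : Equivalence (@SOhom_eq i j).
Proof.
by split=> [f x|f g fg x|f g h fg gh x]; rewrite ?fg ?gh.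
Qed.

Lemma SOhom_comp_eq i j k (f f' : SOhom j k) (g g' : SOhom i j) :
  SOhom_eq f f' -> SOhom_eq g g' -> SOhom_eq (SOhom_comp f g) (SOhom_comp f' g').
Proof. by move=> ff' gg' x; rewrite /= gg' ff'. Qed.

(* The object r stands for the r-th tensor power of V. *)
Definition tensor_category : category :=
  @Category nat SOhom SOhom_eq SOhom_id SOhom_comp SOhom_eq_equiv SOhom_comp_eq
    (fun i j f x => erefl) (fun i j f x => erefl) (fun i j k l f g h x => erefl).

Definition Lambda (e : 'I_m -> V) : tpow m := antisymmetrise (pure e).

Record is_linear_tensor_functor
    (F : forall r s, term C m r s -> SOhom r s) : Prop := {
  lt_add : forall r s (f g : term C m r s) x,
    F r s (Add f g) x = F r s f x + F r s g x;
  lt_scale : forall r s a (f : term C m r s) x,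
    F r s (Scale a f) x = a *: F r s f x;
  lt_tens : forall r s r' s' (f : term C m r s) (g : term C m r' s') x y,
    F _ _ (Tens f g) (tens x y) = tens (F r s f x) (F r' s' g y)
}.

(* The factor m! normalises Lambda: with A_m = (m!)^-1 Sigma_m one has
   Lambda o Lambda^* = (m!)^-2 Sigma_m, whereas Delta_m o Delta_m^* = Sigma_m. *)
Record has_generator_values (e : 'I_m -> V)
    (F : forall r s, term C m r s -> SOhom r s) : Prop := {
  gv_I : forall v, F 1 1 (Idn 1) v = v;
  gv_X : forall v w, F 2 2 gX (pure2 v w) = pure2 w v;
  gv_A : forall v w, F 2 0 gA (pure2 v w) = form v w *: unit_tensor;
  gv_U : F 0 2 gU unit_tensor = \sum_(i < m) pure2 (e i) (e i);
  gv_D : F 0 m gD unit_tensor = m`!%:R *: Lambda e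
}.

End TensorPowers.

(* Main.v *)
From HB Require Import structures.
Require Import Defs.
From mathcomp Require Import boolp generic_quotient zify ring.

(** Since [e] is orthonormal, the functor is conjugate, through the matrix
    with columns e_1, ..., e_m, to the evaluation of diagrams in the standard
    coordinates of C^m: swaps, cups and caps become Kronecker deltas, and
    Delta_m becomes the determinant of the matrix formed by the letters of a
    word.  Evaluation respects the relations ([soundness]), so the functor
    exists.  It is unique because its value on the reflection of Delta_m is
    forced by bending.  The content of the theorem is that evaluation is
    bijective on Hom-spaces.

    Both halves rest on one statement about modules over the diagram category,
    [vanishing].  The diagram [omega], the sum over j of the swap of the
    strands 0 and j minus the cup-cap through them, is the split Casimir
    element of so(m), acting on the first strand and on the others.  Suppose
    that subspaces K_n of a module are stable under all diagrams, that
    K_0 = 0, and that (m - 1) x + omega x = 0 for all x in K.  Then K = 0.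
    Indeed, let x be in K_n.  By induction on n the contractions of x are 0,
    and so is its pairing with the reflection of Delta_m.  The first fact
    leaves of omega only the swaps, so that the sum of (i k) x over all
    k <> i is (1 - m) x for every i; the second one kills the elements that
    are antisymmetric in m slots, because Delta_m Delta_m^* is the
    antisymmetriser.  Now let x be antisymmetric in the slots i < j, where
    j < m, and let k be another slot.  Then x minus the sum of (i k) x over
    i < j is antisymmetric in j + 1 slots, hence 0 by descending induction
    on j; summed over k this gives ((n - j) + j (m - j)) x = 0, and x = 0.

    Faithfulness is the case of the module n |-> Hom 0 n and the kernel of
    evaluation.  Here the identity (m - 1) x + omega x = 0 holds for every
    diagram x without inputs ([casimir_identity]): it is a contraction of
    omega (1 (x) x) = 0, the infinitesimal invariance of diagrams, which need
    only be checked on the building blocks of x.  These are cups, swaps and at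
    most one copy of Delta_m ([all_spanned]): a pair of copies is rewritten
    with Delta_m Delta_m^*, and caps are absorbed ([double_coset]).  For
    Delta_m itself the invariance is reduced to the vanishing of an
    endomorphism of one strand ([omega_vol]), and bending it into Hom 0 2,
    which is spanned by the cup and, if m = 2, by Delta_m, makes this a
    computation.

    Fullness is the case of the module of tensor powers and of the invariant
    tensors orthogonal to all diagrams.  There the Casimir identity comes from
    invariance under rational rotations, differentiated as an identity of
    polynomials ([SO_inv_so_act_neq]).  Hence the diagrams exhaust the
    invariants ([SO_inv_is_diagram]).  Bending the inputs to outputs extends
    both results from Hom 0 n to all Hom-spaces. *)

Set Implicit Arguments.
Unset Strict Implicit.
Unset Printing Implicit Defensive.

Import GRing.Theory Num.Theory.
Local Open Scope ring_scope.
Local Open Scope quotient_scope.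

(** * Hom-spaces as quotients of formal diagrams *)

(** The operations on classes are locked: otherwise a failing comparison of
    two large diagrams would unfold them down to chosen representatives. *)
Fact hom_key : unit. Proof. exact: tt. Qed.

Section HomSpaces.
Variables (C : numFieldType) (m : nat).
Local Notation T := (term C m).
Local Notation eqvm := (@eqv C m (m%:R)).

(** A boolean form of the relation, as quotient types require. *)
Definition term_eqv i j (f g : T i j) : bool := `[< eqvm f g >].
HB.instance Definition _ i j := gen_eqMixin (T i j).
HB.instance Definition _ i j := gen_choiceMixin (T i j).

Lemma term_eqv_refl i j : reflexive (@term_eqv i j).
Proof. by move=> f; apply/asboolP; apply: eqv_refl. Qed.

Lemma term_eqv_sym i j : symmetric (@term_eqv i j).
Proof. by move=> f g; apply/asboolP/asboolP; apply: eqv_sym. Qed.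

Lemma term_eqv_trans i j : transitive (@term_eqv i j).
Proof. by move=> f g h /asboolP gf /asboolP fh; apply/asboolP; apply: eqv_trans gf fh. Qed.

Canonical term_eqv_equiv i j := EquivRel (@term_eqv i j) (@term_eqv_refl i j) (@term_eqv_sym i j)
  (@term_eqv_trans i j).
Definition Hom i j : Type := {eq_quot (term_eqv_equiv i j)}.
HB.instance Definition _ i j := Choice.on (Hom i j).
HB.instance Definition _ i j := EqQuotient.on (Hom i j).
Definition cls i j (f : T i j) : Hom i j := \pi_(Hom i j) f.
Definition rep i j (f : Hom i j) : T i j := repr f.

Lemma repK i j (f : Hom i j) : cls (rep f) = f.
Proof. exact: reprK. Qed.

Lemma clsP i j (f g : T i j) : eqvm f g <-> cls f = cls g.
Proof.
split=> [fg|]; first by apply/eqquotP/asboolP.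
by move=> /eqquotP/asboolP.
Qed.

Lemma rep_cls i j (f : T i j) : eqvm (rep (cls f)) f.
Proof. by apply/clsP; rewrite repK. Qed.

Lemma hom_ind i j (Q : Hom i j -> Prop) : (forall t, Q (cls t)) -> forall f, Q f.
Proof. by move=> h f; rewrite -(repK f). Qed.

Definition hadd i j (f g : Hom i j) : Hom i j :=
  locked_with hom_key (cls (Add (rep f) (rep g))).
Definition hscale i j a (f : Hom i j) : Hom i j :=
  locked_with hom_key (cls (Scale a (rep f))).
Definition hzero i j : Hom i j := cls (Zero _ _ i j).

Lemma haddE i j (f g : T i j) : hadd (cls f) (cls g) = cls (Add f g).
Proof. by rewrite [LHS]unlock; apply/clsP/eqv_Add; apply: rep_cls. Qed.

Lemma hscaleE i j a (f : T i j) : hscale a (cls f) = cls (Scale a f).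
Proof. by rewrite [LHS]unlock; apply/clsP/eqv_Scale; apply: rep_cls. Qed.

Lemma haddA i j : associative (@hadd i j).
Proof.
elim/hom_ind=> f; elim/hom_ind=> g; elim/hom_ind=> h.
by rewrite !haddE; apply/clsP/eqv_AddA.
Qed.

Lemma haddC i j : commutative (@hadd i j).
Proof. by elim/hom_ind=> f; elim/hom_ind=> g; rewrite !haddE; apply/clsP/eqv_AddC. Qed.

Lemma hadd0 i j : left_id (hzero i j) (@hadd i j).
Proof. by elim/hom_ind=> f; rewrite haddE; apply/clsP/eqv_Add0. Qed.

Lemma haddN i j : left_inverse (hzero i j) (@hscale i j (-1)) (@hadd i j).
Proof. by elim/hom_ind=> f; rewrite hscaleE haddE; apply/clsP/eqv_AddN. Qed.
HB.instance Definition _ i j := GRing.isZmodule.Build (Hom i j)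
  (@haddA i j) (@haddC i j) (@hadd0 i j) (@haddN i j).

Lemma hscaleA i j a b (f : Hom i j) : hscale a (hscale b f) = hscale (a * b) f.
Proof. by elim/hom_ind: f => f; rewrite !hscaleE; apply/clsP/eqv_ScaleA. Qed.

Lemma hscale1 i j : left_id 1 (@hscale i j).
Proof. by elim/hom_ind=> f; rewrite !hscaleE; apply/clsP/eqv_Scale1. Qed.

Lemma hscaleDr i j : right_distributive (@hscale i j) +%R.
Proof.
move=> a; elim/hom_ind=> f; elim/hom_ind=> g.
by rewrite /GRing.add /= !(hscaleE, haddE); apply/clsP/eqv_ScaleDr.
Qed.

Lemma hscaleDl i j (v : Hom i j) : {morph (@hscale i j)^~ v : a b / a + b}.
Proof.
elim/hom_ind: v => f a b; rewrite [in RHS]/GRing.add /= !(hscaleE, haddE).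
exact/clsP/eqv_ScaleDl.
Qed.
HB.instance Definition _ i j := GRing.Zmodule_isLmodule.Build C (Hom i j)
  (@hscaleA i j) (@hscale1 i j) (@hscaleDr i j) (@hscaleDl i j).

Lemma clsD i j (f g : T i j) : cls (Add f g) = cls f + cls g.
Proof. by rewrite -haddE. Qed.

Lemma clsZ i j a (f : T i j) : cls (Scale a f) = a *: cls f.
Proof. by rewrite -hscaleE. Qed.

Lemma cls0 i j : cls (Zero _ _ i j) = 0.
Proof. by []. Qed.

Definition hcomp i j k (f : Hom j k) (g : Hom i j) : Hom i k :=
  locked_with hom_key (cls (Comp (rep f) (rep g))).
Definition htens i j k l (f : Hom i j) (g : Hom k l) : Hom (i + k) (j + l) :=
  locked_with hom_key (cls (Tens (rep f) (rep g))).
Definition hstar i j (f : Hom i j) : Hom j i :=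
  locked_with hom_key (cls (star (rep f))).
Definition hid n : Hom n n := cls (Idn n).
Definition hcast i j i' j' (ei : i = i') (ej : j = j') (f : Hom i j) : Hom i' j' :=
  let: erefl in _ = j'' := ej return Hom i' j'' in
  let: erefl in _ = i'' := ei return Hom i'' j in f.

Local Notation "f ∘ g" := (hcomp f g) (at level 40, left associativity).
Local Notation "f ⊗ g" := (htens f g) (at level 35, right associativity).

Lemma cls_comp i j k (f : T j k) (g : T i j) : cls (Comp f g) = cls f ∘ cls g.
Proof. by rewrite [RHS]unlock; apply/esym/clsP/eqv_Comp; apply: rep_cls. Qed.

Lemma cls_tens i j k l (f : T i j) (g : T k l) : cls (Tens f g) = cls f ⊗ cls g.
Proof. by rewrite [RHS]unlock; apply/esym/clsP/eqv_Tens; apply: rep_cls. Qed.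

Lemma cls_star i j (f : T i j) : cls (star f) = hstar (cls f).
Proof. by rewrite [RHS]unlock; apply/esym/clsP/eqv_star; apply: rep_cls. Qed.

Lemma cls_cast i j i' j' (ei : i = i') (ej : j = j') (f : T i j) :
  cls (castt ei ej f) = hcast ei ej (cls f).
Proof. by case: _ / ei; case: _ / ej. Qed.

Lemma hcast_id i j (ei : i = i) (ej : j = j) (f : Hom i j) : hcast ei ej f = f.
Proof. by rewrite (eq_irrelevance ei erefl) (eq_irrelevance ej erefl). Qed.

Lemma hcompA i j k l (f : Hom k l) (g : Hom j k) (h : Hom i j) : f ∘ (g ∘ h) = f ∘ g ∘ h.
Proof.
elim/hom_ind: f => f; elim/hom_ind: g => g; elim/hom_ind: h => h; rewrite -!cls_comp.
exact/clsP/eqv_CompA.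
Qed.

Lemma hcomp1l i j (f : Hom i j) : hid j ∘ f = f.
Proof. by elim/hom_ind: f => f; rewrite -!cls_comp; apply/clsP/eqv_Comp1l. Qed.

Lemma hcomp1r i j (f : Hom i j) : f ∘ hid i = f.
Proof. by elim/hom_ind: f => f; rewrite -!cls_comp; apply/clsP/eqv_Comp1r. Qed.

Lemma hcompDl i j k (f g : Hom j k) (h : Hom i j) : (f + g) ∘ h = f ∘ h + g ∘ h.
Proof.
elim/hom_ind: f => f; elim/hom_ind: g => g; elim/hom_ind: h => h.
by rewrite -!(clsD, cls_comp); apply/clsP/eqv_CompDl.
Qed.

Lemma hcompDr i j k (f : Hom j k) (g h : Hom i j) : f ∘ (g + h) = f ∘ g + f ∘ h.
Proof.
elim/hom_ind: f => f; elim/hom_ind: g => g; elim/hom_ind: h => h.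
by rewrite -!(clsD, cls_comp); apply/clsP/eqv_CompDr.
Qed.

Lemma hcompZl i j k a (f : Hom j k) (h : Hom i j) : (a *: f) ∘ h = a *: (f ∘ h).
Proof.
elim/hom_ind: f => f; elim/hom_ind: h => h.
by rewrite -!(clsZ, cls_comp); apply/clsP/eqv_CompZl.
Qed.

Lemma hcompZr i j k a (f : Hom j k) (h : Hom i j) : f ∘ (a *: h) = a *: (f ∘ h).
Proof.
elim/hom_ind: f => f; elim/hom_ind: h => h.
by rewrite -!(clsZ, cls_comp); apply/clsP/eqv_CompZr.
Qed.

Lemma htensDl i j k l (f g : Hom j k) (h : Hom i l) : (f + g) ⊗ h = f ⊗ h + g ⊗ h.
Proof.
elim/hom_ind: f => f; elim/hom_ind: g => g; elim/hom_ind: h => h.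
by rewrite -!(clsD, cls_tens); apply/clsP/eqv_TensDl.
Qed.

Lemma htensDr i j k l (f : Hom j k) (g h : Hom i l) : f ⊗ (g + h) = f ⊗ g + f ⊗ h.
Proof.
elim/hom_ind: f => f; elim/hom_ind: g => g; elim/hom_ind: h => h.
by rewrite -!(clsD, cls_tens); apply/clsP/eqv_TensDr.
Qed.

Lemma htensZl i j k l a (f : Hom j k) (h : Hom i l) : (a *: f) ⊗ h = a *: (f ⊗ h).
Proof.
elim/hom_ind: f => f; elim/hom_ind: h => h.
by rewrite -!(clsZ, cls_tens); apply/clsP/eqv_TensZl.
Qed.

Lemma htensZr i j k l a (f : Hom j k) (h : Hom i l) : f ⊗ (a *: h) = a *: (f ⊗ h).
Proof.
elim/hom_ind: f => f; elim/hom_ind: h => h.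
by rewrite -!(clsZ, cls_tens); apply/clsP/eqv_TensZr.
Qed.

HB.instance Definition _ i j k (f : Hom j k) :=
  GRing.isSemilinear.Build C (Hom i j) (Hom i k) _ (@hcomp i j k f)
   ((fun a => hcompZr a f), (hcompDr f)).
Definition hcompr i j k (h : Hom i j) (f : Hom j k) := f ∘ h.
HB.instance Definition _ i j k (h : Hom i j) :=
  GRing.isSemilinear.Build C (Hom j k) (Hom i k) _ (@hcompr i j k h)
   ((fun a f => hcompZl a f h), (fun f g => hcompDl f g h)).
HB.instance Definition _ i j k l (f : Hom i j) :=
  GRing.isSemilinear.Build C (Hom k l) (Hom _ _) _ (@htens i j k l f)
   ((fun a => htensZr a f), (htensDr f)).
Definition htensr i j k l (h : Hom k l) (f : Hom i j) := f ⊗ h.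
HB.instance Definition _ i j k l (h : Hom k l) :=
  GRing.isSemilinear.Build C (Hom i j) (Hom _ _) _ (@htensr i j k l h)
   ((fun a f => htensZl a f h), (fun f g => htensDl f g h)).

Lemma hcompBr i j k (f : Hom j k) (g h : Hom i j) : f ∘ (g - h) = f ∘ g - f ∘ h.
Proof. exact: raddfB. Qed.

Lemma hcompBl i j k (f g : Hom j k) (h : Hom i j) : (f - g) ∘ h = f ∘ h - g ∘ h.
Proof. exact: (raddfB (hcompr h)). Qed.

Lemma hcomp0r i j k (f : Hom j k) : f ∘ (0 : Hom i j) = 0.
Proof. exact: raddf0. Qed.

Lemma hcomp0l i j k (h : Hom i j) : (0 : Hom j k) ∘ h = 0.
Proof. exact: (raddf0 (hcompr h)). Qed.

Lemma hcomp_sumr i j k I (r : seq I) (Q : pred I) (F : I -> Hom i j) (f : Hom j k) :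
  f ∘ (\sum_(x <- r | Q x) F x) = \sum_(x <- r | Q x) f ∘ F x.
Proof. exact: raddf_sum. Qed.

Lemma hcomp_suml i j k I (r : seq I) (Q : pred I) (F : I -> Hom j k) (h : Hom i j) :
  (\sum_(x <- r | Q x) F x) ∘ h = \sum_(x <- r | Q x) F x ∘ h.
Proof. exact: (raddf_sum (hcompr h)). Qed.

Lemma htensA i j i' j' i'' j'' (f : Hom i j) (g : Hom i' j') (h : Hom i'' j'') :
  hcast (addnA i i' i'') (addnA j j' j'') (f ⊗ (g ⊗ h)) = (f ⊗ g) ⊗ h.
Proof.
elim/hom_ind: f => f; elim/hom_ind: g => g; elim/hom_ind: h => h.
by rewrite -!(cls_tens, cls_cast); apply/clsP/eqv_TensA.
Qed.

Lemma htens1l i j (f : Hom i j) : hid 0 ⊗ f = f.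
Proof. by elim/hom_ind: f => f; rewrite -cls_tens; apply/clsP/eqv_Tens1l. Qed.

Lemma htens1r i j (f : Hom i j) : hcast (addn0 i) (addn0 j) (f ⊗ hid 0) = f.
Proof. by elim/hom_ind: f => f; rewrite -cls_tens -cls_cast; apply/clsP/eqv_Tens1r. Qed.

Lemma htens11 i j : hid i ⊗ hid j = hid (i + j).
Proof. by rewrite -cls_tens; apply/clsP/eqv_Tens11. Qed.

Lemma htens_comp i j k i' j' k' (f : Hom j k) (g : Hom i j) (f' : Hom j' k') (g' : Hom i' j') :
  (f ∘ g) ⊗ (f' ∘ g') = (f ⊗ f') ∘ (g ⊗ g').
Proof.
elim/hom_ind: f => f; elim/hom_ind: g => g; elim/hom_ind: f' => f'; elim/hom_ind: g' => g'.
by rewrite -!(cls_tens, cls_comp); apply/clsP/eqv_TensComp.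
Qed.

Lemma htensA_cast i j i' j' i'' j'' (f : Hom i j) (g : Hom i' j') (h : Hom i'' j'')
  (e : (i + (i' + i'') = i + i' + i'')%N) (e' : (j + (j' + j'') = j + j' + j'')%N) :
  hcast e e' (f ⊗ (g ⊗ h)) = (f ⊗ g) ⊗ h.
Proof. by rewrite -htensA (eq_irrelevance e (addnA i i' i'')) (eq_irrelevance e' (addnA j j' j'')).
  Qed.

(** When the source and the target of the first factor are numerals, both
    index equations hold by computation, and associativity of the tensor
    product needs no transport. *)
Lemma htensA11 i' j' i'' j'' (f : Hom 1 1) (g : Hom i' j') (h : Hom i'' j'') :
  f ⊗ (g ⊗ h) = (f ⊗ g) ⊗ h.
Proof. exact: (htensA_cast f g h erefl erefl). Qed.

Lemma htensA22 i' j' i'' j'' (f : Hom 2 2) (g : Hom i' j') (h : Hom i'' j'') :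
  f ⊗ (g ⊗ h) = (f ⊗ g) ⊗ h.
Proof. exact: (htensA_cast f g h erefl erefl). Qed.

Lemma htensA20 i' j' i'' j'' (f : Hom 2 0) (g : Hom i' j') (h : Hom i'' j'') :
  f ⊗ (g ⊗ h) = (f ⊗ g) ⊗ h.
Proof. exact: (htensA_cast f g h erefl erefl). Qed.

Lemma htensA02 i' j' i'' j'' (f : Hom 0 2) (g : Hom i' j') (h : Hom i'' j'') :
  f ⊗ (g ⊗ h) = (f ⊗ g) ⊗ h.
Proof. exact: (htensA_cast f g h erefl erefl). Qed.

End HomSpaces.

(** * Diagrams on the first strands *)

Section Strands.
Variables (C : numFieldType) (m : nat).
Local Notation H := (Hom C m).
Local Notation id_ := (hid C m).
Local Notation "f ∘ g" := (hcomp f g) (at level 40, left associativity).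
Local Notation "f ⊗ g" := (htens f g) (at level 35, right associativity).

Definition hU : H 0 2 := cls gU.
Definition hA : H 2 0 := cls gA.
Definition hX : H 2 2 := cls gX.
Definition hD : H 0 m := cls gD.
Definition hDs : H m 0 := cls gDs.

(** Positions are counted from the left, because a strand added on the left
    changes n into n.+1 by computation. A diagram at position a is then a + 1
    fold nesting of definitions rather than a term with transports. *)
Definition lpad i j (f : H i j) : H i.+1 j.+1 := id_ 1 ⊗ f.
Definition rpad k i j (f : H i j) : H (i + k) (j + k) := f ⊗ id_ k.
Definition swap0 n : H n.+2 n.+2 := rpad n hX.
Definition cup0 n : H n n.+2 := rpad n hU.
Definition cap0 n : H n.+2 n := rpad n hA.

Lemma rpad_comp n i j k (f : H j k) (g : H i j) : rpad n (f ∘ g) = rpad n f ∘ rpad n g.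
Proof. by rewrite /rpad -htens_comp hcomp1l. Qed.

Lemma rpad_id n i : rpad n (id_ i) = id_ (i + n).
Proof. exact: htens11. Qed.

Lemma rpadZ n i j a (f : H i j) : rpad n (a *: f) = a *: rpad n f.
Proof. exact: htensZl. Qed.

Lemma lpad_comp i j k (f : H j k) (g : H i j) : lpad (f ∘ g) = lpad f ∘ lpad g.
Proof. by rewrite /lpad -{1}(hcomp1l (id_ 1)); exact: (htens_comp (id_ 1) (id_ 1) f g). Qed.

Lemma lpad_id i : lpad (id_ i) = id_ i.+1.
Proof. exact: (htens11 C m 1 i). Qed.

Lemma lpadD i j (f g : H i j) : lpad (f + g) = lpad f + lpad g.
Proof. exact: (htensDr (id_ 1)). Qed.

Lemma lpadB i j (f g : H i j) : lpad (f - g) = lpad f - lpad g.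
Proof. exact: (raddfB (htens (id_ 1))). Qed.

Lemma lpadZ i j a (f : H i j) : lpad (a *: f) = a *: lpad f. Proof. exact: (htensZr a (id_ 1)). Qed.

Lemma lpad0 i j : lpad (0 : H i j) = 0. Proof. exact: (raddf0 (htens (id_ 1))). Qed.

Lemma lpad_sum i j I (r : seq I) (Q : pred I) (F : I -> H i j) :
  lpad (\sum_(x <- r | Q x) F x) = \sum_(x <- r | Q x) lpad (F x).
Proof. exact: (raddf_sum (htens (id_ 1))). Qed.

Lemma lpad_rpad n i j (f : H i j) : lpad (rpad n f) = rpad n (lpad f).
Proof. exact: htensA11. Qed.

Lemma swap0S n : swap0 n.+1 = rpad n (swap0 1).
Proof. by rewrite /swap0 /rpad -htensA22 htens11. Qed.

Lemma cup0S n : cup0 n.+1 = rpad n (cup0 1).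
Proof. by rewrite /cup0 /rpad -htensA02 htens11. Qed.

Lemma cap0S n : cap0 n.+1 = rpad n (cap0 1).
Proof. by rewrite /cap0 /rpad -htensA20 htens11. Qed.

Lemma lpad2 i j (f : H i j) : lpad (lpad f) = id_ 2 ⊗ f.
Proof.
by rewrite -(htens11 C m 1 1); exact: (htensA11 (id_ 1) (id_ 1) f).
Qed.

(** The interchange law, here and in the next two lemmas: what happens on the
    first two strands commutes with what happens on the others. *)
Lemma swap0_nat i j (f : H i j) : swap0 j ∘ lpad (lpad f) = lpad (lpad f) ∘ swap0 i.
Proof.
rewrite lpad2 /swap0 /rpad; transitivity (hX ⊗ f).
  by rewrite -{2}(hcomp1r hX) -{2}(hcomp1l f); exact: esym (htens_comp hX (id_ 2) (id_ j) f).
by rewrite -{1}(hcomp1l hX) -{1}(hcomp1r f); exact: (htens_comp (id_ 2) hX f (id_ i)).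
Qed.

Lemma cup0_nat i j (f : H i j) : cup0 j ∘ f = lpad (lpad f) ∘ cup0 i.
Proof.
rewrite lpad2 /cup0 /rpad; transitivity (hU ⊗ f).
  by rewrite -{1}(htens1l f) -{2}(hcomp1r hU) -{2}(hcomp1l f);
    exact: esym (htens_comp hU (id_ 0) (id_ j) f).
by rewrite -{1}(hcomp1l hU) -{1}(hcomp1r f); exact: (htens_comp (id_ 2) hU f (id_ i)).
Qed.

Lemma cap0_nat i j (f : H i j) : cap0 j ∘ lpad (lpad f) = f ∘ cap0 i.
Proof.
rewrite lpad2 /cap0 /rpad; transitivity (hA ⊗ f).
  by rewrite -{2}(hcomp1r hA) -{2}(hcomp1l f); exact: esym (htens_comp hA (id_ 2) (id_ j) f).
by rewrite -{2}(htens1l f) -{1}(hcomp1l hA) -{1}(hcomp1r f);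
  exact: (htens_comp (id_ 0) hA f (id_ i)).
Qed.

Lemma swap0K n : swap0 n ∘ swap0 n = id_ n.+2.
Proof.
rewrite -(rpad_comp n hX hX) -(rpad_id n 2); apply: (congr1 (@rpad n 2 2)).
by rewrite -cls_comp -(htens11 C m 1 1) -cls_tens; apply/clsP/eqv_XX.
Qed.

Lemma lpad_swap0K n : lpad (swap0 n) ∘ lpad (swap0 n) = id_ n.+3.
Proof. by rewrite -lpad_comp swap0K lpad_id. Qed.

Lemma swap0_braid n :
  swap0 n.+1 ∘ lpad (swap0 n) ∘ swap0 n.+1 = lpad (swap0 n) ∘ swap0 n.+1 ∘ lpad (swap0 n).
Proof.
rewrite swap0S (lpad_rpad n hX) -!(rpad_comp n (_ : H 3 3) (_ : H 3 3));
  apply: (congr1 (@rpad n 3 3)).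
by rewrite /swap0 /rpad /lpad -!cls_tens -!cls_comp; apply/clsP/eqv_braid.
Qed.

Lemma cap0_swap0 n : cap0 n ∘ swap0 n = cap0 n.
Proof. by rewrite -(rpad_comp n hA hX); apply: (congr1 (@rpad n 2 0)); rewrite -cls_comp;
  apply/clsP/eqv_AX. Qed.

Lemma swap0_cup0 n : swap0 n ∘ cup0 n = cup0 n.
Proof. by rewrite -(rpad_comp n hX hU); apply: (congr1 (@rpad n 0 2)); rewrite -cls_comp;
  apply/clsP/eqv_XU. Qed.

Lemma cap0_cup0 n : cap0 n ∘ cup0 n = m%:R *: id_ n.
Proof.
rewrite -(rpad_comp n hA hU).
have -> : hA ∘ hU = m%:R *: id_ 0 by rewrite -cls_comp -clsZ; apply/clsP/eqv_AU.
by rewrite rpadZ rpad_id.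
Qed.

Lemma cap0_slide n : cap0 n.+1 ∘ lpad (swap0 n) = lpad (cap0 n) ∘ swap0 n.+1.
Proof.
rewrite swap0S cap0S (lpad_rpad n hX) (lpad_rpad n hA) -!(rpad_comp n (_ : H 3 1) (_ : H 3 3));
  apply: (congr1 (@rpad n 3 1)).
by rewrite /swap0 /cap0 /rpad /lpad -!cls_tens -!cls_comp; apply/clsP/eqv_slideA.
Qed.

Lemma cup0_slide n : lpad (swap0 n) ∘ cup0 n.+1 = swap0 n.+1 ∘ lpad (cup0 n).
Proof.
rewrite swap0S cup0S (lpad_rpad n hX) (lpad_rpad n hU) -!(rpad_comp n (_ : H 3 3) (_ : H 1 3));
  apply: (congr1 (@rpad n 1 3)).
by rewrite /swap0 /cup0 /rpad /lpad -!cls_tens -!cls_comp; apply/clsP/eqv_slideU.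
Qed.

Lemma zigzagl n : cap0 n.+1 ∘ lpad (cup0 n) = id_ n.+1.
Proof.
rewrite cap0S (lpad_rpad n hU) -!(rpad_comp n (_ : H 3 1) (_ : H 1 3)) -(rpad_id n 1);
  apply: (congr1 (@rpad n 1 1)).
by rewrite /cup0 /cap0 /rpad /lpad -!cls_tens -!cls_comp; apply/clsP/eqv_zigzagl.
Qed.

Lemma zigzagr n : lpad (cap0 n) ∘ cup0 n.+1 = id_ n.+1.
Proof.
rewrite cup0S (lpad_rpad n hA) -!(rpad_comp n (_ : H 3 1) (_ : H 1 3)) -(rpad_id n 1);
  apply: (congr1 (@rpad n 1 1)).
by rewrite /cup0 /cap0 /rpad /lpad -!cls_tens -!cls_comp; apply/clsP/eqv_zigzagr.
Qed.

End Strands.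

(** * Permutations and adjacent transpositions *)

Section PermLemmas.

Lemma tperm_lift n (k : 'I_n.+1) (a b : 'I_n) :
  tperm (fintype.lift k a) (fintype.lift k b) = lift_perm k k (tperm a b).
Proof.
apply/permP=> i; case: (unliftP k i) => [j ->|->].
  rewrite lift_perm_lift; case: (tpermP a b j) => [->|->|ja jb].
  - by rewrite tpermL.
  - by rewrite tpermR.
  - by rewrite tpermD // (inj_eq (@lift_inj _ k)) eq_sym; apply/eqP.
by rewrite lift_perm_id tpermD // eq_sym neq_lift.
Qed.

(** Removing a from the source and its neighbour b from the target leaves an
    order-preserving bijection. *)
Lemma tperm_adj n (a b : 'I_n.+1) : b = a.+1 :> nat -> tperm a b = lift_perm a b 1.
Proof.
move=> ab; apply/permP=> i; case: (unliftP a i) => [j ->|->]; last first.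
  by rewrite tpermL lift_perm_id.
rewrite lift_perm_lift perm1; apply: val_inj => /=.
case: tpermP => [/(congr1 val)|/(congr1 val)|]; rewrite /= /bump.
- by move=> e; move: (ltn_ord j); lia.
- by move=> e; move: (ltn_ord j); lia.
move=> /eqP; rewrite -val_eqE /= /bump => h1 /eqP; rewrite -val_eqE /= /bump.
by lia.
Qed.

Definition rem_fun n (s : 'S_n.+1) (i : 'I_n) : 'I_n :=
  odflt i (unlift (s ord0) (s (fintype.lift ord0 i))).

Lemma rem_funE n (s : 'S_n.+1) i :
  fintype.lift (s ord0) (rem_fun s i) = s (fintype.lift ord0 i).
Proof.
rewrite /rem_fun; case: unliftP => [j -> //|/perm_inj/eqP].
by rewrite eq_sym (negbTE (neq_lift _ _)).
Qed.

Lemma rem_inj n (s : 'S_n.+1) : injective (rem_fun s).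
Proof.
move=> i j /(congr1 (fintype.lift (s ord0))); rewrite !rem_funE.
by move=> /perm_inj/lift_inj.
Qed.

(** The effect of s on the strands other than the first, renumbered in order.
    *)
Definition perm_rem n (s : 'S_n.+1) : 'S_n := perm (@rem_inj n s).

Lemma perm_remK n (s : 'S_n.+1) : lift_perm ord0 (s ord0) (perm_rem s) = s.
Proof.
apply/permP=> i; case: (unliftP ord0 i) => [j ->|->]; last by rewrite lift_perm_id.
by rewrite lift_perm_lift permE rem_funE.
Qed.

Lemma lift_permK n (k : 'I_n.+1) s : perm_rem (lift_perm ord0 k s) = s.
Proof.
apply/permP=> i; apply: (@lift_inj _ k).
by rewrite -(lift_perm_lift ord0 k s) permE -rem_funE lift_perm_id.
Qed.

(** Transpositions generate the symmetric group, and a long one is the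
    conjugate of a shorter one by an adjacent one. *)
Lemma adj_ind n (Q : 'S_n -> Prop) : Q 1%g ->
  (forall s (a b : 'I_n), b = a.+1 :> nat -> Q s -> Q (s * tperm a b)%g) ->
  forall s, Q s.
Proof.
move=> Q1 QM.
have QT d : forall s (a b : 'I_n), (b = a + d.+1 :> nat)%N -> Q s -> Q (s * tperm a b)%g.
  elim: d => [|d IHd] s a b ab Qs; first by apply: QM Qs; lia.
  have ltc : (a + d.+1 < n)%N by move: (ltn_ord b); lia.
  pose c := Ordinal ltc.
  have -> : tperm a b = (tperm c b * tperm a c * tperm c b)%g.
    rewrite -{1}(tpermV c b) -mulgA -/(conjg _ _) tpermJ tpermL.
    by rewrite tpermD // -val_eqE /=; lia.
  have Qs' := Qs; rewrite !mulgA; apply: (QM); first by rewrite /c /=; lia.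
  by apply: IHd; [rewrite /c /=; lia|apply: (QM _ _ _ _ Qs') => //; rewrite /c /=; lia].
have QT2 s (a b : 'I_n) : Q s -> Q (s * tperm a b)%g.
  case: (ltngtP a b) => ab Qs.
  - by apply: (QT (b - a.+1)%N) => //; lia.
  - by rewrite tpermC; apply: (QT (a - b.+1)%N) => //; lia.
  - by rewrite (val_inj ab) tperm1 mulg1.
move=> s; case: (prod_tpermP s) => ts -> _.
elim/last_ind: ts => [|ts t IH]; first by rewrite big_nil.
by rewrite -cats1 big_cat /= big_seq1; apply: QT2.
Qed.

End PermLemmas.

(** * Permutation diagrams *)

Section Perms.
Variables (C : numFieldType) (m : nat).
Local Notation H := (Hom C m).
Local Notation id_ := (hid C m).
Local Notation "f ∘ g" := (hcomp f g) (at level 40, left associativity).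
Local Notation S0 := (swap0 C m).

(** Total in a: a position that does not fit gives the identity. *)
Fixpoint adj_hom n a : H n n :=
  match n return H n n with
  | 0 => id_ 0
  | n'.+1 => match a with
    | 0 => match n' return H n'.+1 n'.+1 with 0 => id_ 1 | k.+1 => S0 k end
    | a'.+1 => lpad (adj_hom n' a')
    end
  end.

(** The diagram that carries the first strand to position k and keeps the
    order of the others. *)
Fixpoint cyc_hom n k : H n.+1 n.+1 :=
  match n return H n.+1 n.+1 with
  | 0 => id_ 1
  | n'.+1 => match k with
    | 0 => id_ n'.+2
    | k'.+1 => lpad (cyc_hom n' k') ∘ S0 n'
    end
  end.

(** A normal form: the strands after the first are permuted among themselves,
    then the first strand is carried to its place. Having one diagram for each
    permutation avoids reduced words, and the relations of the symmetric group
    become [perm_homM]. *)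
Fixpoint perm_hom n : 'S_n -> H n n :=
  match n return 'S_n -> H n n with
  | 0 => fun=> id_ 0
  | n'.+1 => fun s => cyc_hom n' (s ord0) ∘ lpad (perm_hom (perm_rem s))
  end.

Lemma adj_homK n a : adj_hom n a ∘ adj_hom n a = id_ n.
Proof.
elim: n a => [|n IH] [|a] /=; rewrite ?hcomp1l //.
  by case: n {IH} => [|n]; rewrite ?hcomp1l ?swap0K.
by rewrite -lpad_comp IH lpad_id.
Qed.

Lemma cyc_hom0 n : cyc_hom n 0 = id_ n.+1. Proof. by case: n. Qed.

(** There are four ways in which an adjacent swap meets the cycle of the
    normal form: it lengthens it, shortens it, or passes through it, above or
    below its end, to become a swap of the remaining strands. Only the last
    one needs the braid relation. *)
Lemma adj_cyc_next n k : (k < n)%N -> adj_hom n.+1 k ∘ cyc_hom n k = cyc_hom n k.+1.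
Proof.
elim: n k => [//|n IH] [|k] kn /=; first by rewrite cyc_hom0 lpad_id hcomp1l hcomp1r.
by rewrite hcompA -lpad_comp IH.
Qed.

Lemma adj_cyc_prev n k : (k < n)%N -> adj_hom n.+1 k ∘ cyc_hom n k.+1 = cyc_hom n k.
Proof. by move=> kn; rewrite -adj_cyc_next // hcompA adj_homK hcomp1l. Qed.

Lemma adj_cyc_after n k a : (k <= a)%N -> (a < n)%N ->
  adj_hom n.+1 a.+1 ∘ cyc_hom n k = cyc_hom n k ∘ lpad (adj_hom n a).
Proof.
elim: n k a => [//|n IH] [|k] [|a] //= ka an; rewrite ?hcomp1l ?hcomp1r //.
by rewrite hcompA -lpad_comp [X in lpad X](IH k a) // lpad_comp -hcompA -swap0_nat hcompA.
Qed.

Lemma adj_cyc_before n k a : (a.+1 < k)%N -> (k <= n)%N ->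
  adj_hom n.+1 a ∘ cyc_hom n k = cyc_hom n k ∘ lpad (adj_hom n a).
Proof.
elim: n k a => [|n IH] [|k] [|a] //= ka kn; last first.
  by rewrite hcompA -lpad_comp [X in lpad X](IH k a) // lpad_comp -!hcompA swap0_nat.
case: k ka kn => // k _; case: n {IH} => // n _ /=.
rewrite lpad_comp !hcompA swap0_nat -!hcompA; congr (_ ∘ _).
by rewrite !hcompA swap0_braid.
Qed.

Lemma perm_hom_lift n (k : 'I_n.+1) s : perm_hom (lift_perm ord0 k s) =
  cyc_hom n k ∘ lpad (perm_hom s).
Proof. by rewrite /= lift_permK lift_perm_id. Qed.

Lemma perm_hom_lift0 n (s : 'S_n) : perm_hom (lift_perm ord0 ord0 s) = lpad (perm_hom s).
Proof. by rewrite perm_hom_lift cyc_hom0 hcomp1l. Qed.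

Lemma perm_hom1 n : perm_hom (1%g : 'S_n) = id_ n.
Proof. by elim: n => // n IH; rewrite -(lift_perm1 ord0) perm_hom_lift0 IH lpad_id. Qed.

(** By induction on n; the position of [s ord0] relative to a and b decides
    which of the four rules applies. *)
Lemma perm_hom_adj n (s : 'S_n) (a b : 'I_n) : b = a.+1 :> nat ->
  perm_hom (s * tperm a b) = adj_hom n a ∘ perm_hom s.
Proof.
elim: n s a b => [s []//|n IH] s a b ab.
rewrite -(perm_remK s); set k := s ord0; set s' := perm_rem s.
have an : (a < n)%N by move: (ltn_ord b); lia.
have [ka|ka] := eqVneq k a.
  by rewrite ka (tperm_adj ab) lift_permM mulg1 !perm_hom_lift hcompA ab adj_cyc_next.
have [kb|kb] := eqVneq k b.
  rewrite kb -tpermV (tperm_adj ab) lift_permV invg1 lift_permM mulg1 !perm_hom_lift hcompA.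
  by rewrite ab adj_cyc_prev.
case: (unliftP k a) ka => [a' ea _|->]; last by rewrite eqxx.
case: (unliftP k b) kb => [b' eb _|->]; last by rewrite eqxx.
have ab' : b' = a'.+1 :> nat.
  by move: ab; rewrite ea eb /= /bump; lia.
rewrite {1}ea {1}eb tperm_lift lift_permM !perm_hom_lift (IH _ _ _ ab') lpad_comp !hcompA.
congr (_ ∘ _); have := congr1 val ea; have := congr1 val eb.
rewrite /= /bump ab' => eb' ea'; have a'n := ltn_ord a'; have b'n := ltn_ord b'.
have [ka|ka] := leqP k a'.
  by rewrite ea' ka adj_cyc_after //; lia.
have -> : nat_of_ord a = a' by lia.
by rewrite adj_cyc_before //; [lia|move: (ltn_ord k); lia].
Qed.

Lemma perm_homM n (s t : 'S_n) : perm_hom (s * t) = perm_hom t ∘ perm_hom s.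
Proof.
elim/adj_ind: t s => [s|t a b ab IH s]; first by rewrite mulg1 perm_hom1 hcomp1l.
by rewrite mulgA !perm_hom_adj // IH hcompA.
Qed.

Lemma perm_hom_tperm n (a b : 'I_n) : b = a.+1 :> nat -> perm_hom (tperm a b) = adj_hom n a.
Proof. by move=> ab; rewrite -[tperm a b]mul1g perm_hom_adj // perm_hom1 hcomp1r. Qed.

Lemma perm_homK n (s : 'S_n) : perm_hom s ∘ perm_hom s^-1 = id_ n.
Proof. by rewrite -perm_homM mulVg perm_hom1. Qed.

End Perms.

(** * Permutation diagrams between a cup and a cap *)

(** For the permutation that exchanges two disjoint pairs of strands, written
    as a product of four adjacent transpositions. *)
Lemma abca_involution (gT : groupType) (a b c : gT) : (a * a = 1 -> b * b = 1 -> c * c = 1 ->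
  c * b = b * c -> (a * b * c * a) * (a * b * c * a) = 1)%g.
Proof.
move=> aa bb cc cb; rewrite !mulgA -(mulgA _ a a) aa mulg1 -(mulgA _ c b) cb mulgA.
by rewrite -(mulgA _ b b) bb mulg1 -(mulgA _ c c) cc mulg1 aa.
Qed.

Section DoubleCoset.
Variables (C : numFieldType) (m : nat).
Local Notation H := (Hom C m).
Local Notation id_ := (hid C m).
Local Notation "f ∘ g" := (hcomp f g) (at level 40, left associativity).
Local Notation S0 := (swap0 C m).
Local Notation U0 := (cup0 C m).
Local Notation A0 := (cap0 C m).
Local Notation P := (perm_hom C m).
Local Notation adj_hom := (adj_hom C m).

Lemma adj_hom_out n a : (n <= a.+1)%N -> adj_hom n a = id_ n.
Proof.
elim: n a => [|n IH] [|a] //=; first by case: n {IH}.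
by move=> na; rewrite IH ?lpad_id.
Qed.

Lemma adj_hom_tperm n a (lt : (a.+1 < n)%N) :
  adj_hom n a = P (tperm (Ordinal (ltn_trans (ltnSn a) lt)) (Ordinal lt)).
Proof. by rewrite perm_hom_tperm. Qed.

Lemma adj_hom_perm n a : exists t : 'S_n, adj_hom n a = P t.
Proof.
have [lt|?] := ltnP a.+1 n; last by exists 1%g; rewrite adj_hom_out // perm_hom1.
by eexists; exact: (adj_hom_tperm lt).
Qed.

(** Caps and cups at other positions are obtained from those at the left end
    by swaps, so it suffices to study the latter. *)
Lemma lpad_cap0 n : lpad (A0 n) = A0 n.+1 ∘ lpad (S0 n) ∘ S0 n.+1.
Proof. by rewrite cap0_slide -hcompA swap0K hcomp1r. Qed.

Lemma lpad_cup0 n : lpad (U0 n) = S0 n.+1 ∘ lpad (S0 n) ∘ U0 n.+1.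
Proof. by rewrite -hcompA cup0_slide hcompA swap0K hcomp1l. Qed.

Lemma zigzag_swap n : A0 n.+1 ∘ lpad (S0 n) ∘ U0 n.+1 = id_ n.+1.
Proof. by rewrite -hcompA cup0_slide hcompA cap0_swap0 zigzagl. Qed.

(** The permutation in the middle exchanges the first two strands with the
    next two, so the cup and the cap do not meet. *)
Lemma cap_cup_disjoint n :
  A0 n.+2 ∘ (lpad (S0 n.+1) ∘ S0 n.+2 ∘ lpad (lpad (S0 n)) ∘ lpad (S0 n.+1)) ∘ U0 n.+2 =
  U0 n ∘ A0 n.
Proof.
rewrite -!hcompA cup0_slide.
rewrite [lpad (lpad (S0 n)) ∘ _]hcompA -swap0_nat -!hcompA [S0 _ ∘ (S0 _ ∘ _)]hcompA swap0K hcomp1l.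
by rewrite -lpad_comp cup0_slide lpad_comp (hcompA (lpad _) (lpad _)) lpad_swap0K hcomp1l cap0_nat.
Qed.

Definition o1 n : 'I_n.+2 := fintype.lift ord0 ord0.
Definition o2 n : 'I_n.+3 := fintype.lift ord0 (o1 n).
Definition o3 n : 'I_n.+4 := fintype.lift ord0 (o2 n).

Lemma perm_fix01 n (s : 'S_n.+2) : s ord0 = ord0 -> s (o1 n) = o1 n ->
  exists t, P s = lpad (lpad (P t)).
Proof.
move=> s0 s1; exists (perm_rem (perm_rem s)); rewrite -!perm_hom_lift0.
have r0 : perm_rem s ord0 = ord0.
  by apply: (@lift_inj _ ord0); rewrite -{1}s0 permE rem_funE.
have := perm_remK (perm_rem s); rewrite r0 => ->.
by have := perm_remK s; rewrite s0 => ->.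
Qed.

Definition cupcap n : H n n :=
  match n return H n n with n'.+2 => U0 n' ∘ A0 n' | _ => 0 end.

Definition reduced_cap_cup n (f : H n n) :=
  [\/ exists t, f = m%:R *: P t, exists t, f = P t
    | exists t t', f = P t ∘ cupcap n ∘ P t'].

Lemma perm_hom01 n : P (tperm ord0 (o1 n)) = S0 n. Proof. by rewrite perm_hom_tperm. Qed.

Lemma perm_hom12 n : P (tperm (o1 n.+1) (o2 n)) = lpad (S0 n).
Proof. by rewrite perm_hom_tperm. Qed.

Lemma perm_hom23 n : P (tperm (o2 n.+1) (o3 n)) = lpad (lpad (S0 n)).
Proof. by rewrite perm_hom_tperm. Qed.

(** The permutation may be changed on both sides by the swap of the first two
    strands, which the cup and the cap absorb, and by permutations of the
    other strands, which slide to the outside. All that is left is the number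
    of ends of the cup which are joined to the cap: two give a loop, one gives
    a zigzag, none leaves the cup and the cap apart. *)
Lemma double_coset n (s : 'S_n.+2) : reduced_cap_cup (A0 n ∘ P s ∘ U0 n).
Proof.
pose R (s : 'S_n.+2) := reduced_cap_cup (A0 n ∘ P s ∘ U0 n).
pose tau := tperm ord0 (o1 n).
have Rl (t : 'S_n.+2) : R (tau * t)%g -> R t.
  by rewrite /R perm_homM perm_hom01 -!hcompA swap0_cup0.
have Rr (t : 'S_n.+2) : R (t * tau)%g -> R t.
  by rewrite /R perm_homM perm_hom01 hcompA cap0_swap0.
(* Both ends of the cup meet the cap. *)
have caseA (t : 'S_n.+2) : t ord0 = ord0 -> t (o1 n) = o1 n -> R t.
  move=> t0 t1; have [u Pu] := perm_fix01 t0 t1; constructor 1; exists u.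
  by rewrite Pu cap0_nat -hcompA cap0_cup0 hcompZr hcomp1r.
(* At least one end of the cup meets the cap; if only one does, the other ends
   of the cup and of the cap are moved to strand 2, which exposes a zigzag. *)
have caseB (t : 'S_n.+2) : t ord0 = ord0 -> R t.
  move=> t0; have [t1|] := eqVneq (t (o1 n)) (o1 n); first exact: caseA.
  move=> t1; pose q := (t^-1 (o1 n))%g.
  have tq : t q = o1 n by rewrite permKV.
  have q1 : q != o1 n by apply/eqP => e; move: t1; rewrite -{1}e tq eqxx.
  have q0 : q != ord0 by apply/eqP => e; move: tq; rewrite e t0 => /(congr1 val).
  rewrite /R; case: n t t0 t1 q tq q1 q0 {R tau Rl Rr caseA s} => [|n] t t0 t1 q tq q1 q0.
    by case/negP: q1; move: q0; rewrite -!val_eqE /= /bump /=; move: (ltn_ord q); lia.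
  have [u Pu] : exists u, P (tperm (o2 n) q) = lpad (lpad (P u)).
    by apply: perm_fix01; rewrite tpermD.
  have [v Pv] : exists v, P (tperm (o1 n.+1) (o2 n) * (tperm (o2 n) q * t))%g = lpad (lpad (P v)).
    apply: perm_fix01; rewrite !permM; first by rewrite (@tpermD _ (o1 n.+1)) // tpermD // t0.
    by rewrite !tpermL.
  have -> : P t = lpad (lpad (P v)) ∘ lpad (S0 n) ∘ lpad (lpad (P u)).
    rewrite -Pu -Pv -perm_hom12 -!perm_homM; congr (P _).
    by rewrite (mulgA (tperm (o1 _) _)) tperm2 mul1g mulgA tperm2 mul1g.
  constructor 2; exists (u * v)%g.
  rewrite perm_homM !hcompA cap0_nat -(hcompA _ (lpad (lpad (P u)))) -cup0_nat hcompA.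
  by rewrite -!(hcompA (P v)) zigzag_swap hcomp1l.
have [t0|t0] := eqVneq (s ord0) ord0; first exact: caseB.
have [t1|t1] := eqVneq (s (o1 n)) ord0.
  by apply/Rl/caseB; rewrite permM tpermL.
have [t2|t2] := eqVneq (s ord0) (o1 n).
  by apply/Rr/caseB; rewrite permM t2 tpermR.
have [t3|t3] := eqVneq (s (o1 n)) (o1 n).
  by apply/Rl/Rr/caseB; rewrite !permM tpermL t3 tpermR.
(* The cup and the cap do not meet. With rho sliding past the cup, and k
   exchanging the strands 0, 1 with 2, 3, the permutation k rho s fixes 0 and
   1, so that s is a product of k and of permutations that slide to the
   outside. *)
pose p := (s^-1 ord0)%g; pose q := (s^-1 (o1 n))%g.
have sp : s p = ord0 by rewrite permKV.
have sq : s q = o1 n by rewrite permKV.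
have p0 : p != ord0 by apply/eqP => e; move: t0; rewrite -{1}e sp eqxx.
have p1 : p != o1 n by apply/eqP => e; move: t1; rewrite -{1}e sp eqxx.
have q0 : q != ord0 by apply/eqP => e; move: t2; rewrite -{1}e sq eqxx.
have q1 : q != o1 n by apply/eqP => e; move: t3; rewrite -{1}e sq eqxx.
have pq : p != q by apply/eqP => e; move: sp; rewrite e sq.
move: (p) (q) sp sq p0 p1 q0 q1 pq => {p q t0 t1 t2 t3 Rl Rr caseA caseB} p q.
rewrite {}/R {tau}; case: n s p q => [|[|n]] s p q sp sq p0 p1 q0 q1 pq.
- by case/negP: p1; move: p0; rewrite -!val_eqE /= /bump /=; move: (ltn_ord p); lia.
- case/negP: pq; move: p0 p1 q0 q1; rewrite -!val_eqE /=; move: (ltn_ord p) (ltn_ord q).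
  by rewrite /bump /=; lia.
pose q' := tperm (o2 n.+1) p q.
pose rho := (tperm (o3 n) q' * tperm (o2 n.+1) p)%g.
have q'2 : q' != o2 n.+1.
  by rewrite -(tpermR (o2 n.+1) p) /q' (inj_eq perm_inj) eq_sym.
have q'0 : q' != ord0.
  by rewrite /q'; case: tpermP.
have q'1 : q' != o1 n.+2 by rewrite /q'; case: tpermP.
have [u Pu] : exists u, P rho = lpad (lpad (P u)).
  by apply: perm_fix01; rewrite /rho permM (@tpermD _ (o3 n)) // tpermD.
have r2 : rho (o2 n.+1) = p.
  by rewrite /rho permM (@tpermD _ (o3 n)) // tpermL.
have r3 : rho (o3 n) = q by rewrite /rho permM tpermL /q' tpermK.
pose k := (tperm (o1 n.+2) (o2 n.+1) * tperm (o2 n.+1) (o3 n) *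
  tperm ord0 (o1 n.+2) * tperm (o1 n.+2) (o2 n.+1))%g.
have k2 : k (ord0) = o2 n.+1.
  have e1 : tperm (o1 n.+2) (o2 n.+1) ord0 = ord0 by rewrite tpermD.
  have e2 : tperm (o2 n.+1) (o3 n) ord0 = ord0 by rewrite tpermD.
  by rewrite /k !permM e1 e2 !tpermL.
have k3 : k (o1 n.+2) = o3 n.
  have e1 : tperm ord0 (o1 n.+2) (o3 n) = o3 n by rewrite tpermD.
  have e2 : tperm (o1 n.+2) (o2 n.+1) (o3 n) = o3 n by rewrite tpermD.
  by rewrite /k !permM !tpermL e1 e2.
have kk : (k * k = 1)%g.
  apply: abca_involution; try exact: tperm2.
  apply/permP => i; rewrite !permM; case: (tpermP ord0 _ i) => [->|->|/eqP i0 /eqP i1].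
  - by rewrite !(@tpermD _ (o2 n.+1)) // tpermL.
  - by rewrite !(@tpermD _ (o2 n.+1)) // tpermR.
  by case: (tpermP (o2 n.+1) _ i) => [_|_|_ _]; rewrite tpermD // eq_sym.
have Pk : P k = lpad (S0 n.+1) ∘ (S0 n.+2 ∘ (lpad (lpad (S0 n)) ∘ lpad (S0 n.+1))).
  by rewrite /k !perm_homM perm_hom12 perm_hom23 perm_hom01.
clearbody k rho.
have [v Pv] : exists v, P (k * (rho * s))%g = lpad (lpad (P v)).
  by apply: perm_fix01; rewrite !permM ?k2 ?k3 ?r2 ?r3 ?sp ?sq.
have -> : P s = lpad (lpad (P v)) ∘ P k ∘ lpad (lpad (P u^-1)).
  have -> : lpad (lpad (P u^-1)) = P rho^-1.
    rewrite -[LHS]hcomp1r -(perm_homK _ _ rho) Pu hcompA -!lpad_comp -{2}(invgK u).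
    by rewrite perm_homK !lpad_id hcomp1l.
  rewrite -Pv -!perm_homM; congr (P _).
  by rewrite (mulgA k k) kk mul1g mulgA mulVg mul1g.
constructor 3; exists v, u^-1%g.
rewrite Pk !hcompA cap0_nat -(hcompA _ (lpad (lpad (P u^-1)))) -cup0_nat hcompA.
by rewrite -(hcompA (P v) (U0 n) (A0 n)) -cap_cup_disjoint !hcompA.
Qed.

End DoubleCoset.

(** * A spanning set of the diagrams without inputs *)

Section Spanning.
Variables (C : numFieldType) (m : nat).
Local Notation H := (Hom C m).
Local Notation T := (term C m).
Local Notation id_ := (hid C m).
Local Notation "f ∘ g" := (hcomp f g) (at level 40, left associativity).
Local Notation "f ⊗ g" := (htens f g) (at level 35, right associativity).
Local Notation S0 := (swap0 C m).
Local Notation U0 := (cup0 C m).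
Local Notation A0 := (cap0 C m).
Local Notation P := (perm_hom C m).
Local Notation adj_hom := (adj_hom C m).
Local Notation D := (hD C m).
Local Notation Ds := (hDs C m).
Local Notation cupcap := (cupcap C m).

Fixpoint lpadn a i j (f : H i j) : H (a + i) (a + j) :=
  match a return H (a + i) (a + j) with 0 => f | a'.+1 => lpad (lpadn a' f) end.

Lemma lpadnE a i j (f : H i j) : lpadn a f = id_ a ⊗ f.
Proof.
elim: a => [|a IH] /=; first by rewrite htens1l.
by rewrite IH -(htens11 C m 1 a); exact: (htensA11 (id_ 1) (id_ a) f).
Qed.

Lemma lpadn_adj a n b : lpadn a (adj_hom n b) = adj_hom (a + n) (a + b).
Proof. by elim: a => //= a ->. Qed.

Lemma lpadn_comp a i j k (f : H j k) (g : H i j) : lpadn a (f ∘ g) = lpadn a f ∘ lpadn a g.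
Proof. by elim: a => //= a ->; rewrite lpad_comp. Qed.

Lemma lpadn_id a i : lpadn a (id_ i) = id_ (a + i).
Proof. by elim: a => //= a ->; rewrite lpad_id. Qed.

Lemma lpad_cast i j i' j' (ei : i = i') (ej : j = j') (f : H i j) :
  lpad (hcast ei ej f) = hcast (congr1 S ei) (congr1 S ej) (lpad f).
Proof. by case: _ / ei; case: _ / ej. Qed.

Lemma hcastK i j i' j' (ei : i = i') (ej : j = j') (f : H i j) :
  hcast (esym ei) (esym ej) (hcast ei ej f) = f.
Proof. by case: _ / ei; case: _ / ej. Qed.

Lemma hcast_comp i j i' j' i'' j'' (ei : i = i') (ej : j = j') (ei' : i' = i'') (ej' : j' = j'')
  (f : H i j) : hcast ei' ej' (hcast ei ej f) = hcast (etrans ei ei') (etrans ej ej') f.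
Proof. by case: _ / ei'; case: _ / ej'; case: _ / ei; case: _ / ej. Qed.

Lemma hcast_irr i j i' j' (ei ei' : i = i') (ej ej' : j = j') (f : H i j) :
  hcast ei ej f = hcast ei' ej' f.
Proof. by rewrite (eq_irrelevance ei ei') (eq_irrelevance ej ej'). Qed.

Lemma lpadn_lpad a i j (f : H i j) :
  hcast (addnS a i) (addnS a j) (lpadn a (lpad f)) = lpadn a.+1 f.
Proof.
elim: a => [|a IH]; first exact: hcast_id.
by rewrite [RHS]/= -[lpad (lpadn a f)]/(lpadn a.+1 f) -IH lpad_cast; apply: hcast_irr.
Qed.

(** Linear combinations of words in cups and swaps that start from the empty
    diagram or from a single copy of Delta_m. Neither caps nor further copies
    of Delta_m are allowed. *)
Inductive spanned : forall n, H 0 n -> Prop :=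
| spanned_id : spanned (id_ 0)
| spanned_vol : spanned D
| spanned_cup n x : @spanned n x -> spanned (U0 n ∘ x)
| spanned_swap n a x : @spanned n x -> spanned (adj_hom n a ∘ x)
| spanned_0 n : spanned (0 : H 0 n)
| spanned_add n x y : @spanned n x -> @spanned n y -> spanned (x + y)
| spanned_scale n a x : @spanned n x -> @spanned n (a *: x).

(** The span has to be stable under a diagram with strands on its left, and
    [stable] adds strands on its right; an induction through tensor products
    needs both. *)
Definition preserves i j (f : H i j) := forall a x, @spanned (a + i) x -> spanned (lpadn a f ∘ x).
Definition stable i j (f : H i j) := forall k, preserves (rpad k f).

Lemma spanned_cast n n' (e : n = n') x : spanned x -> spanned (hcast erefl e x : H 0 n').
Proof. by case: _ / e. Qed.

Lemma spanned_castV n n' (e0 : 0 = 0) (e : n = n') (x : H 0 n) :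
  spanned (hcast e0 e x) -> spanned x.
Proof. by rewrite (eq_irrelevance e0 erefl); case: _ / e. Qed.

Lemma spanned_cast_comp i j i' j' (ei : i = i') (ej : j = j') (f : H i j) :
  (forall x, spanned x -> spanned (f ∘ x)) ->
  forall x, spanned x -> spanned (hcast ei ej f ∘ x).
Proof. by case: _ / ei; case: _ / ej. Qed.

Lemma spanned_perm n (s : 'S_n) x : spanned x -> spanned (P s ∘ x).
Proof.
move=> gx; elim/adj_ind: s => [|s a b ab gs]; first by rewrite perm_hom1 hcomp1l.
by rewrite perm_hom_adj // -hcompA; apply: spanned_swap.
Qed.

Lemma preserves_adj n b : preserves (adj_hom n b).
Proof. by move=> a x gx; rewrite lpadn_adj; apply: spanned_swap. Qed.

Lemma preserves_comp i j k (f : H j k) (g : H i j) : preserves f -> preserves g ->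
  preserves (f ∘ g).
Proof. by move=> Gf Gg a x gx; rewrite lpadn_comp -hcompA; apply/Gf/Gg. Qed.

Lemma preserves_id n : preserves (id_ n).
Proof. by move=> a x; rewrite lpadn_id hcomp1l. Qed.

Lemma preserves_lpad i j (f : H i j) : preserves f -> preserves (lpad f).
Proof.
move=> Gf a x gx; rewrite -[lpadn a (lpad f)](hcastK (addnS a i) (addnS a j)) lpadn_lpad.
by apply: spanned_cast_comp gx => y; apply: (Gf a.+1).
Qed.

Lemma preserves_cast i j i' j' (ei : i = i') (ej : j = j') (f : H i j) :
  preserves f -> preserves (hcast ei ej f).
Proof. by case: _ / ei; case: _ / ej. Qed.

Lemma preserves_lpadn b i j (f : H i j) : preserves f -> preserves (lpadn b f).
Proof. by move=> Gf; elim: b => //= b; apply: preserves_lpad. Qed.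

Lemma preserves_add i j (f g : H i j) : preserves f -> preserves g -> preserves (f + g).
Proof.
move=> Gf Gg a x gx; rewrite lpadnE htensDr hcompDl -!lpadnE.
by apply: spanned_add; [apply: Gf|apply: Gg].
Qed.

Lemma preserves_scale i j c (f : H i j) : preserves f -> preserves (c *: f).
Proof.
by move=> Gf a x gx; rewrite lpadnE htensZr hcompZl -!lpadnE; apply/spanned_scale/Gf.
Qed.

Lemma preserves_swap0 k : preserves (S0 k). Proof. exact: (@preserves_adj k.+2 0). Qed.

Lemma preserves_cup0 k : preserves (U0 k).
Proof.
move=> a; elim: a k => [|a IH] k x gx /=; first exact: spanned_cup.
rewrite -[lpad _]/(lpadn a.+1 _) -lpadn_lpad; apply: spanned_cast_comp gx => y gy.
rewrite lpad_cup0 !lpadn_comp -!hcompA.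
by apply: preserves_swap0; apply/preserves_lpad; [exact: preserves_swap0|exact: IH].
Qed.

Lemma stable_hcomp i j k (f : H j k) (g : H i j) : stable f -> stable g -> stable (f ∘ g).
Proof. by move=> Gf Gg n; rewrite rpad_comp; apply: preserves_comp. Qed.

Lemma stable_id n : stable (id_ n).
Proof. by move=> k; rewrite rpad_id; apply: preserves_id. Qed.

Lemma stable_cast i j i' j' (ei : i = i') (ej : j = j') (f : H i j) :
  stable f -> stable (hcast ei ej f).
Proof. by case: _ / ei; case: _ / ej. Qed.

Lemma stable_add i j (f g : H i j) : stable f -> stable g -> stable (f + g).
Proof. by move=> Gf Gg k; rewrite /rpad htensDl; apply: preserves_add. Qed.

Lemma stable_scale i j c (f : H i j) : stable f -> stable (c *: f).
Proof. by move=> Gf k; rewrite /rpad htensZl; apply: preserves_scale. Qed.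

Lemma stable_X : stable (hX C m). Proof. by move=> k; apply: preserves_swap0. Qed.

Lemma stable_U : stable (hU C m). Proof. by move=> k; apply: preserves_cup0. Qed.

Lemma stable_htens i j i' j' (f : H i j) (g : H i' j') : stable f -> stable g -> stable (f ⊗ g).
Proof.
move=> Gf Gg k; rewrite /rpad -htensA; apply: preserves_cast.
have -> : f ⊗ (g ⊗ id_ k) = rpad (j' + k) f ∘ lpadn i (rpad k g).
  by rewrite lpadnE /rpad -htens_comp hcomp1l hcomp1r.
by apply: preserves_comp; [exact: Gf|apply/preserves_lpadn/Gg].
Qed.

Lemma stable_Comp i j k (f : T j k) (g : T i j) :
  stable (cls f) -> stable (cls g) -> stable (cls (Comp f g)).
Proof. by rewrite cls_comp; apply: stable_hcomp. Qed.

Lemma stable_Tens i j k l (f : T i j) (g : T k l) :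
  stable (cls f) -> stable (cls g) -> stable (cls (Tens f g)).
Proof. by rewrite cls_tens; apply: stable_htens. Qed.

Lemma stable_castt i j i' j' (ei : i = i') (ej : j = j') (f : T i j) :
  stable (cls f) -> stable (cls (castt ei ej f)).
Proof. by rewrite cls_cast; apply: stable_cast. Qed.

Lemma stable_cross n : stable (cls (cross C m n)) /\ stable (cls (star (cross C m n))).
Proof.
elim: n => [|n [IH IH']]; first by split; apply: stable_id.
have C1 : stable (cls (Idn 1)) := @stable_id 1; have Cn : stable (cls (Idn n)) := @stable_id n.
have CX : stable (cls gX) := @stable_X; split.
  exact: (stable_Comp (stable_Tens C1 IH) (stable_Tens CX Cn)).
exact: (stable_Comp (stable_Tens CX Cn) (stable_Tens C1 IH')).
Qed.

Lemma star_cast i j i' j' (ei : i = i') (ej : j = j') (f : T i j) :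
  star (castt ei ej f) = castt ej ei (star f).
Proof. by case: _ / ei; case: _ / ej. Qed.

Lemma stable_cups n : stable (cls (star (caps C m n))).
Proof.
elim: n => [|n IH]; first exact: stable_id.
have Cc := stable_castt (esym (addnA n 1 n.+1)) erefl
  (stable_Tens (stable_cross n).2 (@stable_id n.+1 : stable (cls (Idn n.+1)))).
have Ct := stable_Tens (@stable_id n : stable (cls (Idn n)))
  (stable_Tens (@stable_U : stable (cls gU)) (@stable_id n : stable (cls (Idn n)))).
have := stable_Comp (stable_Comp Cc Ct) IH.
by rewrite -(star_cast erefl (esym (addnA n 1 n.+1)) (Tens (cross C m n) (Idn n.+1))).
Qed.

Lemma cls_simple n a k (e : (a + (2 + k) = n)%N) : cls (simple C m e) = adj_hom n a.
Proof.
rewrite /simple cls_cast cls_tens cls_tens; case: _ / e => /=.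
by rewrite -lpadnE -[hX C m ⊗ _]/(adj_hom k.+2 0) lpadn_adj addn0.
Qed.

Lemma cls_lift n (s : 'S_n) (t : T n n) : lift s t -> cls t = P s.
Proof.
elim=> [|a b k e s' t' ab _ IH]; first by rewrite perm_hom1.
by rewrite cls_comp IH cls_simple perm_hom_adj.
Qed.

Lemma lift_exists n (s : 'S_n) : exists t : T n n, lift s t.
Proof.
elim/adj_ind: s => [|s a b ab [t lt]]; first by exists (Idn n); apply: lift1.
have e : (a + (2 + (n - a.+2)) = n)%N by move: (ltn_ord b); lia.
by exists (Comp (simple C m e) t); apply: liftM.
Qed.

(** The defining relation allows any lifts of the permutations; all of them
    have the class [perm_hom]. *)
Lemma vol_covol : D ∘ Ds = \sum_(s : 'S_m) (-1) ^+ odd_perm s *: P s.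
Proof.
have [w lw] := choice (@lift_exists m).
have /clsP := eqv_antisym (m%:R : C) lw; rewrite cls_comp /= => ->.
transitivity (\sum_(s : 'S_m) cls (Scale ((-1) ^+ odd_perm s) (w s))).
  by apply: (big_morph (@cls C m m m)) => [f g|]; rewrite ?clsD ?cls0.
by apply: eq_bigr => s _; rewrite clsZ (cls_lift (lw s)).
Qed.

Lemma perm_vol (s : 'S_m) : P s ∘ D = (-1) ^+ odd_perm s *: D.
Proof.
elim/adj_ind: s => [|s a b ab IH]; first by rewrite perm_hom1 hcomp1l odd_perm1 expr0 scale1r.
rewrite perm_hom_adj // -hcompA IH hcompZr.
have e : (a + (2 + (m - a.+2)) = m)%N by move: (ltn_ord b); lia.
have /clsP := eqv_alternating (m%:R : C) e; rewrite cls_comp cls_simple clsZ => ->.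
rewrite scalerA; congr (_ *: _).
rewrite odd_permM odd_tperm -val_eqE /= ab neq_ltn ltnSn /=.
by rewrite signr_addb expr1.
Qed.

Definition hcups : H 0 (m + m) := cls (star (caps C m m)).

(** The reflection of the bending relation. It replaces one of two copies of
    Delta_m by the reflection, so that [vol_covol] becomes applicable. *)
Lemma vol_bend : D = rpad m Ds ∘ hcups.
Proof.
have /eqv_star/clsP e := eqv_bend (m%:R : C) (gD : T 0 m).
rewrite /hcups /rpad -[id_ m]/(cls (Idn m)) -(cls_tens gDs (Idn m)) -cls_comp; exact: e.
Qed.

Lemma covol_bend : Ds = cls (caps C m m) ∘ (D ⊗ id_ m).
Proof.
have /clsP e := eqv_bend (m%:R : C) (gD : T 0 m).
by rewrite -[id_ m]/(cls (Idn m)) -cls_tens -cls_comp; exact: e.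
Qed.

Lemma rpad_adj k n a : (a.+1 < n)%N -> rpad k (adj_hom n a) = adj_hom (n + k) a.
Proof.
elim: n a => [//|n IH] [|a] an /=; last by rewrite -lpad_rpad IH.
case: n an {IH} => // n _.
by rewrite /swap0 {1}/rpad -htensA22 htens11.
Qed.

Lemma spanned_rpad_perm k n (s : 'S_n) x : spanned x -> spanned (rpad k (P s) ∘ x).
Proof.
move=> gx; elim/adj_ind: s => [|s a b ab gs]; first by rewrite perm_hom1 rpad_id hcomp1l.
rewrite perm_hom_adj // rpad_comp -hcompA rpad_adj; last by rewrite -ab.
exact: spanned_swap.
Qed.

(** Two copies of Delta_m are Delta_m Delta_m^* applied to one half of the
    ends of m cups, and therefore a signed sum of permuted cups. *)
Lemma spanned_vol_vol : spanned (D ⊗ D).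
Proof.
have -> : D ⊗ D = rpad m (D ∘ Ds) ∘ hcups.
  rewrite rpad_comp -hcompA -[rpad m Ds ∘ hcups]vol_bend.
  by rewrite -{1}(hcomp1r D) -{2}(hcomp1l D) htens_comp htens1l.
rewrite vol_covol /rpad -/(htensr (id_ m) _) raddf_sum hcomp_suml.
elim/big_ind: _ => [|x y|s _]; [exact: spanned_0|exact: spanned_add|].
rewrite /= /htensr htensZl hcompZl; apply: spanned_scale; apply: (@spanned_rpad_perm m).
have := @stable_cups m 0 0 (id_ 0) spanned_id.
rewrite /= hcomp1r /rpad -[_ ⊗ _](hcastK (addn0 0) (addn0 (m + m))) htens1r.
by move/spanned_castV; apply.
Qed.

Lemma spanned_tens_vol n x : spanned x -> spanned ((x : H 0 n) ⊗ D).
Proof.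
elim=> {n x} [||n x _ IH|n b x _ IH|n|n x y _ IHx _ IHy|n c x _ IH].
- by rewrite htens1l; apply: spanned_vol.
- exact: spanned_vol_vol.
- have -> : (U0 n ∘ x) ⊗ D = rpad m (U0 n) ∘ (x ⊗ D).
    by rewrite -[D in LHS]hcomp1l htens_comp.
  have -> : rpad m (U0 n) = U0 (n + m) by rewrite /cup0 {1}/rpad -htensA02 htens11.
  exact: spanned_cup.
- have [lt|ge] := ltnP b.+1 n; last by rewrite adj_hom_out // hcomp1l.
  rewrite -[D in X in spanned X]hcomp1l htens_comp -/(rpad m _) rpad_adj //; exact: spanned_swap.
- by rewrite -/(htensr D _) raddf0; apply: spanned_0.
- by rewrite htensDl; apply: spanned_add.
- by rewrite htensZl; apply: spanned_scale.
Qed.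

(** Naturality of the symmetry moves a strand from the right of Delta_m to its
    left. *)
Lemma vol_slide : D ⊗ id_ 1 = cls (cross C m m) ∘ lpad D.
Proof.
have /clsP := eqv_slide (m%:R : C) (gD : T 0 m).
rewrite [RHS]cls_comp hcomp1r cls_tens => <-; rewrite cls_comp cls_tens; by [].
Qed.

(** Without strands on its right, Delta_m is appended to a word, where
    [spanned_tens_vol] merges it with the copy that the word may contain. *)
Lemma preserves_vol : preserves D.
Proof.
move=> a x gx.
pose x' := hcast erefl (addn0 a) x.
have -> : x = x' ⊗ id_ 0.
  by rewrite -[RHS](hcastK (addn0 0) (addn0 a)) htens1r hcast_comp hcast_id.
rewrite lpadnE -(htens_comp (id_ a) x' D (id_ 0)) hcomp1l hcomp1r; apply: spanned_tens_vol.
exact: spanned_cast.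
Qed.

Lemma stable_vol : stable D.
Proof.
elim=> [|k IH].
  rewrite /rpad -[_ ⊗ _](hcastK (addn0 0) (addn0 m)) htens1r.
  by apply: preserves_cast; apply: preserves_vol.
have -> : rpad k.+1 D = hcast (esym (addnA 0 1 k)) (esym (addnA m 1 k))
  (rpad k (cls (cross C m m)) ∘ lpad (rpad k D)).
  rewrite lpad_rpad -(rpad_comp k (cls (cross C m m)) (lpad D)) -vol_slide /rpad -(htensA D (id_ 1)
    (id_ k)) hcast_comp htens11.
  by rewrite hcast_id.
apply/preserves_cast/preserves_comp; first exact: (stable_cross m).1.
exact: preserves_lpad.
Qed.

Lemma perm_vol_cast N (e : m = N) (s : 'S_N) :
  P s ∘ hcast erefl e D = (-1) ^+ odd_perm s *: hcast erefl e D.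
Proof. by case: _ / e s => s; apply: perm_vol. Qed.

Lemma cap0_vol n (e : m = n.+2) : A0 n ∘ hcast erefl e D = 0.
Proof.
have /clsP := @eqv_harmonic C m m%:R 0 n (esym e).
rewrite cls_comp cls_tens cls_tens cls_cast cls0 htens1l => h.
by rewrite (hcast_irr erefl erefl e (esym (esym e))); exact: h.
Qed.

Lemma spanned_cupcap n x (IH : forall n' (e : n = n'.+2) (s : 'S_n'.+2),
  spanned (A0 n' ∘ P s ∘ hcast erefl e x)) t : spanned (cupcap n ∘ (P t ∘ x)).
Proof.
case: n x IH t => [|[|n]] x IH t /=; rewrite ?hcomp0l; try exact: spanned_0.
rewrite -hcompA; apply: spanned_cup; have := IH n erefl t.
by rewrite hcast_id -hcompA.
Qed.

(** By induction on words, with an arbitrary permutation between the word and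
    the cap, since the swaps of the word accumulate there. Where the last
    letter is a cup, [double_coset] either removes the cap or passes it on to
    the shorter word. *)
Lemma spanned_cap_perm n x : spanned x -> forall n' (e : n = n'.+2) (s : 'S_n'.+2),
  spanned (A0 n' ∘ P s ∘ hcast erefl e x).
Proof.
elim=> {n x} [//||n x gx IH|n b x _ IH|n|n x y _ IHx _ IHy|n c x _ IH] n' e s.
- by rewrite -hcompA perm_vol_cast hcompZr cap0_vol scaler0; apply: spanned_0.
- have en : n = n' by case: e.
  move: e s; rewrite -en => e s; rewrite hcast_id hcompA.
  case: (double_coset C m s) => [[t ->]|[t ->]|[t [t' ->]]].
  + by rewrite hcompZl; apply/spanned_scale/spanned_perm.
  + exact: spanned_perm.
  by rewrite -!hcompA; apply/spanned_perm/spanned_cupcap.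
- have [t ->] := adj_hom_perm C m n b.
  subst n; rewrite hcast_id hcompA -[_ ∘ P s ∘ P t]hcompA -perm_homM.
  by have := IH n' erefl (t * s)%g; rewrite hcast_id.
- have -> : hcast erefl e (0 : H 0 n) = 0 by case: _ / e.
  by rewrite hcomp0r; apply: spanned_0.
- have -> : hcast erefl e (x + y) = hcast erefl e x + hcast erefl e y by case: _ / e.
  by rewrite hcompDr; apply: spanned_add.
- have -> : hcast erefl e (c *: x) = c *: hcast erefl e x by case: _ / e.
  by rewrite hcompZr; apply: spanned_scale.
Qed.

Lemma spanned_cap0 n x : spanned x -> spanned (A0 n ∘ x).
Proof.
move=> gx; have := spanned_cap_perm gx erefl 1%g.
by rewrite hcast_id perm_hom1 hcomp1r.
Qed.

Lemma preserves_cap0 k : preserves (A0 k).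
Proof.
move=> a; elim: a k => [|a IH] k x gx /=; first exact: spanned_cap0.
rewrite -[lpad _]/(lpadn a.+1 _) -lpadn_lpad; apply: spanned_cast_comp gx => y gy.
rewrite lpad_cap0 !lpadn_comp -!hcompA.
by apply: IH; apply/preserves_lpad; [exact: preserves_swap0|exact: preserves_swap0].
Qed.

Lemma stable_A : stable (hA C m). Proof. by move=> k; apply: preserves_cap0. Qed.

Lemma stable_caps n : stable (cls (caps C m n)).
Proof.
elim: n => [|n IH]; first exact: stable_id.
have Cc := stable_castt erefl (esym (addnA n 1 n.+1))
  (stable_Tens (stable_cross n).1 (@stable_id n.+1 : stable (cls (Idn n.+1)))).
have Ct := stable_Tens (@stable_id n : stable (cls (Idn n)))
  (stable_Tens (@stable_A : stable (cls gA)) (@stable_id n : stable (cls (Idn n)))).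
exact: (stable_Comp IH (stable_Comp Ct Cc)).
Qed.

Lemma stable_covol : stable Ds.
Proof.
rewrite covol_bend; apply: stable_hcomp; first exact: stable_caps.
exact: (stable_htens stable_vol (@stable_id m)).
Qed.

Lemma stable_all i j (f : T i j) : stable (cls f).
Proof.
elim: f => [n||||||? ? ? f IHf g IHg|? ? ? ? f IHf g IHg|i' j'|i' j' f IHf g IHg|i' j' c f IHf].
- exact: stable_id.
- exact: stable_U.
- exact: stable_A.
- exact: stable_X.
- exact: stable_vol.
- exact: stable_covol.
- exact: stable_Comp.
- exact: stable_Tens.
- rewrite cls0 -(scale0r (cls (Zero C m i' j'))); apply: stable_scale => k a x gx.
  rewrite cls0 /rpad -/(htensr (id_ k) _) raddf0 lpadnE raddf0 hcomp0l; exact: spanned_0.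
- by rewrite clsD; apply: stable_add.
- by rewrite clsZ; apply: stable_scale.
Qed.

(** Every diagram preserves the span, by induction on diagrams, and the span
    contains the empty diagram. *)
Theorem all_spanned n (x : H 0 n) : spanned x.
Proof.
elim/hom_ind: x => t; have := @stable_all _ _ t 0 0 (id_ 0) spanned_id.
rewrite /= hcomp1r /rpad -[_ ⊗ _](hcastK (addn0 0) (addn0 n)) htens1r.
exact: spanned_castV.
Qed.

Definition vol2 : H 0 2 := if m =P 2 is ReflectT e then hcast erefl e D else 0.

(** A word with at most two outputs contains at most one cup, and a copy of
    Delta_m only if m = 2. *)
Lemma spanned_small n (x : H 0 n) : (2 <= m)%N -> spanned x ->
  (forall e : n = 0, exists c, hcast erefl e x = c *: id_ 0) /\
  (forall e : n = 2, exists c d, hcast erefl e x = c *: U0 0 + d *: vol2).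
Proof.
move=> m2; elim=> {n x} [||n x _ [IH0 IH2]|n b x _ [IH0 IH2]|n|n x y _ [IHx0 IHx2] _ [IHy0 IHy2]|n
  c x _ [IH0 IH2]].
- by split=> // e; exists 1; rewrite hcast_id scale1r.
- split=> e; first by exfalso; move: m2; rewrite e.
  exists 0, 1; rewrite scale0r add0r scale1r /vol2; case: eqP => // e'.
  exact: hcast_irr.
- split=> // e; have e0 : n = 0 by case: e.
  subst n; have [c] := IH0 erefl; rewrite !hcast_id => ->.
  by exists c, 0; rewrite hcompZr hcomp1r scale0r addr0.
- split=> e; subst n; rewrite hcast_id.
    by have [c] := IH0 erefl; rewrite hcast_id hcomp1l; exists c.
  have [c [d]] := IH2 erefl; rewrite hcast_id => ->.
  have [t St] := adj_hom_perm C m 2 b.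
  exists c, ((-1) ^+ odd_perm t * d); rewrite hcompDr !hcompZr; congr (_ + _).
    by congr (_ *: _); case: b {t St} => [|b]; rewrite ?swap0_cup0 // adj_hom_out // hcomp1l.
  rewrite St mulrC -scalerA; congr (_ *: _); rewrite /vol2; case: eqP => [e|_].
    exact: perm_vol_cast.
  by rewrite hcomp0r scaler0.
- split=> e; subst n; rewrite hcast_id; first by exists 0; rewrite scale0r.
  by exists 0, 0; rewrite !scale0r addr0.
- split=> e; subst n; rewrite hcast_id.
    have [c] := IHx0 erefl; have [d] := IHy0 erefl; rewrite !hcast_id => -> ->.
    by exists (c + d); rewrite scalerDl.
  have [c [d]] := IHx2 erefl; have [c' [d']] := IHy2 erefl; rewrite !hcast_id => -> ->.
  by exists (c + c'), (d + d'); rewrite !scalerDl addrACA.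
- split=> e; subst n; rewrite hcast_id.
    have [d] := IH0 erefl; rewrite !hcast_id => ->.
    by exists (c * d); rewrite scalerA.
  have [d [d']] := IH2 erefl; rewrite !hcast_id => ->.
  by exists (c * d), (c * d'); rewrite scalerDr !scalerA.
Qed.

Lemma hom00 (x : H 0 0) : (2 <= m)%N -> exists c, x = c *: id_ 0.
Proof.
by move=> m2; have [/(_ erefl) + _] := spanned_small m2 (all_spanned x); rewrite hcast_id.
Qed.

Lemma hom02 (x : H 0 2) : (2 <= m)%N -> exists c d, x = c *: U0 0 + d *: vol2.
Proof.
by move=> m2; have [_ /(_ erefl)] := spanned_small m2 (all_spanned x); rewrite hcast_id.
Qed.

End Spanning.

(** * The split Casimir diagram *)

Section Omega.
Variables (C : numFieldType) (m : nat).
Local Notation H := (Hom C m).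
Local Notation id_ := (hid C m).
Local Notation "f ∘ g" := (hcomp f g) (at level 40, left associativity).
Local Notation S0 := (swap0 C m).
Local Notation U0 := (cup0 C m).
Local Notation A0 := (cap0 C m).
Local Notation P := (perm_hom C m).
Local Notation adj_hom := (adj_hom C m).
Local Notation D := (hD C m).
Local Notation Ds := (hDs C m).
Local Notation cupcap := (cupcap C m).

Let hcompE := (@hcompBr C m, @hcompBl C m, @hcompDr C m, @hcompDl C m).

(** The sum over j of the swap of the strands 0 and j minus the cup-cap
    through them. The terms with j > 1 are the terms of a smaller sum,
    conjugated by the first swap. *)
Fixpoint omega n : H n.+1 n.+1 :=
  match n return H n.+1 n.+1 with
  | 0 => 0
  | n'.+1 => S0 n' - U0 n' ∘ A0 n' + S0 n' ∘ lpad (omega n') ∘ S0 n'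
  end.

(** Both sides are the cup-cap through the strands 0 and 2. *)
Lemma lpad_cupcap n : S0 n.+1 ∘ lpad (U0 n ∘ A0 n) ∘ S0 n.+1 =
  lpad (S0 n) ∘ (U0 n.+1 ∘ A0 n.+1) ∘ lpad (S0 n).
Proof.
rewrite lpad_comp lpad_cup0 lpad_cap0 !hcompA swap0K hcomp1l -!hcompA.
by rewrite swap0K hcomp1r.
Qed.

(** The terms of the strands 1 and 2 are displayed, since these are the terms
    affected by a swap or by a cup on these strands. *)
Lemma omegaSS n : omega n.+2 = S0 n.+1 - U0 n.+1 ∘ A0 n.+1 + S0 n.+1 ∘ lpad (S0 n) ∘ S0 n.+1
  - lpad (S0 n) ∘ (U0 n.+1 ∘ A0 n.+1) ∘ lpad (S0 n)
  + S0 n.+1 ∘ lpad (S0 n) ∘ lpad (lpad (omega n)) ∘ lpad (S0 n) ∘ S0 n.+1.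
Proof.
rewrite [LHS]/= lpadD lpadB !hcompE lpad_cupcap !addrA.
by rewrite !lpad_comp !hcompA.
Qed.

(** The swap of the strands 1 and 2 exchanges their terms in [omega]. *)
Lemma omega_swap0 n : omega n.+2 ∘ lpad (S0 n) = lpad (S0 n) ∘ omega n.+2.
Proof.
have e1 : S0 n.+1 ∘ lpad (S0 n) ∘ S0 n.+1 ∘ lpad (S0 n) = lpad (S0 n) ∘ S0 n.+1.
  by rewrite swap0_braid -hcompA lpad_swap0K hcomp1r.
have e2 : lpad (S0 n) ∘ (S0 n.+1 ∘ lpad (S0 n) ∘ S0 n.+1) = S0 n.+1 ∘ lpad (S0 n).
  by rewrite swap0_braid !hcompA lpad_swap0K hcomp1l.
rewrite omegaSS !hcompE e1 e2.
have -> : lpad (S0 n) ∘ (U0 n.+1 ∘ A0 n.+1) ∘ lpad (S0 n) ∘ lpad (S0 n) =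
  lpad (S0 n) ∘ (U0 n.+1 ∘ A0 n.+1).
  by rewrite -hcompA lpad_swap0K hcomp1r.
have -> : lpad (S0 n) ∘ (lpad (S0 n) ∘ (U0 n.+1 ∘ A0 n.+1) ∘ lpad (S0 n)) =
  U0 n.+1 ∘ A0 n.+1 ∘ lpad (S0 n).
  by rewrite !hcompA lpad_swap0K hcomp1l.
congr (_ + _); last first.
  rewrite -(hcompA _ (lpad (S0 n)) (S0 n.+1)) -(hcompA _ _ (lpad (S0 n))) -swap0_braid.
  rewrite -!hcompA (hcompA (lpad (lpad _)) (S0 _)) -swap0_nat !hcompA.
  by rewrite swap0_braid.
by rewrite -[LHS]addrA [LHS]addrC [LHS]addrA.
Qed.

Lemma omega_adj n a : omega n ∘ lpad (adj_hom n a) = lpad (adj_hom n a) ∘ omega n.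
Proof.
elim: n a => [|n IH] a; first by rewrite hcomp0l hcomp0r.
case: a => [|a].
  case: n {IH} => [|n]; first by rewrite [adj_hom _ _]/= lpad_id hcomp1l hcomp1r.
  exact: omega_swap0.
rewrite [adj_hom n.+1 a.+1]/= [omega _]/= !hcompE swap0_nat.
congr (_ - _ + _); first by rewrite -hcompA cap0_nat hcompA cup0_nat hcompA.
rewrite -hcompA swap0_nat !hcompA -swap0_nat; apply: (congr1 (hcompr (S0 n))).
by rewrite -!hcompA -!lpad_comp IH.
Qed.

(** The terms of the two ends of the cup cancel: the form is invariant under
    so(m). *)
Lemma omega_cup0 n : omega n.+2 ∘ lpad (U0 n) = lpad (U0 n) ∘ omega n.
Proof.
have e0 : S0 n.+1 ∘ lpad (U0 n) = lpad (S0 n) ∘ U0 n.+1 by rewrite cup0_slide.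
have e1 : U0 n.+1 ∘ A0 n.+1 ∘ lpad (U0 n) = U0 n.+1 by rewrite -hcompA zigzagl hcomp1r.
have e2 : S0 n.+1 ∘ lpad (S0 n) ∘ S0 n.+1 ∘ lpad (U0 n) = U0 n.+1.
  by rewrite -hcompA e0 -hcompA (hcompA (lpad _)) lpad_swap0K hcomp1l swap0_cup0.
have e3 : lpad (S0 n) ∘ (U0 n.+1 ∘ A0 n.+1) ∘ lpad (S0 n) ∘ lpad (U0 n) = lpad (S0 n) ∘ U0 n.+1.
  by rewrite -(hcompA _ (lpad (S0 n))) -lpad_comp swap0_cup0 -hcompA e1.
rewrite omegaSS !hcompE e0 e1 e2 e3 subrK subrr add0r.
rewrite -(hcompA _ (S0 n.+1)) e0 -(hcompA _ (lpad (S0 n))) (hcompA (lpad _) (lpad _)) lpad_swap0K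
  hcomp1l.
by rewrite -hcompA -cup0_nat hcompA -lpad_cup0.
Qed.

(** The constant m - 1 is the Casimir value of the defining representation:
    the swap contributes a loop, that is m, and the cup-cap contributes a
    straight strand. *)
Lemma omega_contract n :
  A0 n.+1 ∘ lpad (S0 n) ∘ lpad (omega n.+1) ∘ U0 n.+1 = (m%:R - 1) *: id_ n.+1 + omega n.
Proof.
rewrite [omega n.+1]/= lpadD lpadB !hcompE scalerBl scale1r.
congr (_ - _ + _).
- by rewrite -(hcompA _ (lpad _) (lpad _)) lpad_swap0K hcomp1r cap0_cup0.
- rewrite -(hcompA (A0 _)) -lpad_comp hcompA swap0_cup0 lpad_comp hcompA zigzagl hcomp1l.
  exact: zigzagr.
rewrite !lpad_comp !hcompA -(hcompA _ (lpad (S0 n)) (lpad (S0 n))) lpad_swap0K hcomp1r cap0_nat.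
by rewrite -!hcompA (hcompA (A0 _)) zigzag_swap hcomp1r.
Qed.

(** Combinations of diagrams that contain a cap. They annihilate every element
    whose contractions vanish. *)
Inductive capped n : H n n -> Prop :=
| capped0 : capped 0
| cappedD f g : capped f -> capped g -> capped (f + g)
| cappedP s t : capped (P s ∘ cupcap n ∘ P t).

Lemma capped_conj n (f : H n n) s t : capped f -> capped (P s ∘ f ∘ P t).
Proof.
elim=> [|g h _ IHg _ IHh|s' t'].
- by rewrite hcomp0r hcomp0l; apply: capped0.
- by rewrite hcompDr hcompDl; apply: cappedD.
rewrite !hcompA -perm_homM -hcompA -perm_homM; exact: cappedP.
Qed.

Lemma capped_lpad n (f : H n n) : capped f -> capped (lpad f).
Proof.
move=> cf; elim: {f} cf => [|g h _ IHg _ IHh|s t].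
- by rewrite lpad0; apply: capped0.
- by rewrite lpadD; apply: cappedD.
rewrite !lpad_comp -!perm_hom_lift0; apply: capped_conj.
case: n {s t} => [|[|n]] /=; rewrite ?lpad0; try exact: capped0.
rewrite lpad_comp lpad_cup0 lpad_cap0 -perm_hom01 -perm_hom12 -perm_homM -(hcompA (A0 _))
  -perm_homM hcompA -(hcompA (P _)).
exact: cappedP.
Qed.

Lemma omega_sum n : exists2 R : H n.+1 n.+1, capped R &
  omega n = \sum_(j : 'I_n) P (tperm ord0 (fintype.lift ord0 j)) - R.
Proof.
elim: n => [|n [R cR IH]].
  by exists 0; [apply: capped0|rewrite big_ord0 subr0].
exists (U0 n ∘ A0 n + S0 n ∘ lpad R ∘ S0 n).
  apply: cappedD; last by rewrite -perm_hom01; apply/capped_conj/capped_lpad.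
  by have := cappedP (n := n.+2) 1 1; rewrite !perm_hom1 hcomp1l hcomp1r.
rewrite [omega _]/= IH lpadB hcompBr hcompBl big_ord_recl -perm_hom01.
have -> : P (tperm ord0 (o1 n)) ∘ lpad (\sum_(j < n) P (tperm ord0 (fintype.lift ord0 j))) ∘ P
  (tperm ord0 (o1 n))
  = \sum_(i < n) P (tperm ord0 (fintype.lift ord0 (fintype.lift ord0 i))).
  rewrite lpad_sum hcomp_sumr hcomp_suml; apply: eq_bigr => i _.
  rewrite -perm_hom_lift0 -tperm_lift -!perm_homM; congr (P _).
  rewrite -{1}(tpermV ord0 (o1 n)) -/(conjg _ _) tpermJ tpermR.
  by rewrite tpermD // (inj_eq (@lift_inj _ ord0)) .
by rewrite opprD -!addrA; congr (_ + _); rewrite addrCA.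
Qed.

Lemma vol_covol_vol : D ∘ (Ds ∘ D) = m`!%:R *: D.
Proof.
rewrite hcompA vol_covol hcomp_suml.
under eq_bigr => s _ do rewrite hcompZl perm_vol scalerA -signr_addb addbb scale1r.
by rewrite sumr_const card_Sn scaler_nat.
Qed.

Lemma omega_perm n (s : 'S_n) : omega n ∘ lpad (P s) = lpad (P s) ∘ omega n.
Proof.
elim/adj_ind: s => [|s a b ab IH]; first by rewrite perm_hom1 lpad_id hcomp1l hcomp1r.
by rewrite perm_hom_adj // lpad_comp hcompA omega_adj -hcompA IH hcompA.
Qed.

(** As Delta_m Delta_m^* Delta_m = m! Delta_m, and as [omega] commutes with
    Delta_m Delta_m^*, a sum of permutations, m! times [omega] applied to
    Delta_m factors through the pairing with Delta_m^*. *)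
Lemma omega_vol_of_pairing : lpad Ds ∘ (omega m ∘ lpad D) = 0 -> omega m ∘ lpad D = 0.
Proof.
move=> z0.
have : m`!%:R *: (omega m ∘ lpad D) = 0.
  rewrite -hcompZr -lpadZ -vol_covol_vol hcompA vol_covol lpad_comp hcompA lpad_sum hcomp_sumr.
  under eq_bigr => s _ do rewrite lpadZ hcompZr omega_perm -hcompZl -lpadZ.
  by rewrite -hcomp_suml -lpad_sum -vol_covol lpad_comp -!hcompA z0 hcomp0r.
move/eqP; rewrite scaler_eq0 pnatr_eq0; case/orP => [|/eqP //].
by rewrite eqn0Ngt fact_gt0.
Qed.

(** Infinitesimal invariance of diagrams. By [all_spanned] it has to be known
    for cups, for swaps and for Delta_m. *)
Lemma omega_invariant n (x : H 0 n) : omega m ∘ lpad D = 0 -> omega n ∘ lpad x = 0.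
Proof.
move=> OD; elim: (all_spanned x) => {n x} [||n x _ IH|n b x _ IH|n|n x y _ IHx _ IHy|n c x _ IH].
- by rewrite hcomp0l.
- exact: OD.
- by rewrite lpad_comp hcompA omega_cup0 -hcompA IH hcomp0r.
- by rewrite lpad_comp hcompA omega_adj -hcompA IH hcomp0r.
- by rewrite lpad0 hcomp0r.
- by rewrite lpadD hcompDr IHx IHy addr0.
- by rewrite lpadZ hcompZr IH scaler0.
Qed.

(** In omega (1 (x) x) = 0 the extra strand is bent into the first strand of
    x. *)
Theorem casimir_identity n (x : H 0 n.+1) : omega m ∘ lpad D = 0 ->
  (m%:R - 1) *: x + omega n ∘ x = 0.
Proof.
move=> OD; have /(congr1 (fun f => A0 n.+1 ∘ lpad (S0 n) ∘ lpad f ∘ U0 0)) := omega_invariant x OD.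
rewrite lpad_comp !hcompA -[_ ∘ lpad (lpad x) ∘ U0 0]hcompA -cup0_nat hcompA omega_contract.
by rewrite hcompDl hcompZl hcomp1l lpad0 hcomp0r hcomp0l.
Qed.

End Omega.

(** * Antisymmetric elements of symmetric group representations *)

Section Descent.
Variables (C : numFieldType) (m n : nat) (M : lmodType C) (rho : 'S_n -> {linear M -> M}).
Variable (K : M -> Prop).
Hypothesis rhoM : forall s t x, rho (s * t)%g x = rho t (rho s x).
Hypothesis rho1 : forall x, rho 1%g x = x.
Hypothesis KB : forall x y, K x -> K y -> K (x - y).
Hypothesis Krho : forall s x, K x -> K (rho s x).

Definition antisym_on (A : {set 'I_n}) (x : M) :=
  forall i i', i \in A -> i' \in A -> i != i' -> rho (tperm i i') x = - x.

Lemma subK0 x : K x -> K 0. Proof. by move=> Kx; rewrite -(subrr x); apply: KB. Qed.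

Lemma subKN x : K x -> K (- x). Proof. by move=> Kx; rewrite -sub0r; apply: KB => //;
  apply: subK0 Kx. Qed.

Lemma subKD x y : K x -> K y -> K (x + y).
Proof. by move=> Kx Ky; rewrite -(opprK y); apply: KB => //; apply: subKN. Qed.

(** The identity and the transpositions (l k) represent the cosets of the
    permutations of A among those of A and k; the signed sum over them extends
    the antisymmetry. *)
Lemma antisym_on_step A k x : antisym_on A x -> k \notin A ->
  antisym_on (k |: A) (x - \sum_(l in A) rho (tperm l k) x).
Proof.
move=> Ax kA; set y := x - _.
have inA i i' : i \in A -> i' \in A -> i != i' -> rho (tperm i i') y = - y.
  move=> iA i'A ii'; rewrite /y linearB linear_sum /= Ax // opprB [RHS]addrC.
  congr (_ + _); rewrite [in RHS](reindex_inj (@perm_inj _ (tperm i i'))) /= -sumrN.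
  have AA l : (tperm i i' l \in A) = (l \in A).
    by case: tpermP => [->|->|//]; rewrite iA i'A.
  rewrite [RHS](eq_bigl _ _ AA); apply: eq_bigr => l lA; rewrite -rhoM.
  have tk : tperm i i' k = k.
    by rewrite tpermD //; apply: contraNneq kA => <-.
  have -> : (tperm l k * tperm i i' = tperm i i' * tperm (tperm i i' l) k)%g.
    by rewrite -{2}tk -tpermJ /conjg tpermV !mulgA tperm2 mul1g.
  by rewrite rhoM Ax // linearN opprK.
have kin i : i \in A -> rho (tperm i k) y = - y.
  move=> iA; rewrite /y linearB linear_sum /= (bigD1 i) //= -rhoM tperm2 rho1.
  rewrite [in RHS](bigD1 i) //=.
  rewrite (_ : \sum_(_ in A | _) rho (tperm i k) _ = - \sum_(l in A | l != i) rho (tperm l k) x).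
    by rewrite !opprB addrA.
  rewrite -sumrN; apply: eq_bigr => l /andP[lA li].
  have ik : i != k by apply: contraNneq kA => <-.
  have -> : rho (tperm i k) (rho (tperm l k) x) = rho (tperm l k) (rho (tperm i l) x).
    rewrite -!rhoM (_ : tperm i k = tperm i l ^ tperm l k)%g; last first.
      by rewrite tpermJ tpermL tpermD // eq_sym.
    by rewrite /conjg tpermV !mulgA tperm2 mul1g.
  by rewrite Ax 1?eq_sym // linearN.
move=> i i'; rewrite !inE => /predU1P[->|iA] /predU1P[->|i'A] ii'.
- by rewrite eqxx in ii'.
- by rewrite tpermC; apply: kin.
- exact: kin.
- exact: inA.
Qed.

Lemma antisym_on_perm (A B : {set 'I_n}) (t : 'S_n) x : antisym_on A x ->
  (forall i, i \in B -> (t^-1)%g i \in A) -> antisym_on B (rho t x).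
Proof.
move=> Ax BA i i' iB i'B ii'; rewrite -rhoM.
have -> : (t * tperm i i' = tperm (t^-1 i) (t^-1 i') * t)%g.
  by rewrite -tpermJ /conjg invgK !mulgA mulgKV.
by rewrite rhoM Ax ?BA ?linearN // (inj_eq perm_inj).
Qed.

Hypothesis n_gt0 : (0 < n)%N.
Hypothesis casimirK : forall x, K x -> forall i : 'I_n,
  \sum_(k | k != i) rho (tperm i k) x = (1 - m%:R) *: x.
Definition slots_below j := [set i : 'I_n | (i < j)%N].
Hypothesis antisym_topK : (m <= n)%N -> forall x, K x -> antisym_on (slots_below m) x -> x = 0.

Lemma card_slots_below j : (j <= n)%N -> #|slots_below j| = j.
Proof.
move=> jn; rewrite -sum1_card.
rewrite (eq_bigl (fun i : 'I_n => (i < j)%N)) => [|i]; last by rewrite inE.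
by rewrite -(big_ord_widen n (fun=> 1%N) jn) sum1_card card_ord.
Qed.

(** For k outside the first j slots, the antisymmetrisation of x over these
    slots and k vanishes, so the sum of (l k) x over l < j is x. The sum over
    all k for a fixed l is known from the Casimir hypothesis. Comparing the
    two double sums yields a positive multiple of x that vanishes. *)
Lemma descent_step j : (j < m)%N -> (j <= n)%N ->
  ((j < n)%N -> forall x, K x -> antisym_on (slots_below j.+1) x -> x = 0) ->
  forall x, K x -> antisym_on (slots_below j) x -> x = 0.
Proof.
move=> jm jn IH x Kx Ax.
(* The antisymmetrisation of x over the slots below j and k; the transposition
   t moves it to the slots below j.+1. *)
have e k : k \notin slots_below j -> \sum_(l in slots_below j) rho (tperm l k) x = x.
  move=> kA; have kj : (j <= k)%N by move: kA; rewrite inE -leqNgt.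
  have jn' : (j < n)%N := leq_ltn_trans kj (ltn_ord k).
  set y := \sum_(_ in _) _; apply/esym/eqP; rewrite -subr_eq0; apply/eqP.
  pose t := tperm (Ordinal jn') k.
  have : rho t (x - y) = 0.
    apply: (IH jn').
      apply/Krho/KB => //; rewrite /y; elim/big_ind: _ => [|a b|l _];
        [exact: subK0 Kx|exact: subKD|].
      exact: Krho.
    apply: (antisym_on_perm (antisym_on_step Ax kA)) => i; rewrite tpermV !inE /t => ij.
    case: tpermP => [_|ik|/eqP i1 /eqP i2]; first by rewrite eqxx.
      move: ij; rewrite ik ltnS leq_eqVlt => /orP[/eqP kj'|]; last by rewrite ltnNge kj.
      by rewrite -val_eqE /= kj' eqxx.
    by move: ij i1; rewrite -val_eqE /= ltnS leq_eqVlt => /orP[->|-> _] //; rewrite orbT.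
  move=> /(congr1 (rho t)); rewrite -rhoM tperm2 rho1 linear0; exact.
(* The j - 1 terms with k below j contribute - x each. *)
have e2 l : l \in slots_below j -> \sum_(k in ~: slots_below j) rho (tperm l k) x =
  (j%:R - m%:R) *: x.
  move=> lA; have := casimirK Kx l; rewrite (bigID (mem (slots_below j))) /=.
  rewrite (eq_bigr (fun=> - x)) => [|k /andP[kl kA]]; last by rewrite Ax // eq_sym.
  rewrite [X in _ + X](eq_bigl (fun k => k \in ~: slots_below j)) => [|k]; last first.
    rewrite in_setC; apply/andP/idP => [[]//|kA]; split=> //.
    by apply: contraNneq kA => ->.
  move/(canRL (addKr _)) => ->.
  rewrite sumr_const (_ : #|_| = j.-1); last first.
    transitivity #|slots_below j :\ l|.
      by apply: eq_card => k; rewrite -[LHS]/((k != l) && (k \in slots_below j)) !inE.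
    by have := cardsD1 l (slots_below j);
      rewrite card_slots_below // lA add1n => /(congr1 predn) /= ->.
  rewrite mulNrn opprK -scaler_nat -scalerDl; congr (_ *: _).
  have j0 : (0 < j)%N by move: lA; rewrite inE; case: (j).
  by rewrite -[in RHS](prednK j0) mulrS addrC addrA [_ + 1]addrC.
(* The two values of this double sum give ((n - j) + j (m - j)) x = 0. *)
have : \sum_(k in ~: slots_below j) \sum_(l in slots_below j) rho (tperm l k) x = (n - j)%:R *: x.
  rewrite (eq_bigr (fun=> x)) => [|k]; last by rewrite in_setC; apply: e.
  by rewrite sumr_const cardsCs setCK card_slots_below // card_ord scaler_nat.
rewrite exchange_big /= (eq_bigr (fun=> (j%:R - m%:R) *: x)); last exact: e2.
rewrite sumr_const card_slots_below // -scaler_nat scalerA => /eqP.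
rewrite eq_sym -subr_eq0 -scalerBl -[j%:R - m%:R]opprB mulrN opprK -natrB ?(ltnW jm) // -natrM
  -natrD.
rewrite scaler_eq0 pnatr_eq0 addn_eq0 muln_eq0 !subn_eq0.
case/orP => [|/eqP //]; case/andP=> nj /orP[/eqP j0|]; last by rewrite leqNgt jm.
by move: n_gt0; rewrite ltnNge -{1}j0 nj.
Qed.

(** By descending induction on the number j of slots in which x is
    antisymmetric, from the minimum of m and n down to j = 0, where
    antisymmetry says nothing. *)
Lemma descent x : K x -> x = 0.
Proof.
have main d : forall j, (j <= m)%N -> (j <= n)%N -> (minn m n - j = d)%N ->
    forall x, K x -> antisym_on (slots_below j) x -> x = 0.
  elim: d => [|d IHd] j jm jn jd.
    have [mn|nm] := leqP m n.
      have -> : j = m by lia.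
      exact: antisym_topK.
    by apply: descent_step => //; lia.
  apply: descent_step => //; first by lia.
  by move=> jn'; apply: IHd => //; lia.
move=> Kx; apply: (main _ 0 _ _ erefl) => // i i'; by rewrite inE.
Qed.

End Descent.

(** * Vanishing of submodules with the Casimir identity *)

#[local] Arguments perm_hom : simpl never.
Section Vanishing.
Variables (C : numFieldType) (m : nat).
Local Notation H := (Hom C m).
Local Notation id_ := (hid C m).
Local Notation "f ∘ g" := (hcomp f g) (at level 40, left associativity).
Local Notation P := (perm_hom C m).
Local Notation D := (hD C m).
Local Notation Ds := (hDs C m).

Variables (M : nat -> lmodType C) (act : forall i j, H i j -> {linear M i -> M j}).
Hypothesis act_comp : forall i j k (f : H j k) (g : H i j) x, act (f ∘ g) x = act f (act g x).
Hypothesis act_id : forall i x, act (id_ i) x = x.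
Hypothesis actD : forall i j (f g : H i j) x, act (f + g) x = act f x + act g x.
Hypothesis actZ : forall i j a (f : H i j) x, act (a *: f) x = a *: act f x.
Variable (K : forall n, M n -> Prop).
Hypothesis KB : forall n (x y : M n), K x -> K y -> K (x - y).
Hypothesis Kact : forall i j (f : H i j) x, K x -> K (act f x).
Hypothesis Kbase : forall x : M 0, K x -> x = 0.
Hypothesis Kcasimir : forall n (x : M n.+1), K x -> (m%:R - 1) *: x + act (omega C m n) x = 0.
Hypothesis m_gt0 : (0 < m)%N.

Lemma act0 i j x : act (0 : H i j) x = 0.
Proof. by rewrite -(scale0r 0) actZ scale0r. Qed.

Lemma act_sum i j I (r : seq I) (Q : pred I) (F : I -> H i j) x :
  act (\sum_(y <- r | Q y) F y) x = \sum_(y <- r | Q y) act (F y) x.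
Proof. by apply: (big_morph (fun f => act f x)) => [f g|]; rewrite ?actD ?act0. Qed.

Lemma capped_vanish n (f : H n n) x : capped f ->
  (forall n' (e : n = n'.+2) y, K (y : M n') -> y = 0) -> K x -> act f x = 0.
Proof.
move=> cf IH Kx; elim: {f} cf => [|g h _ IHg _ IHh|s t].
- exact: act0.
- by rewrite actD IHg IHh addr0.
rewrite act_comp; have := Kact (P t) Kx; move: (act _ x) => {x Kx t} y Ky.
rewrite act_comp; suff -> : act (cupcap C m n) y = 0 by rewrite linear0.
case: n IH y Ky {s} => [|[|n]] IH y Ky; try exact: act0.
have A0y : act (cap0 C m n) y = 0 by apply: (IH n erefl); apply: Kact.
by rewrite act_comp A0y linear0.
Qed.

(** By strong induction on n: a contraction of x, and its pairing with
    Delta_m^*, lie in K at smaller values of n. Hence [omega] acts on x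
    through transpositions only, and elements antisymmetric in m slots are 0,
    so [descent] applies. *)
Theorem vanishing n (x : M n) : K x -> x = 0.
Proof.
elim/ltn_ind: n x => n IH x Kx.
case: (posnP n) => [n0|n0]; first by subst n; apply: Kbase.
have rhoM (s t : 'S_n) (y : M n) : act (P (s * t)) y = act (P t) (act (P s) y).
  by rewrite perm_homM act_comp.
have rho1 (y : M n) : act (P 1) y = y by rewrite perm_hom1 act_id.
apply: (descent (rho := fun s : 'S_n => act (P s)) (m := m) (K := @K n)) => //.
- by move=> y z; apply: KB.
- by move=> s y; apply: Kact.
(* The Casimir identity is about slot 0; conjugation by the transposition (0
   i) carries it to slot i. *)
- case: n n0 IH x Kx rhoM rho1 => // n _ IH x Kx rhoM rho1 y Ky i.
  have L0 (z : M n.+1) : K z -> \sum_(k : 'I_n.+1 | k != ord0) act (P (tperm ord0 k)) z =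
    (1 - m%:R) *: z.
    move=> Kz; have [R cR eR] := omega_sum C m n.
    have := Kcasimir Kz; rewrite eR -scaleN1r actD actZ act_sum.
    rewrite (capped_vanish cR) // => [|n' e u]; last first.
      by apply: IH; rewrite e; apply: ltnW.
    rewrite scaler0 addr0 => /(canRL (addKr _)); rewrite -scaleNr opprB addr0 => <-.
    rewrite big_mkcond big_ord_recl /= add0r; exact: eq_bigr.
  pose t : 'S_n.+1 := tperm ord0 i.
  have := L0 (act (P t) y) (Kact _ Ky) => /(congr1 (act (P t))).
  rewrite linearZ /= -!rhoM {1 2}/t tperm2 rho1 => <-.
  rewrite linear_sum /= (reindex_inj (@perm_inj _ t)) /=.
  apply: eq_big => [k|k ki].
    by rewrite -[k == ord0](inj_eq (@perm_inj _ t)) /t tpermL.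
  rewrite -!rhoM; congr (act (P _) y).
  have -> : tperm i (t k) = (tperm ord0 k ^ t)%g by rewrite tpermJ /t tpermL.
  by rewrite /conjg tpermV mulgA.
(* If y is antisymmetric in the first m slots, Delta_m Delta_m^* multiplies it
   by m!, while Delta_m^* sends it to K at a smaller value of n. *)
- move=> mn y Ky Ay; have [k e] : exists k, n = (m + k)%N by exists (n - m)%N; rewrite subnKC.
  subst n.
  have sgn (s : 'S_m) : act (rpad k (P s)) y = (-1) ^+ odd_perm s *: y.
    elim/adj_ind: s => [|s a b ab IHs]; first by rewrite perm_hom1 rpad_id act_id odd_perm1 expr0
      scale1r.
    rewrite perm_hom_adj // rpad_comp act_comp IHs linearZ /= rpad_adj -?ab //.
    have lt : (a.+1 < m + k)%N by rewrite -ab ltn_addr.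
    rewrite (adj_hom_tperm _ _ lt) Ay ?inE -?val_eqE /= ?neq_ltn ?ltnSn //; last by rewrite -ab.
    rewrite odd_permM odd_tperm -val_eqE /= ab neq_ltn ltnSn /=.
    by rewrite signr_addb expr1 mulrN1 scalerN scaleNr.
  have : act (rpad k (D ∘ Ds)) y = 0.
    have Dsy : act (rpad k Ds) y = 0 :> M k.
      by apply: (IH k); [rewrite -[X in (X < _)%N]add0n ltn_add2r|apply: Kact].
    by rewrite rpad_comp act_comp Dsy linear0.
  rewrite vol_covol /rpad -/(htensr (id_ k) _) raddf_sum act_sum.
  under eq_bigr => s _ do rewrite /= /htensr htensZl actZ -/(rpad k _) sgn scalerA -signr_addb
    addbb scale1r.
  rewrite sumr_const card_Sn -scaler_nat => /eqP; rewrite scaler_eq0 pnatr_eq0.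
  by rewrite eqn0Ngt fact_gt0 => /eqP.
Qed.

End Vanishing.

(** * Sums over words *)

Section WordSums.
Variables (m : nat).
Local Notation word := (seq 'I_m).

(** Coordinates of tensors are indexed by words and not by functions on an
    ordinal: the length of a word is not part of its type, so that transports
    along equalities of objects have no effect on evaluation. *)
Fixpoint word_sum (R : nmodType) n (G : word -> R) : R :=
  match n with
  | 0 => G [::]
  | n'.+1 => \sum_(a : 'I_m) word_sum n' (fun u => G (a :: u))
  end.

Lemma eq_word_sum (R : nmodType) n (G G' : word -> R) :
  (forall u, size u = n -> G u = G' u) -> word_sum n G = word_sum n G'.
Proof.
elim: n G G' => [|n IH] G G' GG' /=; first exact: GG'.
by apply: eq_bigr => a _; apply: IH => u un; rewrite GG' //= un.
Qed.

Lemma word_sumD (R : nmodType) n (G G' : word -> R) :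
  word_sum n (fun u => G u + G' u) = word_sum n G + word_sum n G'.
Proof. by elim: n G G' => //= n IH G G'; rewrite -big_split; apply: eq_bigr. Qed.

Lemma word_sum0 (R : nmodType) n : word_sum n (fun=> 0 : R) = 0.
Proof. by elim: n => //= n IH; rewrite big1. Qed.

Lemma word_sum_sum (R : nmodType) n I (r : seq I) (Q : pred I) (G : I -> word -> R) :
  word_sum n (fun u => \sum_(i <- r | Q i) G i u) = \sum_(i <- r | Q i) word_sum n (G i).
Proof.
elim: n G => //= n IH G; rewrite [RHS]exchange_big /=; apply: eq_bigr => a _.
exact: IH.
Qed.

Lemma word_sum_exch (R : nmodType) n k (G : word -> word -> R) :
  word_sum n (fun u => word_sum k (fun v => G u v)) =
    word_sum k (fun v => word_sum n (fun u => G u v)).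
Proof.
elim: n G => //= n IH G; rewrite word_sum_sum; apply: eq_bigr => a _; exact: IH.
Qed.

Lemma word_sum_cat (R : nmodType) n k (G : word -> R) :
  word_sum (n + k) G = word_sum n (fun u => word_sum k (fun v => G (u ++ v))).
Proof. by elim: n G => //= n IH G; apply: eq_bigr => a _; apply: IH. Qed.

Lemma word_sum_ffun (R : nmodType) n (G : word -> R) :
  word_sum n G = \sum_(t : {ffun 'I_n -> 'I_m}) G (codom t).
Proof.
elim: n G => [|n IH] G /=.
  have e (t : {ffun 'I_0 -> 'I_m}) : codom t = [::].
    by apply/nilP; rewrite /nilp size_codom card_ord.
  rewrite (eq_bigr (fun=> G [::])) => [|t _]; last by rewrite e.
  by rewrite sumr_const card_ffun !card_ord expn0.
under eq_bigr => a _ do rewrite IH.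
rewrite pair_big /=.
pose f (p : 'I_m * {ffun 'I_n -> 'I_m}) : {ffun 'I_n.+1 -> 'I_m} :=
  [ffun i => if unlift ord0 i is Some j then p.2 j else p.1].
pose g (t : {ffun 'I_n.+1 -> 'I_m}) := (t ord0, [ffun j => t (fintype.lift ord0 j)]).
rewrite [RHS](reindex f); last first.
  exists g => [[a t] _|t _]; rewrite /f /g.
    by congr pair; [rewrite ffunE unlift_none|apply/ffunP=> j; rewrite !ffunE liftK].
  by apply/ffunP=> i; rewrite ffunE; case: unliftP => [j ->|->] //=; rewrite ffunE.
apply: eq_bigr => [[a t]] _ /=; congr (G _).
rewrite !codomE enum_ordSl /= -map_comp /f ffunE unlift_none; congr cons.
by apply: eq_map => j; rewrite /= ffunE liftK.
Qed.

Section Ring.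
Variable (R : pzRingType).

Lemma word_sum_mull n (c : R) (G : word -> R) : word_sum n (fun u => c * G u) = c * word_sum n G.
Proof.
elim: n G => //= n IH G; rewrite big_distrr; apply: eq_bigr => a _; exact: IH.
Qed.

Lemma word_sum_mulr n (c : R) (G : word -> R) : word_sum n (fun u => G u * c) = word_sum n G * c.
Proof.
elim: n G => //= n IH G; rewrite big_distrl; apply: eq_bigr => a _; exact: IH.
Qed.

Lemma word_sum_delta n v (G : word -> R) : size v = n ->
  word_sum n (fun u => (v == u)%:R * G u) = G v.
Proof.
elim: n v G => [|n IH] [|a v] //= G; first by rewrite mul1r.
move=> [vn]; rewrite (bigD1 a) //= [X in _ + X]big1 => [|b ba].
  rewrite addr0 -[RHS](IH v (fun u => G (a :: u)) vn).
  by apply: eq_word_sum => u _; rewrite eqseq_cons eqxx.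
rewrite -[RHS](word_sum0 R n); apply: eq_word_sum => u _.
by rewrite eqseq_cons eq_sym (negbTE ba) mul0r.
Qed.

End Ring.

End WordSums.

(** * Evaluation of diagrams in orthonormal coordinates *)

Section Kernels.
Variables (C : numFieldType) (m : nat).
Local Notation T := (term C m).
Local Notation word := (seq 'I_m).

(** Row i is the basis vector named by the letter i. The determinant is the
    coefficient of the word in the signed sum of the permutations of e_1 (x)
    ... (x) e_m. The default of [nth] only affects words shorter than m. *)
Definition letter_mx (u : word) : 'M[C]_m := \matrix_(i, j) (nth j u i == j)%:R.

(** Matrix coefficients in an orthonormal basis, outputs first. They are
    meaningful only on words of the right lengths, whence the conditions on
    sizes below. *)
Fixpoint kernel i j (t : T i j) : word -> word -> C :=
  match t in term _ _ i j return word -> word -> C with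
  | Idn _ => fun u v => (u == v)%:R
  | gU => fun u _ => if u is [:: a; b] then (a == b)%:R else 0
  | gA => fun _ v => if v is [:: a; b] then (a == b)%:R else 0
  | gX => fun u v => (rev u == v)%:R
  | gD => fun u _ => \det (letter_mx u)
  | gDs => fun _ v => \det (letter_mx v)
  | Comp _ j _ f g => fun u v => word_sum j (fun w => kernel f u w * kernel g w v)
  | Tens i j _ _ f g => fun u v =>
      kernel f (take j u) (take i v) * kernel g (drop j u) (drop i v)
  | Zero _ _ => fun _ _ => 0
  | Add _ _ f g => fun u v => kernel f u v + kernel g u v
  | Scale _ _ a f => fun u v => a * kernel f u v
  end.

Lemma kernel_star i j (f : T i j) u v : kernel (star f) u v = kernel f v u.
Proof.
elim: f u v => //= [n||??? f IHf g IHg|???? f IHf g IHg|?? f IHf g IHg|?? a f IHf] u v.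
- by rewrite eq_sym.
- by rewrite eq_sym (can2_eq revK revK) eq_sym.
- by apply: eq_word_sum => w _; rewrite IHf IHg mulrC.
- by rewrite IHf IHg.
- by rewrite IHf IHg.
- by rewrite IHf.
Qed.

Definition eval i j (f : T i j) (y : word -> C) (u : word) : C :=
  word_sum i (fun v => kernel f u v * y v).

Lemma eq_eval i j (f : T i j) y y' u :
  (forall v, size v = i -> y v = y' v) -> eval f y u = eval f y' u.
Proof. by move=> yy'; apply: eq_word_sum => v vi; rewrite yy'. Qed.

Lemma eval_delta i j (f : T i j) u v : size v = i ->
  eval f (fun w => (v == w)%:R) u = kernel f u v.
Proof.
move=> vi; rewrite -(word_sum_delta (kernel f u) vi); apply: eq_word_sum => w _.
by rewrite mulrC.
Qed.

Lemma eval_ext i j (f g : T i j) :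
  (forall y u, size u = j -> eval f y u = eval g y u) ->
  forall u v, size u = j -> size v = i -> kernel f u v = kernel g u v.
Proof. by move=> fg u v uj vi; rewrite -!eval_delta // fg. Qed.

Lemma eval_exch i j k l (f : T i j) (g : T k l) (y : word -> word -> C) u u' :
  eval f (fun v => eval g (y v) u') u = eval g (fun w => eval f (fun v => y v w) u) u'.
Proof.
rewrite /eval; under eq_word_sum => v _ do rewrite -word_sum_mull.
rewrite word_sum_exch; apply: eq_word_sum => w _; rewrite -word_sum_mull; apply: eq_word_sum => v _.
by rewrite mulrCA.
Qed.

Lemma eval_Idn n y u : size u = n -> eval (Idn n) y u = y u.
Proof. by move=> un; rewrite /eval word_sum_delta. Qed.

Lemma eval_Comp i j k (f : T j k) (g : T i j) y u : eval (Comp f g) y u = eval f (eval g y) u.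
Proof.
rewrite /eval /=; under eq_word_sum => v _ do rewrite -word_sum_mulr.
rewrite word_sum_exch; apply: eq_word_sum => w _; rewrite -word_sum_mull.
by apply: eq_word_sum => v _; rewrite mulrA.
Qed.

Lemma eval_Tens i j k l (f : T i j) (g : T k l) y u :
  eval (Tens f g) y u = eval f (fun v => eval g (fun w => y (v ++ w)) (drop j u)) (take j u).
Proof.
rewrite /eval word_sum_cat; apply: eq_word_sum => v vi; rewrite -word_sum_mull.
apply: eq_word_sum => w _ /=; rewrite take_size_cat // drop_size_cat //.
by rewrite mulrA.
Qed.

Lemma eval_Tens_cat i j k l (f : T i j) (g : T k l) y u u' : size u = j ->
  eval (Tens f g) y (u ++ u') = eval f (fun v => eval g (fun w => y (v ++ w)) u') u.
Proof. by move=> uj; rewrite eval_Tens take_size_cat // drop_size_cat. Qed.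

Lemma eval_Add i j (f g : T i j) y u : eval (Add f g) y u = eval f y u + eval g y u.
Proof. by rewrite /eval -word_sumD; apply: eq_word_sum => v _ /=; rewrite mulrDl. Qed.

Lemma eval_Scale i j a (f : T i j) y u : eval (Scale a f) y u = a * eval f y u.
Proof. by rewrite /eval -word_sum_mull; apply: eq_word_sum => v _ /=; rewrite mulrA. Qed.

Lemma eval_Zero i j y u : eval (Zero C m i j) y u = 0.
Proof. by rewrite /eval -[RHS](word_sum0 m C i); apply: eq_word_sum => v _ /=; rewrite mul0r. Qed.

Lemma eval_cast i j i' j' (ei : i = i') (ej : j = j') (f : T i j) y u :
  eval (castt ei ej f) y u = eval f y u.
Proof. by case: _ / ei; case: _ / ej. Qed.

Lemma evalD i j (f : T i j) y y' u : eval f (fun v => y v + y' v) u = eval f y u + eval f y' u.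
Proof. by rewrite /eval -word_sumD; apply: eq_word_sum => v _; rewrite mulrDr. Qed.

Lemma evalZ i j (f : T i j) a y u : eval f (fun v => a * y v) u = a * eval f y u.
Proof. by rewrite /eval -word_sum_mull; apply: eq_word_sum => v _; rewrite mulrCA. Qed.

Lemma eval_X y a b : eval gX y [:: a; b] = y [:: b; a].
Proof. by rewrite /eval /= -(word_sum_delta (n := 2) y (erefl : size [:: b; a] = 2)). Qed.

Lemma eval_A y : eval gA y [::] = \sum_a y [:: a; a].
Proof.
rewrite /eval /=; apply: eq_bigr => a _.
rewrite (bigD1 a) //= eqxx mul1r big1 ?addr0 // => b.
by rewrite eq_sym => /negbTE ->; rewrite mul0r.
Qed.

Lemma eval_U y a b : eval gU y [:: a; b] = (a == b)%:R * y [::].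
Proof. by []. Qed.

Lemma eval_I y a : eval (Idn 1) y [:: a] = y [:: a]. Proof. exact: eval_Idn. Qed.

Lemma eval_lpad i j (f : T i j) y a u :
  eval (Tens (Idn 1) f) y (a :: u) = eval f (fun v => y (a :: v)) u.
Proof. by rewrite -[a :: u]/([:: a] ++ u) eval_Tens_cat // eval_I. Qed.

Lemma eval_rpad n i j (f : T i j) y u u' : size u = j -> size u' = n ->
  eval (Tens f (Idn n)) y (u ++ u') = eval f (fun v => y (v ++ u')) u.
Proof.
by move=> uj un; rewrite eval_Tens_cat //; apply: eq_eval => v _; rewrite eval_Idn.
Qed.

Lemma eval_swap0 n y a b u : size u = n ->
  eval (Tens gX (Idn n)) y [:: a, b & u] = y [:: b, a & u].
Proof. by move=> un; rewrite -[_ :: _]/([:: a; b] ++ u) eval_rpad // eval_X. Qed.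

Lemma eval_cap0 n y u : size u = n ->
  eval (Tens gA (Idn n)) y u = \sum_a y [:: a, a & u].
Proof. by move=> un; rewrite -[u]/([::] ++ u) eval_rpad // eval_A. Qed.

Lemma eval_cup0 n y a b u : size u = n ->
  eval (Tens gU (Idn n)) y [:: a, b & u] = (a == b)%:R * y u.
Proof. by move=> un; rewrite -[_ :: _]/([:: a; b] ++ u) eval_rpad // eval_U. Qed.

Lemma eval_lpadn n r (f : T n n) y u v : size u = r ->
  eval (Tens (Idn r) f) y (u ++ v) = eval f (fun w => y (u ++ w)) v.
Proof. by move=> ur; rewrite eval_Tens_cat // eval_Idn. Qed.

Lemma eval_cross n y a u : size u = n -> eval (cross C m n) y (rcons u a) = y (a :: u).
Proof.
elim: n u y => [|n IH] [|b u] // y; first by rewrite eval_I.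
move=> [un]; rewrite rcons_cons /= eval_Comp eval_lpad IH // eval_swap0 //.
Qed.

Lemma eval_caps n y : eval (caps C m n) y [::] = word_sum n (fun t => y (t ++ t)).
Proof.
elim: n y => [|n IH] y; first by rewrite eval_Idn.
rewrite /= eval_Comp IH -(word_sum_sum n _ _ (fun a t => y ((a :: t) ++ a :: t))).
apply: eq_word_sum => t tn; rewrite eval_Comp eval_Tens_cat // eval_Idn // eval_cap0 //.
apply: eq_bigr => a _; rewrite eval_cast -(cat_rcons a t (a :: t)) eval_rpad.
- exact: (eval_cross (fun v => y (v ++ a :: t)) a tn).
- by rewrite size_rcons tn addn1.
- by rewrite /= tn.
Qed.

Lemma codom_swap n (x : {ffun 'I_n -> 'I_m}) (a b : 'I_n) (u v : word) p q :
  b = a.+1 :> nat -> size u = a -> codom x = u ++ [:: p, q & v] ->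
  codom [ffun i => x (tperm a b i)] = u ++ [:: q, p & v].
Proof.
move=> ab ua xe.
have nthx (z : {ffun 'I_n -> 'I_m}) (i : 'I_n) : nth p (codom z) i = z i.
  by rewrite codomE (nth_map i) ?size_enum_ord // nth_ord_enum.
have xa : x a = p by rewrite -nthx xe nth_cat ua ltnn subnn.
have xb : x b = q by rewrite -nthx xe nth_cat ua ab ltnNge leqnSn /= subSnn.
have sz : size (u ++ [:: p, q & v]) = n by rewrite -xe size_codom card_ord.
apply: (@eq_from_nth _ p); first by rewrite size_codom card_ord -sz !size_cat.
move=> i; rewrite size_codom card_ord => lt.
move: (Ordinal lt) (erefl : nat_of_ord (Ordinal lt) = i) => o <-.
rewrite nthx ffunE; case: tpermP => [->|->|].
- by rewrite xb nth_cat ua ltnn subnn.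
- by rewrite xa nth_cat ua ab ltnNge leqnSn /= subSnn.
move=> /eqP + /eqP; rewrite -!val_eqE /= ab => ia ib.
rewrite -nthx xe /= !nth_cat ua; case: ltnP => // ai.
have -> : (o - a = (o - a - 2).+2)%N by move/eqP: ia; move/eqP: ib; lia.
by [].
Qed.

Lemma eval_simple n (x : {ffun 'I_n -> 'I_m}) (a b : 'I_n) k (e : (a + (2 + k) = n)%N) y :
  b = a.+1 :> nat ->
  eval (simple C m e) y (codom x) = y (codom [ffun i => x (tperm a b i)]).
Proof.
move=> ab; rewrite /simple eval_cast.
have sx : size (codom x) = n by rewrite size_codom card_ord.
have : codom x = take a (codom x) ++ drop a (codom x) by rewrite cat_take_drop.
have : size (drop a (codom x)) = k.+2 by rewrite size_drop sx -[X in (X - _)%N]e addKn.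
have : size (take a (codom x)) = a by rewrite size_takel // sx ltnW.
move: (take _ _) (drop _ _) => u [|p [|q v]] // ua [vk] xe.
by rewrite (codom_swap ab ua xe) xe eval_lpadn // eval_swap0.
Qed.

Lemma eval_lift n (s : 'S_n) (t : T n n) : lift s t -> forall (x : {ffun 'I_n -> 'I_m}) y,
  eval t y (codom x) = y (codom [ffun i => x (s i)]).
Proof.
elim=> [x y|a b k e s' t' ab _ IH x y].
  rewrite eval_Idn ?size_codom ?card_ord //.
  by have -> : [ffun i => x ((1%g : 'S_n) i)] = x by apply/ffunP=> i; rewrite ffunE perm1.
rewrite eval_Comp (eval_simple _ _ _ ab) IH.
set z := [ffun i => _]; have -> // : z = [ffun i => x ((s' * tperm a b)%g i)].
by apply/ffunP=> i; rewrite !ffunE permM.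
Qed.

Lemma letter_mx_codom (x : {ffun 'I_m -> 'I_m}) : letter_mx (codom x) = \matrix_(i,
  j) (x i == j)%:R.
Proof.
apply/matrixP=> i j; rewrite !mxE; congr ((_ == _)%:R).
by rewrite codomE (nth_map i) ?size_enum_ord // nth_ord_enum.
Qed.

Lemma word_codom n (u : word) : size u = n -> exists x : {ffun 'I_n -> 'I_m}, u = codom x.
Proof.
move=> un; exists [ffun i => tnth (Tuple (introT eqP un)) i].
rewrite codomE; transitivity (map (tnth (Tuple (introT eqP un))) (enum 'I_n)).
  by rewrite map_tnth_enum.
by apply: eq_map => i; rewrite ffunE.
Qed.

End Kernels.

(** * Soundness of evaluation *)

Section Soundness.
Variables (C : numFieldType) (m : nat).
Local Notation T := (term C m).

Lemma nth_codom n p (z : {ffun 'I_n -> 'I_m}) (i : 'I_n) : nth p (codom z) i = z i.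
Proof. by rewrite codomE (nth_map i) ?size_enum_ord // nth_ord_enum. Qed.

Definition same_eval i j (f g : T i j) := forall y u, size u = j -> eval f y u = eval g y u.

Lemma same_eval_star i j (f g : T i j) : same_eval f g -> same_eval (star f) (star g).
Proof.
move=> fg y u ui; apply: eq_word_sum => v vj; rewrite !kernel_star.
by rewrite (eval_ext fg).
Qed.

Lemma same_eval_Comp i j k (f f' : T j k) (g g' : T i j) :
  same_eval f f' -> same_eval g g' -> same_eval (Comp f g) (Comp f' g').
Proof.
move=> ff gg y u uk; rewrite !eval_Comp ff //; apply: eq_eval => v vj; exact: gg.
Qed.

Lemma same_eval_Tens i j k l (f f' : T i j) (g g' : T k l) :
  same_eval f f' -> same_eval g g' -> same_eval (Tens f g) (Tens f' g').
Proof.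
move=> ff gg y u uk; rewrite !eval_Tens ff; last by rewrite size_takel // uk leq_addr.
by apply: eq_eval => v vj; rewrite gg // size_drop uk addKn.
Qed.

Lemma same_eval_TensA i j i' j' i'' j'' (f : T i j) (g : T i' j') (h : T i'' j'') :
  same_eval (castt (addnA i i' i'') (addnA j j' j'') (Tens f (Tens g h))) (Tens (Tens f g) h).
Proof.
move=> y u us; rewrite eval_cast !eval_Tens take_takel ?leq_addr //.
apply: eq_eval => v vi; rewrite eval_Tens drop_drop take_drop ![(j' + j)%N]addnC.
by apply: eq_eval => w wi; apply: eq_eval => x xi; rewrite catA.
Qed.

Lemma same_eval_TensComp i j k i' j' k' (f : T j k) (g : T i j) (f' : T j' k') (g' : T i' j') :
  same_eval (Tens (Comp f g) (Comp f' g')) (Comp (Tens f f') (Tens g g')).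
Proof.
move=> y u us; rewrite eval_Comp !eval_Tens eval_Comp.
apply: eq_eval => v vj.
transitivity (eval g (fun w => eval f' (eval g' (fun w' => y (w ++ w'))) (drop k u)) v).
  by apply: eq_eval => w wi; rewrite eval_Comp.
rewrite eval_exch; apply: eq_eval => w wj.
by rewrite eval_Tens_cat.
Qed.

Lemma same_eval_slide i j (f : T i j) :
  same_eval (Comp (cross C m j) (Tens (Idn 1) f)) (Comp (Tens f (Idn 1)) (cross C m i)).
Proof.
move=> y u; case/lastP: u => [|u a] us; first by move: us => /=; lia.
have {}us : size u = j by move: us; rewrite size_rcons; lia.
rewrite !eval_Comp eval_cross // eval_lpad.
rewrite -cats1 eval_rpad //; apply: eq_eval => v vi.
by rewrite cats1 eval_cross.
Qed.

Lemma same_eval_bend n (f : T 0 n) : same_eval (star f) (Comp (caps C m n) (Tens f (Idn n))).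
Proof.
move=> y [|//] _; rewrite eval_Comp eval_caps; apply: eq_word_sum => v vn.
by rewrite (eval_rpad f y vn vn) kernel_star.
Qed.

(** A contraction makes two rows of the determinant equal. *)
Lemma same_eval_harmonic r k (e : (r + (2 + k))%N = m) :
  same_eval (Comp (Tens (Idn r) (Tens gA (Idn k))) (castt erefl (esym e) (gD : T 0 m)))
    (Zero C m 0 (r + (0 + k))).
Proof.
move=> y u us; rewrite eval_Zero eval_Comp -(cat_take_drop r u).
have ur : size (take r u) = r by rewrite size_takel // us leq_addr.
have uk : size (drop r u) = k by rewrite size_drop us addKn.
rewrite eval_Tens_cat // eval_Idn // eval_cap0 //; apply: big1 => a _.
rewrite eval_cast /eval /= (_ : \det _ = 0) ?mul0r //.
have lt1 : (r < m)%N by rewrite -e; lia.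
have lt2 : (r.+1 < m)%N by rewrite -e; lia.
apply: (@determinant_alternate _ _ _ (Ordinal lt1) (Ordinal lt2)) => [|j].
  by rewrite -val_eqE /= neq_ltn ltnSn.
by rewrite !mxE /= !nth_cat ur ltnn subnn ltnNge leqnSn /= subSnn.
Qed.

Lemma same_eval_alternating r k (e : (r + (2 + k))%N = m) :
  same_eval (Comp (simple C m e) (gD : T 0 m)) (Scale (-1) gD).
Proof.
move=> y u us; rewrite eval_Comp eval_Scale.
have [x ->] := word_codom us.
have lt1 : (r < m)%N by rewrite -e; lia.
have lt2 : (r.+1 < m)%N by rewrite -e; lia.
rewrite (@eval_simple _ _ _ _ (Ordinal lt1) (Ordinal lt2)) //.
rewrite /eval /= mulrA; congr (_ * _); rewrite !letter_mx_codom.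
set M := \matrix_(i, j) _.
have -> : M = row_perm (tperm (Ordinal lt1) (Ordinal lt2)) (\matrix_(i, j) (x i == j)%:R).
  by apply/matrixP=> i j; rewrite !mxE ffunE.
rewrite row_permE det_mulmx det_perm odd_tperm -val_eqE /= neq_ltn ltnSn /=.
by rewrite expr1.
Qed.

(** A product of two letter determinants is the determinant of a matrix of
    Kronecker deltas, and its Leibniz expansion is the antisymmetriser. *)
Lemma same_eval_antisym (w : 'S_m -> T m m) : (forall s, lift s (w s)) ->
  same_eval (Comp gD (star gD))
    (\big[@Add C m m m/Zero C m m m]_(s : 'S_m) Scale ((-1) ^+ odd_perm s) (w s)).
Proof.
move=> lw y u us.
have -> : eval (\big[@Add C m m m/Zero C m m m]_(s : 'S_m) Scale ((-1) ^+ odd_perm s) (w s)) y u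
   = \sum_s (-1) ^+ odd_perm s * eval (w s) y u.
  rewrite (big_morph (fun f => eval f y u) (fun f g => eval_Add f g y u) (eval_Zero _ _ y u)).
  by apply: eq_bigr => s _; rewrite eval_Scale.
have [x ->] := word_codom us.
under eq_bigr => s _ do rewrite (eval_lift (lw s)) -(word_sum_delta (n :=
  m) y) ?size_codom ?card_ord // -word_sum_mull.
rewrite -word_sum_sum; apply: eq_word_sum => v vm; have [z ->] := word_codom vm.
rewrite -[LHS]/(\det (letter_mx C (codom x)) * \det (letter_mx C (codom z)) * y (codom z)).
under eq_bigr => s _ do rewrite mulrA.
rewrite -mulr_suml; congr (_ * _); rewrite mulrC !letter_mx_codom -[X in _ * X]det_tr -det_mulmx.
apply: eq_bigr => s _; congr (_ * _).
transitivity (\prod_i (z i == x (s i))%:R : C).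
  apply: eq_bigr => i _; rewrite !mxE (bigD1 (z i)) //= !mxE eqxx mul1r big1 ?addr0; last first.
    by move=> j; rewrite !mxE eq_sym => /negbTE ->; rewrite mul0r.
  by rewrite eq_sym.
case: eqP => [e|ne].
  rewrite big1 // => i _; have := congr1 (fun u => nth (z i) u i) e.
  by rewrite !nth_codom ffunE => ->; rewrite eqxx.
have [i zi] : exists i, z i != x (s i).
  apply/existsP; apply: contra_notT ne => /existsPn h.
  have -> // : [ffun i => x (s i)] = z.
  by apply/ffunP=> i; rewrite ffunE; have := h i; rewrite negbK => /eqP.
by rewrite (bigD1 i) //= (negbTE zi) mul0r.
Qed.

Theorem soundness i j (f g : T i j) : eqv m%:R f g -> same_eval f g.
Proof.
elim=> {i j f g}; rewrite /same_eval.
- by [].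
- by move=> i j f g _ fg y u us; rewrite fg.
- by move=> i j f g h _ fg _ gh y u us; rewrite fg // gh.
- by move=> i j k f f' g g' _ + _; apply: same_eval_Comp.
- by move=> i j k l f f' g g' _ + _; apply: same_eval_Tens.
- by move=> i j f f' g g' _ ff _ gg y u us; rewrite !eval_Add ff // gg.
- by move=> i j a f f' _ ff y u us; rewrite !eval_Scale ff.
- by move=> i j f f' _; apply: same_eval_star.
- by move=> *; rewrite !eval_Add addrA.
- by move=> *; rewrite !eval_Add addrC.
- by move=> *; rewrite !eval_Add eval_Zero add0r.
- by move=> *; rewrite !eval_Add eval_Zero eval_Scale mulN1r addNr.
- by move=> *; rewrite !eval_Scale mulrA.
- by move=> *; rewrite !eval_Scale mul1r.
- by move=> *; rewrite !eval_Add !eval_Scale mulrDl.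
- by move=> *; rewrite eval_Add !eval_Scale eval_Add mulrDr.
- move=> i j k l f g h y u us; rewrite !eval_Comp; apply: eq_eval => v _; exact: eval_Comp.
- by move=> *; rewrite !eval_Comp eval_Idn.
- move=> i j f y u us; rewrite !eval_Comp; apply: eq_eval => v; exact: eval_Idn.
- by move=> *; rewrite eval_Add !eval_Comp eval_Add.
- move=> i j k f g h y u us; rewrite eval_Add !eval_Comp -evalD.
  by apply: eq_eval => v _; rewrite eval_Add.
- by move=> *; rewrite !(eval_Comp, eval_Scale).
- move=> i j k a f g y u us; rewrite eval_Scale !eval_Comp -evalZ.
  by apply: eq_eval => v _; rewrite eval_Scale.
- by move=> i j i' j' i'' j'' f g h; apply: same_eval_TensA.
- by move=> i j f y u us; rewrite -[u]/([::] ++ u) eval_Tens_cat // eval_Idn.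
- move=> i j f y u us; rewrite eval_cast eval_Tens take_oversize ?us // drop_oversize ?us //.
  by apply: eq_eval => v _; rewrite eval_Idn // cats0.
- move=> i j y u us; rewrite eval_Tens !eval_Idn ?cat_take_drop //.
    by rewrite size_drop us addKn.
  by rewrite size_takel // us leq_addr.
- by move=> i j k i' j' k' f g f' g'; apply: same_eval_TensComp.
- by move=> *; rewrite eval_Add !eval_Tens eval_Add.
- move=> i j k l f g h y u us; rewrite eval_Add !eval_Tens -evalD.
  by apply: eq_eval => v _; rewrite eval_Add.
- by move=> *; rewrite !(eval_Tens, eval_Scale).
- move=> i j k l a f g y u us; rewrite eval_Scale !eval_Tens -evalZ.
  by apply: eq_eval => v _; rewrite eval_Scale.
- by move=> i j f; apply: same_eval_slide.
- by move=> n f; apply: same_eval_bend.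
- move=> y [|a [|b []]] // _; rewrite eval_Comp !eval_X.
  by rewrite eval_lpad !eval_I.
- move=> y [|a [|b [|c []]]] // _; rewrite !eval_Comp.
  by rewrite !(eval_swap0, eval_lpad, eval_X).
- by move=> y [|//] _; rewrite !eval_Comp !eval_A; apply: eq_bigr => a _; rewrite eval_X.
- by move=> y [|a [|b []]] // _; rewrite !eval_Comp eval_X !eval_U eq_sym.
- move=> y [|//] _; rewrite !eval_Comp eval_Scale eval_A eval_Idn //.
  rewrite (eq_bigr (fun=> y [::])) => [|a _]; last by rewrite eval_U eqxx mul1r.
  by rewrite sumr_const card_ord mulr_natl.
- move=> y [|a []] // _; rewrite !eval_Comp eval_cap0 // eval_lpad eval_A.
  by apply: eq_bigr => b _; rewrite eval_lpad eval_X eval_swap0.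
- move=> y [|a [|b [|c []]]] // _; rewrite !eval_Comp eval_lpad eval_X eval_swap0 //.
  by rewrite eval_cup0 // eval_lpad eval_U eq_sym.
- move=> y [|a []] // _; rewrite eval_Comp eval_cap0 // eval_I (bigD1 a) //= eval_lpad eval_U eqxx
  mul1r.
  by rewrite big1 ?addr0 // => b /negbTE ba; rewrite eval_lpad eval_U ba mul0r.
- move=> y [|a []] // _; rewrite eval_Comp eval_lpad eval_A eval_I (bigD1 a) //= eval_cup0 // eqxx
  mul1r.
  by rewrite big1 ?addr0 // => b; rewrite eq_sym => /negbTE ba; rewrite eval_cup0 // ba mul0r.
- by move=> r k e; apply: same_eval_harmonic.
- by move=> r k e; apply: same_eval_alternating.
- by move=> w lw; apply: same_eval_antisym.
Qed.

End Soundness.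

(** * Tensor powers of matrices and their derivatives *)

Section TensorPowerEntries.
Variables (R : comNzRingType) (m : nat).
Local Notation word := (seq 'I_m).
Implicit Types g : 'M[R]_m.

(** The entries of the tensor power of g. *)
Fixpoint tcoef g (u v : word) : R :=
  match u, v with
  | [::], [::] => 1
  | a :: u', b :: v' => g a b * tcoef g u' v'
  | _, _ => 0
  end.

Lemma tcoef_cat g u v u' v' : size u = size v ->
  tcoef g (u ++ u') (v ++ v') = tcoef g u v * tcoef g u' v'.
Proof.
elim: u v => [|a u IH] [|b v] //=; first by rewrite mul1r.
by move=> [uv]; rewrite IH // mulrA.
Qed.

Lemma tcoef_tr g u v : tcoef g^T u v = tcoef g v u.
Proof. by elim: u v => [|a u IH] [|b v] //=; rewrite mxE IH. Qed.

Lemma tcoefZ c g u v n : size u = n -> tcoef (c *: g) u v = c ^+ n * tcoef g u v.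
Proof.
elim: u v n => [|a u IH] [|b v] [|n] //=; rewrite ?mulr1 ?mulr0 //.
by move=> [un]; rewrite (IH _ n) // mxE exprS mulrACA.
Qed.

Lemma tcoef1 u v n : size u = n -> size v = n -> tcoef 1%:M u v = (u == v)%:R.
Proof.
elim: u v n => [|a u IH] [|b v] [|n] //= [un] [vn]; rewrite (IH _ n) // mxE.
by rewrite eqseq_cons; case: eqP => _; rewrite ?mul1r ?mul0r.
Qed.

Lemma tcoefM g h u v n : size u = n ->
  tcoef (g *m h) u v = word_sum n (fun w => tcoef g u w * tcoef h w v).
Proof.
elim: u v n => [|a u IH] [|b v] [|n] //=; rewrite ?mulr1 ?mulr0 //.
  move=> [un]; rewrite big1 // => c _; rewrite -[RHS](word_sum0 m R n).
  by apply: eq_word_sum => w _; rewrite mulr0.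
move=> [un]; rewrite mxE mulr_suml; apply: eq_bigr => c _.
by rewrite (IH _ n) // -word_sum_mull; apply: eq_word_sum => w _; rewrite mulrACA.
Qed.

Lemma tcoef_codom n g (x z : {ffun 'I_n -> 'I_m}) :
  tcoef g (codom x) (codom z) = \prod_(i < n) g (x i) (z i).
Proof.
transitivity (\prod_(i <- enum 'I_n) g (x i) (z i)); last by rewrite big_enum.
rewrite !codomE.
by elim: (enum _) => [|i s IH] /=; rewrite ?big_nil // big_cons IH.
Qed.

End TensorPowerEntries.

Section InfinitesimalAction.
Variables (R : comNzRingType) (m : nat).
Local Notation word := (seq 'I_m).

(** The action of a Lie algebra element: N is applied to one tensor factor at
    a time, and the results are added. *)
Fixpoint so_act (N : 'M[R]_m) (y : word -> R) (t : word) : R :=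
  match t with
  | [::] => 0
  | a :: t' => \sum_b N a b * y (b :: t') + so_act N (fun w => y (a :: w)) t'
  end.

Lemma eq_so_act N y y' t : (forall u,
  size u = size t -> y u = y' u) -> so_act N y t = so_act N y' t.
Proof.
elim: t y y' => [|a t IH] y y' yy' //=; congr (_ + _).
  by apply: eq_bigr => b _; rewrite yy'.
by apply: IH => u ut; rewrite yy' //= ut.
Qed.

Lemma so_actZ c N y t : so_act (c *: N) y t = c * so_act N y t.
Proof.
elim: t y => [|a t IH] y /=; first by rewrite mulr0.
rewrite mulrDr IH; congr (_ + _); rewrite mulr_sumr.
by apply: eq_bigr => b _; rewrite mxE mulrA.
Qed.

(** The product rule: the tensor power of a path through the identity has as
    its derivative the infinitesimal action of the velocity. *)
Lemma tcoef_deriv (G : 'M[{poly R}]_m) n (y : word -> R) u : size u = n ->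
  (forall i j, (G i j).[0] = (i == j)%:R) ->
  let W := word_sum n (fun v => tcoef G u v * (y v)%:P) in
  W.[0] = y u /\ W^`().[0] = so_act (\matrix_(i, j) (G i j)^`().[0]) y u.
Proof.
move=> + G0; elim: u n y => [|a u IH] [|n] y //=.
  by rewrite mul1r derivC !hornerE.
move=> [un].
have e b : word_sum n (fun v => G a b * tcoef G u v * (y (b :: v))%:P) =
    G a b * word_sum n (fun v => tcoef G u v * (y (b :: v))%:P).
  by rewrite -word_sum_mull; apply: eq_word_sum => v _; rewrite mulrA.
under eq_bigr => b _ do rewrite e.
split.
  rewrite horner_sum (bigD1 a) //= big1 ?addr0; last first.
    by move=> b; rewrite hornerM G0 eq_sym => /negbTE ->; rewrite mul0r.
  by rewrite hornerM G0 eqxx mul1r (IH n (fun v => y (a :: v)) un).1.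
rewrite linear_sum /= horner_sum.
have dM (p q : {poly R}) : (p * q)^`().[0] = p^`().[0] * q.[0] + p.[0] * q^`().[0].
  by rewrite derivM hornerD !hornerM.
transitivity (\sum_b ((G a b)^`().[0] * y (b :: u) +
    (a == b)%:R * so_act (\matrix_(i, j) (G i j)^`().[0]) (fun v => y (b :: v)) u)).
  apply: eq_bigr => b _; apply: (etrans (dM _ _)).
  by rewrite G0 (IH n (fun v => y (b :: v)) un).1 (IH n (fun v => y (b :: v)) un).2.
rewrite big_split /=; congr (_ + _); first by apply: eq_bigr => b _; rewrite mxE.
rewrite (bigD1 a) //= eqxx mul1r big1 ?addr0 // => b.
by rewrite eq_sym => /negbTE ->; rewrite mul0r.
Qed.

Lemma horner_word_sum n (F : word -> {poly R}) r : (word_sum n F).[r] =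
  word_sum n (fun v => (F v).[r]).
Proof. by elim: n F => //= n IH F; rewrite horner_sum; apply: eq_bigr => a _; apply: IH. Qed.

Lemma horner_tcoef (G : 'M[{poly R}]_m) u v r :
  (tcoef G u v).[r] = tcoef (\matrix_(i, j) (G i j).[r]) u v.
Proof. by elim: u v => [|a u IH] [|b v] //=; rewrite ?hornerC // hornerM IH mxE. Qed.

End InfinitesimalAction.

(** * Invariants of the special orthogonal group *)

Section Invariants.
Variables (C : numFieldType) (m : nat).
Local Notation T := (term C m).
Local Notation word := (seq 'I_m).

Definition SO_std (g : 'M[C]_m) := g^T *m g = 1%:M /\ \det g = 1.

Lemma SO_std_tr g : SO_std g -> SO_std g^T.
Proof. by move=> [gg dg]; split; rewrite ?det_tr // trmxK; apply: mulmx1C. Qed.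

Definition SO_equivariant i j (k : word -> word -> C) := forall g, SO_std g ->
  forall u v, size u = j -> size v = i ->
  word_sum j (fun w => tcoef g u w * k w v) = word_sum i (fun w => k u w * tcoef g w v).

(** Multilinearity of the determinant in its rows. *)
Lemma det_tcoef (g : 'M[C]_m) u : size u = m ->
  word_sum m (fun w => tcoef g u w * \det (letter_mx C w)) = \det (letter_mx C u *m g).
Proof.
move=> um; have [x ->] := word_codom um; rewrite word_sum_ffun.
under eq_bigr => z _ do rewrite tcoef_codom letter_mx_codom big_distrr /=.
rewrite exchange_big /=; apply: eq_bigr => s _.
transitivity ((-1) ^+ s * \sum_(z : {ffun 'I_m -> 'I_m}) \prod_i (g (x i) (z i) * (z i == s i)%:R)).
  rewrite big_distrr /=; apply: eq_bigr => z _; rewrite mulrCA big_split /=; congr (_ * (_ * _)).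
  by apply: eq_bigr => i _; rewrite mxE.
rewrite -(bigA_distr_bigA (fun i b => g (x i) b * (b == s i)%:R)) /=; congr (_ * _).
apply: eq_bigr => i _; rewrite letter_mx_codom mxE.
rewrite (bigD1 (s i)) //= eqxx mulr1 big1 ?addr0; last by move=> b /negbTE ->; rewrite mulr0.
rewrite (bigD1 (x i)) //= mxE eqxx mul1r big1 ?addr0 // => b.
by rewrite mxE eq_sym => /negbTE ->; rewrite mul0r.
Qed.

Lemma det_SO_inv g u : SO_std g -> size u = m ->
  word_sum m (fun w => tcoef g u w * \det (letter_mx C w)) = \det (letter_mx C u).
Proof. by move=> [_ dg] um; rewrite det_tcoef // det_mulmx dg mulr1. Qed.

Lemma SO_std_col g a b : SO_std g -> \sum_c g c a * g c b = (a == b)%:R.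
Proof.
move=> [/matrixP/(_ a b) + _]; rewrite !mxE => <-.
by apply: eq_bigr => c _; rewrite mxE.
Qed.

Lemma SO_std_row g a b : SO_std g -> \sum_c g a c * g b c = (a == b)%:R.
Proof.
move=> /SO_std_tr/SO_std_col <-.
by apply: eq_bigr => c _; rewrite !mxE.
Qed.

Lemma word_sum_delta_r n v (G : word -> C) : size v = n ->
  word_sum n (fun u => G u * (u == v)%:R) = G v.
Proof.
move=> vn; rewrite -[RHS](word_sum_delta G vn); apply: eq_word_sum => u _.
by rewrite mulrC eq_sym.
Qed.

Lemma word_sum_delta_l n v (G : word -> C) : size v = n ->
  word_sum n (fun u => (v == u)%:R * G u) = G v.
Proof. exact: word_sum_delta. Qed.

(** On generators: the rows and the columns of g are orthonormal, which is the
    invariance of cups and caps, and g has determinant 1, which is that of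
    Delta_m. *)
Lemma term_equivariant i j (t : T i j) : SO_equivariant i j (kernel t).
Proof.
elim: t => [n||||||i' j' k f IHf g IHg|i' j' k l f IHf g IHg|i' j'|i' j' f IHf g IHg|i' j' c f IHf]
  h Sh u v us vs.
- by rewrite word_sum_delta_r // word_sum_delta_l.
- case: u us => [|a [|b []]] // _; case: v vs => // _ /=.
  rewrite mulr1 -(SO_std_row _ _ Sh); apply: eq_bigr => c _.
  rewrite (bigD1 c) //= eqxx !mulr1 big1 ?addr0 // => d.
  by rewrite eq_sym => /negbTE ->; rewrite mulr0.
- case: v vs => [|a [|b []]] // _; case: u us => // _ /=.
  rewrite mul1r -(SO_std_col _ _ Sh); apply: eq_bigr => c _.
  rewrite (bigD1 c) //= eqxx mul1r mulr1 big1 ?addr0 // => d.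
  by rewrite eq_sym => /negbTE ->; rewrite mul0r.
- rewrite (eq_word_sum (G' := fun w => tcoef h u w * (w == rev v)%:R)); last first.
    by move=> w _ /=; rewrite (can2_eq revK revK).
  rewrite word_sum_delta_r ?size_rev // word_sum_delta ?size_rev //.
  case: u us => [|a [|b []]] // _; case: v vs => [|c [|d []]] // _ /=.
  by rewrite !mulr1 mulrC.
- case: v vs => // _; rewrite [RHS]/= mulr1; exact: det_SO_inv.
- case: u us => // _; rewrite [LHS]/= mul1r -(det_SO_inv (SO_std_tr Sh) vs).
  by apply: eq_word_sum => w _; rewrite tcoef_tr mulrC.
- rewrite /=; under eq_word_sum => w _ do rewrite -word_sum_mull.
  under [RHS]eq_word_sum => w _ do rewrite -word_sum_mulr.
  rewrite word_sum_exch [RHS]word_sum_exch.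
  transitivity (word_sum j' (fun w => word_sum j' (fun w' => kernel f u w' * tcoef h w' w) * kernel
    g w v)).
    apply: eq_word_sum => w wj; rewrite -(IHf h Sh) // -word_sum_mulr.
    by apply: eq_word_sum => x _; rewrite mulrA.
  under eq_word_sum => w _ do rewrite -word_sum_mulr.
  rewrite [LHS]word_sum_exch; apply: eq_word_sum => w wj.
  transitivity (kernel f u w * word_sum j' (fun w' => tcoef h w w' * kernel g w' v)).
    by rewrite -word_sum_mull; apply: eq_word_sum => x _; rewrite mulrA.
  by rewrite (IHg h Sh) // -word_sum_mull; apply: eq_word_sum => x _; rewrite mulrA.
- have su1 : size (take j' u) = j' by rewrite size_takel // us leq_addr.
  have su2 : size (drop j' u) = l by rewrite size_drop us addKn.
  have sv1 : size (take i' v) = i' by rewrite size_takel // vs leq_addr.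
  have sv2 : size (drop i' v) = k by rewrite size_drop vs addKn.
  rewrite !word_sum_cat.
  transitivity (word_sum j' (fun w => tcoef h (take j' u) w * kernel f w (take i' v)) *
    word_sum l (fun w => tcoef h (drop j' u) w * kernel g w (drop i' v))).
    rewrite -word_sum_mulr; apply: eq_word_sum => w wj; rewrite -word_sum_mull;
      apply: eq_word_sum => x _ /=.
    rewrite -{1}(cat_take_drop j' u) tcoef_cat ?su1 // take_size_cat // drop_size_cat //.
    by rewrite mulrACA.
  rewrite IHf // IHg //.
  rewrite -word_sum_mulr; apply: eq_word_sum => w wj; rewrite -word_sum_mull;
    apply: eq_word_sum => x _ /=.
  rewrite -[in tcoef h (_ ++ _) v](cat_take_drop i' v) tcoef_cat ?sv1 // take_size_cat //
    drop_size_cat //.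
  by rewrite mulrACA.
- rewrite (eq_word_sum (G' := fun=> 0)) => [|w _]; last by rewrite mulr0.
  by rewrite word_sum0 (eq_word_sum (G' := fun=> 0)) ?word_sum0 // => w _; rewrite mul0r.
- rewrite /=; under eq_word_sum => w _ do rewrite mulrDr.
  under [RHS]eq_word_sum => w _ do rewrite mulrDl.
  by rewrite !word_sumD IHf // IHg.
- rewrite /=; under eq_word_sum => w _ do rewrite mulrCA.
  under [RHS]eq_word_sum => w _ do rewrite -mulrA.
  by rewrite !word_sum_mull IHf.
Qed.

Definition SO_inv n (y : word -> C) := forall g, SO_std g -> forall u, size u = n ->
  word_sum n (fun v => tcoef g u v * y v) = y u.

(** The infinitesimal rotation of the plane of the coordinates a and c. *)
Definition so_gen a c : 'M[C]_m := delta_mx a c - delta_mx c a.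

Lemma poly_nat0 (p : {poly C}) : (forall k : nat, p.[k%:R] = 0) -> p = 0.
Proof.
move=> p0; apply/eqP/negP => /negP pn0.
have := @max_poly_roots _ p [seq k%:R | k <- iota 0 (size p)] pn0.
rewrite size_map size_iota ltnn => h; suff: false by [].
apply: h; first by apply/allP => x /mapP[k _ ->]; apply/rootP.
by rewrite map_inj_uniq ?iota_uniq // => x y /eqP; rewrite eqr_nat => /eqP.
Qed.

Section Rotations.
Variables a c : 'I_m.
Hypothesis ac : a != c.
Local Notation N := (so_gen a c).

Lemma so_gen_tr : N^T = - N.
Proof. by rewrite /so_gen linearB /= !trmx_delta opprB. Qed.

Lemma so_gen2 : N *m N = - (delta_mx a a + delta_mx c c).
Proof.
have ca : (c == a) = false by rewrite eq_sym (negbTE ac).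
rewrite /so_gen mulmxBl !mulmxBr !mul_delta_mx_cond ca (negbTE ac) !eqxx !mulr1n !mulr0n.
by rewrite sub0r subr0 opprD.
Qed.

Lemma so_gen3 : N *m N *m N = - N.
Proof.
have ca : (c == a) = false by rewrite eq_sym (negbTE ac).
rewrite so_gen2 mulNmx; congr (- _).
rewrite /so_gen mulmxDl !mulmxBr !mul_delta_mx_cond ca (negbTE ac) !eqxx !mulr1n !mulr0n.
by rewrite subr0 sub0r.
Qed.

(** With al the sine of an angle and be one minus its cosine, h is the
    rotation by this angle in the plane of a and c; the hypothesis is the
    equation of the circle. Orthogonality is immediate, and the square of h
    has determinant 1 without a computation. *)
Lemma rotation_SO_std (al be : C) : be *+ 2 = al ^+ 2 + be ^+ 2 ->
  let h := 1%:M + al *: N + be *: (N *m N) in SO_std (h *m h).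
Proof.
move=> ab h.
pose M := N *m N.
have MT : M^T = M by rewrite /M trmx_mul so_gen_tr mulNmx mulmxN opprK.
have hT : h^T = 1%:M - al *: N + be *: M.
  have tr (A B : 'M[C]_m) : (1%:M + al *: A + be *: B)^T = 1%:M + al *: A^T + be *: B^T.
    by apply/matrixP=> i j; rewrite !mxE eq_sym.
  by rewrite /h tr -/M MT so_gen_tr scalerN.
have MN : M *m N = - N by exact: so_gen3.
have NM : N *m M = - N by rewrite /M mulmxA.
have MM : M *m M = - M by rewrite {1}/M -mulmxA NM mulmxN.
have hh : h^T *m h = 1%:M.
  rewrite hT /h -/M !(mulmxDl, mulmxDr, mulNmx, mul1mx, mulmx1) -!scalemxAl -!scalemxAr.
  rewrite MM MN NM -/M; apply/matrixP=> i j; rewrite !mxE.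
  have e : be * be = be *+ 2 - al ^+ 2 by rewrite ab addrAC subrr add0r expr2.
  move: (_%:R) (N i j) (M i j) => x y z.
  rewrite ?mulrN ?mulrA e; ring.
split; last first.
  have := congr1 determinant hh; by rewrite !det_mulmx det_tr det1.
by rewrite trmx_mul mulmxA -(mulmxA _ h^T h) hh mulmx1.
Qed.

(** Invariance under the rotations with rational parameter t, after
    multiplication by the denominators, is an identity between polynomials in
    t that holds for all natural numbers t, hence identically. Its derivative
    at t = 0 is the claim. *)
Lemma SO_inv_so_act_neq n y t : SO_inv n y -> size t = n -> so_act N y t = 0.
Proof.
move=> iy tn.
pose q : {poly C} := 1 + 'X^2.
(* At a point t, h is 1 + t^2 times the rotation with parameters al = 2t / (1
   + t^2) and be = 2t^2 / (1 + t^2). *)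
pose NP : 'M[{poly C}]_m := map_mx polyC N.
pose h : 'M[{poly C}]_m := q%:M + (2%:R *: 'X) *: NP + (2%:R *: 'X^2) *: (NP *m NP).
pose G := h *m h.
pose p := word_sum n (fun v => tcoef G t v * (y v)%:P) - (q ^+ 2) ^+ n * (y t)%:P.
have NPE : NP *m NP = map_mx polyC (N *m N) by rewrite /NP map_mxM.
have hij i j : h i j = q *+ (i == j) + 2%:R *: 'X * (N i j)%:P + 2%:R *: 'X^2 * ((N *m N) i j)%:P.
  have entryE (x z : {poly C}) (A B : 'M[C]_m) : (q%:M + x *: map_mx polyC A + z *: map_mx polyC B)
    i j =
      q *+ (i == j) + x * (A i j)%:P + z * (B i j)%:P by rewrite !mxE.
  by rewrite /h NPE entryE.
have hE r i j : (h i j).[r] = ((1 + r ^+ 2) *: 1%:M + (2%:R * r) *: N + (2%:R * r ^+ 2) *: (N *m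
  N)) i j.
  have entryE (b x z : C) (A B : 'M[C]_m) : (b *: 1%:M + x *: A + z *: B) i j =
      b * (i == j)%:R + x * (A i j) + z * (B i j) by rewrite !mxE.
  rewrite entryE hij /q; case: (i == j) => /=; rewrite ?mulr1n ?mulr0n !hornerE //.
have GE r i j : (G i j).[r] = \sum_l (h i l).[r] * (h l j).[r].
  by rewrite /G mxE horner_sum; apply: eq_bigr => l _; rewrite hornerM.
have p0 : p = 0.
  apply: poly_nat0 => k; set r : C := k%:R; have q0 : 1 + r ^+ 2 != 0.
    by rewrite /r -natrX -[1]/(1%:R) -natrD pnatr_eq0.
  pose al := 2%:R * r / (1 + r ^+ 2); pose be := 2%:R * r ^+ 2 / (1 + r ^+ 2).
  have ab : be *+ 2 = al ^+ 2 + be ^+ 2 by rewrite /al /be; field.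
  have := rotation_SO_std ab; set h' := (1%:M + al *: N + be *: (N *m N)) => /= Sh.
  have Gr : \matrix_(i, j) (G i j).[r] = (1 + r ^+ 2) ^+ 2 *: (h' *m h').
    have hr : \matrix_(i, j) (h i j).[r] = (1 + r ^+ 2) *: h'.
      apply/matrixP=> i j; rewrite mxE hE /h' !scalerDr !scalerA.
      by rewrite /al /be ![_ * (_ / _)]mulrC !divfK.
    rewrite expr2 -scalerA scalemxAr scalemxAl -hr.
    apply/matrixP=> i j; rewrite [LHS]mxE GE [RHS]mxE; apply: eq_bigr => l _.
    by congr (_ * _); rewrite [RHS]mxE.
  rewrite /p !hornerE horner_word_sum -[X in X - _]/(word_sum n (fun v => (tcoef G t v * (y
    v)%:P).[r])).
  rewrite (eq_word_sum (G' := fun v => ((1 + r ^+ 2) ^+ 2) ^+ n * (tcoef (h' *m h') t v * y v)));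
    last first.
    by move=> v _; rewrite hornerM hornerC horner_tcoef Gr (tcoefZ _ _ _ tn) mulrA.
  by rewrite word_sum_mull iy // subrr.
have h0 i j : (h i j).[0] = (i == j)%:R.
  by rewrite hE expr0n /= !(mulr0, addr0) !scale0r !addr0 scale1r mxE.
have G0 i j : (G i j).[0] = (i == j)%:R.
  rewrite GE (bigD1 i) //= !h0 eqxx mul1r big1 ?addr0 // => l.
  by rewrite h0 eq_sym => /negbTE ->; rewrite mul0r.
have q0 : q^`().[0] = 0 by rewrite /q derivD derivC derivXn !hornerE.
have h1 i j : (h i j)^`().[0] = 2%:R * N i j.
  rewrite hij !derivD derivMn !derivM !derivZ derivX derivXn !derivC !hornerE hornerMn q0 mul0rn /=.
  by rewrite !addr0 add0r.
(* The first derivative of h at 0 is 2 N, and G is the square of h. *)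
have G1 : \matrix_(i, j) (G i j)^`().[0] = 4%:R *: N.
  apply/matrixP=> i j; rewrite [LHS]mxE [RHS]mxE /G mxE linear_sum /= horner_sum.
  rewrite (eq_bigr (fun l => 2%:R * N i l * (l == j)%:R + (i == l)%:R * (2%:R * N l j)));
    last first.
    by move=> l _; rewrite derivM hornerD !hornerM !h0 !h1.
  rewrite big_split /= (bigD1 j) //= eqxx mulr1 big1 ?addr0; last first.
    by move=> l /negbTE ->; rewrite mulr0.
  rewrite (bigD1 i) //= eqxx mul1r big1 ?addr0; last first.
    by move=> l; rewrite eq_sym => /negbTE ->; rewrite mul0r.
  by rewrite -mulrDl -natrD.
have [_] := tcoef_deriv y tn G0.
rewrite G1 so_actZ.
have -> : word_sum n (fun v : word => tcoef G t v * (y v)%:P) = (q ^+ 2) ^+ n * (y t)%:P.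
  by apply/eqP; rewrite -subr_eq0; apply/eqP.
have -> : ((q ^+ 2) ^+ n * (y t)%:P)^`().[0] = 0.
  have e2 : (q ^+ 2)^`().[0] = 0 by rewrite deriv_exp hornerMn hornerM q0 mul0r mul0rn.
  have e3 : ((q ^+ 2) ^+ n)^`().[0] = 0 by rewrite deriv_exp hornerMn hornerM e2 mul0r mul0rn.
  by rewrite derivM derivC mulr0 addr0 hornerM e3 mul0r.
by move=> /esym/eqP; rewrite mulf_eq0 pnatr_eq0 => /eqP.
Qed.

End Rotations.

Lemma SO_inv_so_act n y t a c : SO_inv n y -> size t = n -> so_act (so_gen a c) y t = 0.
Proof.
move=> iy tn; have [->|ac] := eqVneq a c; last exact: SO_inv_so_act_neq iy tn.
by rewrite /so_gen subrr -(scale0r (0 : 'M_m)) so_actZ mul0r.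
Qed.

End Invariants.

(** * Faithfulness of evaluation *)

Section HomSemantics.
Variables (C : numFieldType) (m : nat).
Local Notation H := (Hom C m).
Local Notation T := (term C m).
Local Notation word := (seq 'I_m).
Local Notation id_ := (hid C m).
Local Notation "f ∘ g" := (hcomp f g) (at level 40, left associativity).
Local Notation "f ⊗ g" := (htens f g) (at level 35, right associativity).
Local Notation S0 := (swap0 C m).
Local Notation U0 := (cup0 C m).
Local Notation A0 := (cap0 C m).
Local Notation D := (hD C m).

Definition heval i j (x : H i j) (y : word -> C) (u : word) : C := eval (rep x) y u.

Lemma heval_cls i j (t : T i j) y u : size u = j -> heval (cls t) y u = eval t y u.
Proof. by apply: soundness; apply: rep_cls. Qed.

Lemma eq_heval i j (x : H i j) y y' u :
  (forall v, size v = i -> y v = y' v) -> heval x y u = heval x y' u.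
Proof. exact: eq_eval. Qed.

Lemma heval_comp i j k (f : H j k) (g : H i j) y u : size u = k ->
  heval (f ∘ g) y u = heval f (heval g y) u.
Proof.
move=> uk; elim/hom_ind: f => f; elim/hom_ind: g => g; rewrite -cls_comp !heval_cls // eval_Comp.
by apply: eq_eval => v vj; rewrite heval_cls.
Qed.

Lemma heval_add i j (f g : H i j) y u : size u = j -> heval (f + g) y u = heval f y u + heval g y u.
Proof.
by move=> uj; elim/hom_ind: f => f; elim/hom_ind: g => g; rewrite -clsD !heval_cls // eval_Add.
Qed.

Lemma heval_scale i j a (f : H i j) y u : size u = j -> heval (a *: f) y u = a * heval f y u.
Proof. by move=> uj; elim/hom_ind: f => f; rewrite -clsZ !heval_cls // eval_Scale. Qed.

Lemma heval_opp i j (f : H i j) y u : size u = j -> heval (- f) y u = - heval f y u.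
Proof. by move=> uj; rewrite -scaleN1r heval_scale // mulN1r. Qed.

Lemma heval_0 i j y u : size u = j -> heval (0 : H i j) y u = 0.
Proof. by move=> uj; rewrite -(scale0r 0) heval_scale // mul0r. Qed.

Lemma heval_id i y u : size u = i -> heval (id_ i) y u = y u.
Proof. by move=> ui; rewrite heval_cls // eval_Idn. Qed.

Lemma heval_lpad i j (f : H i j) y a u : size u = j ->
  heval (lpad f) y (a :: u) = heval f (fun v => y (a :: v)) u.
Proof.
move=> uj; elim/hom_ind: f => f; rewrite /lpad -[id_ 1]/(cls (Idn 1)) -(cls_tens (Idn 1) f).
by rewrite [RHS]heval_cls // -eval_lpad -heval_cls //= uj.
Qed.

Lemma heval_swap0 n y a b u : size u = n -> heval (S0 n) y [:: a, b & u] = y [:: b, a & u].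
Proof.
move=> un; rewrite -[S0 n]/(cls gX ⊗ cls (Idn n)) -(cls_tens gX (Idn n)).
by rewrite heval_cls ?eval_swap0 //= un.
Qed.

Lemma heval_cup0 n y a b u : size u = n ->
  heval (U0 n) y [:: a, b & u] = (a == b)%:R * y u.
Proof.
move=> un; rewrite -[U0 n]/(cls gU ⊗ cls (Idn n)) -(cls_tens gU (Idn n)).
by rewrite heval_cls ?eval_cup0 //= un.
Qed.

Lemma heval_cap0 n y u : size u = n -> heval (A0 n) y u = \sum_a y [:: a, a & u].
Proof.
move=> un; rewrite -[A0 n]/(cls gA ⊗ cls (Idn n)) -(cls_tens gA (Idn n)).
by rewrite heval_cls ?eval_cap0 //= un.
Qed.

Lemma heval_vol y u : size u = m -> heval D y u = \det (letter_mx C u) * y [::].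
Proof. by move=> um; rewrite heval_cls. Qed.

Lemma heval_cast i j i' j' (ei : i = i') (ej : j = j') (f : H i j) y u :
  heval (hcast ei ej f) y u = heval f y u.
Proof. by case: _ / ei; case: _ / ej. Qed.

Lemma hevalD i j (f : H i j) y y' u : heval f (fun v => y v + y' v) u = heval f y u + heval f y' u.
Proof. exact: evalD. Qed.

Lemma hevalZ i j (f : H i j) a y u : heval f (fun v => a * y v) u = a * heval f y u.
Proof. exact: evalZ. Qed.

Lemma heval_star i j (f : H i j) u v : size u = i -> size v = j ->
  kernel (rep (hstar f)) u v = kernel (rep f) v u.
Proof.
move=> ui vj; rewrite -[RHS]kernel_star -(eval_delta _ _ vj) -(eval_delta _ _ vj).
by rewrite -[f in hstar f]repK -cls_star -/(heval _ _ _) heval_cls.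
Qed.

(** Reflection of diagrams is transposition. *)
Lemma heval_adjoint i j (f : H i j) (y y' : word -> C) :
  word_sum j (fun u => heval f y u * y' u) = word_sum i (fun v => y v * heval (hstar f) y' v).
Proof.
transitivity (word_sum j (fun u => word_sum i (fun v => y v * (kernel (rep f) u v * y' u)))).
  apply: eq_word_sum => u _; rewrite -word_sum_mulr; apply: eq_word_sum => v _.
  by rewrite mulrCA mulrA.
rewrite word_sum_exch; apply: eq_word_sum => v vi; rewrite -word_sum_mull;
  apply: eq_word_sum => u uj.
by rewrite heval_star.
Qed.

Lemma delta_sum (F : 'I_m -> C) b : \sum_q (b == q)%:R * F q = F b.
Proof.
rewrite (bigD1 b) //= eqxx mul1r big1 ?addr0 // => q.
by rewrite eq_sym => /negbTE ->; rewrite mul0r.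
Qed.

Lemma so_gen_sum a c b (F : 'I_m -> C) :
  \sum_q so_gen C a c b q * F q = (b == a)%:R * F c - (b == c)%:R * F a.
Proof.
under eq_bigr => q _ do rewrite !mxE -!mulnb !natrM mulrBl -!mulrA.
rewrite sumrB -!mulr_sumr; congr (_ * _ - _ * _).
  by rewrite -[RHS]delta_sum; apply: eq_bigr => q _; rewrite eq_sym.
by rewrite -[RHS]delta_sum; apply: eq_bigr => q _; rewrite eq_sym.
Qed.

(** In coordinates [omega] pairs the infinitesimal rotations acting on the
    first factor with the same ones acting on the others. *)
Lemma heval_omega n y c t : size t = n ->
  heval (omega C m n) y (c :: t) = \sum_a so_act (so_gen C a c) (fun w => y (a :: w)) t.
Proof.
elim: n y c t => [|n IH] y c [|b t] //.
  by move=> _; rewrite /= heval_0 // big1.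
move=> [tn]; rewrite [omega _ _ _]/= !(heval_add, heval_opp, heval_comp) /= ?tn //.
rewrite heval_swap0 // heval_cup0 // heval_cap0 // heval_swap0 // heval_lpad /= ?tn // IH //.
rewrite big_split /=; congr (_ + _); last first.
  by apply: eq_bigr => a _; apply: eq_so_act => w wt; rewrite heval_swap0 // wt.
under [RHS]eq_bigr => a _ do rewrite so_gen_sum.
rewrite sumrB delta_sum -mulr_sumr eq_sym; by [].
Qed.

(** Invariance under the rotations of the planes of a and c, applied to all
    factors. The contributions of the first factor, summed over a, give the
    scalar m - 1. *)
Lemma SO_inv_casimir n y u : SO_inv n.+1 y -> size u = n.+1 ->
  (m%:R - 1) * y u + heval (omega C m n) y u = 0.
Proof.
case: u => // c t iy [tn]; rewrite heval_omega //.
have e a : so_act (so_gen C a c) (fun w => y (a :: w)) t =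
  - (y (c :: t) - (a == c)%:R * y (a :: t)).
  have /= := SO_inv_so_act (t := a :: t) a c iy (congr1 S tn).
  rewrite (so_gen_sum _ _ _ (fun b => y (b :: t))) eqxx mul1r => /eqP.
  by rewrite addrC addr_eq0 => /eqP.
under eq_bigr => a _ do rewrite e.
rewrite sumrN sumrB sumr_const card_ord.
rewrite (eq_bigr (fun a => (c == a)%:R * y (a :: t))) => [|a _]; last by rewrite eq_sym.
by rewrite (delta_sum (fun a => y (a :: t))) mulrBl mul1r mulr_natl subrr.
Qed.

Lemma letter_det_SO_inv : SO_inv m (fun u : word => \det (letter_mx C u)).
Proof. by move=> g gSO u um; apply: det_SO_inv. Qed.

Lemma SO_inv_scale n c (y : word -> C) : SO_inv n y -> SO_inv n (fun u => c * y u).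
Proof.
move=> iy g gSO u un; rewrite -(iy g gSO u un) -word_sum_mull; apply: eq_word_sum => v _.
by rewrite mulrCA.
Qed.

Lemma heval_omega_vol y u : size u = m.+1 -> heval (omega C m m ∘ lpad D) y u = 0.
Proof.
case: u => // c t [tm]; rewrite heval_comp /= ?tm // heval_omega //.
apply: big1 => a _.
rewrite -[RHS](SO_inv_so_act a c (SO_inv_scale (y [:: a]) letter_det_SO_inv) tm).
by apply: eq_so_act => w wt; rewrite heval_lpad ?heval_vol ?wt // mulrC.
Qed.

(** The cup is detected by a word with two equal letters, where the
    determinant is 0, and Delta_2 by the word of the two different letters. *)
Lemma heval_inj02 (x : H 0 2) : (2 <= m)%N ->
  (forall y u, size u = 2 -> heval x y u = 0) -> x = 0.
Proof.
move=> m2 x0; have [c [d xE]] := hom02 x m2.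
have lt0 : (0 < m)%N by lia.
pose a := Ordinal lt0.
have D2E y u : size u = 2 -> heval (vol2 C m) y u =
  (if m == 2 then \det (letter_mx C u) else 0) * y [::].
  move=> u2; rewrite /vol2; case: eqP => [e|ne]; last by rewrite heval_0 // mul0r.
  by rewrite heval_cast heval_vol // u2 e.
have xE2 y u : size u = 2 -> heval x y u = c * heval (U0 0) y u + d * heval (vol2 C m) y u.
  by move=> u2; rewrite xE heval_add // !heval_scale.
have c0 : c = 0.
  have := x0 (fun=> 1) [:: a; a] erefl; rewrite xE2 // heval_cup0 // eqxx D2E //.
  have -> : (if m == 2 then \det (letter_mx C [:: a; a]) else 0) = 0.
    case: eqP => // em; have lt1 : (1 < m)%N by lia.
    apply: (@determinant_alternate _ _ _ a (Ordinal lt1)) => // j.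
    by rewrite !mxE.
  by rewrite mul0r mulr0 addr0 !mulr1.
have [em|ne] := eqVneq m 2; last first.
  by rewrite xE c0 scale0r add0r /vol2; case: eqP => [/eqP/(negP ne) //|_]; rewrite scaler0.
have sw : size (codom [ffun i : 'I_m => i]) = 2 by rewrite size_codom card_ord.
have := x0 (fun=> 1) _ sw; rewrite xE2 // c0 mul0r add0r D2E // (introT eqP em).
have -> : \det (letter_mx C (codom [ffun i : 'I_m => i])) = 1.
  rewrite letter_mx_codom (_ : \matrix_(i, j) _ = 1%:M) ?det1 //; apply/matrixP=> i j.
  by rewrite !mxE ffunE.
by rewrite !mulr1 xE c0 => ->; rewrite !scale0r addr0.
Qed.

(** A cap straightens the bent strand. *)
Lemma bend_injective i j (f : H i.+1 j) : lpad f ∘ U0 i = 0 -> f = 0.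
Proof.
move=> f0; have : A0 j ∘ lpad (lpad f ∘ U0 i) = 0 by rewrite f0 lpad0 hcomp0r.
by rewrite lpad_comp hcompA cap0_nat -hcompA zigzagl hcomp1r.
Qed.

(** The pairing with Delta_m^* is an endomorphism of one strand. It evaluates
    to 0, since the determinant is invariant, and it can be bent into Hom 0 2,
    where evaluation is already known to be injective. *)
Lemma omega_vol : (2 <= m)%N -> omega C m m ∘ lpad D = 0.
Proof.
move=> m2; apply: omega_vol_of_pairing; apply: bend_injective; apply: heval_inj02 => // y u u2.
rewrite heval_comp //; case: u u2 => [|a [|b []]] // _.
rewrite heval_lpad // heval_comp //.
rewrite -[RHS](word_sum0 m C m.+1); apply: eq_word_sum => v vm.
by rewrite heval_omega_vol // mulr0.
Qed.

(** [vanishing] for the kernel of evaluation. *)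
Theorem heval_faithful0 n (x : H 0 n) : (2 <= m)%N ->
  (forall y u, size u = n -> heval x y u = 0) -> x = 0.
Proof.
move=> m2.
pose K n (x : H 0 n) := forall y u, size u = n -> heval x y u = 0.
apply: (@vanishing C m (fun n => H 0 n) (fun i j (f : H i j) => hcomp f) _ _ _ _ K) => //.
- by move=> i j k f g x'; rewrite /= hcompA.
- by move=> i x'; rewrite /= hcomp1l.
- by move=> i j f g x'; rewrite /= hcompDl.
- by move=> i j a f x'; rewrite /= hcompZl.
- by move=> k x1 x2 K1 K2 y u uk; rewrite heval_add // heval_opp // K1 // K2 // subrr.
- move=> i j f x1 K1 y u uj; rewrite /= heval_comp // -[RHS](word_sum0 m C i).
  by apply: eq_word_sum => v vi; rewrite K1 // mulr0.
- move=> x1 K1; have [c xc] := hom00 x1 m2; have := K1 (fun=> 1) [::] erefl.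
  by rewrite xc heval_scale // heval_id // mulr1 => ->; rewrite scale0r.
- by move=> k x1 _; apply: casimir_identity; apply: omega_vol.
- exact: ltnW.
Qed.

Theorem heval_faithful i j (f : H i j) : (2 <= m)%N ->
  (forall y u, size u = j -> heval f y u = 0) -> f = 0.
Proof.
move=> m2; elim: i j f => [|i IH] j f f0; first exact: heval_faithful0.
apply: bend_injective; apply: IH => y [|a u] // [uj].
rewrite heval_comp /= ?uj // heval_lpad // f0 //.
Qed.

End HomSemantics.

(** * Nondegenerate subspaces *)

Section NondegenerateSubspaces.
Variables (C : fieldType) (V : vectType C).

(** A subspace of maximal dimension among those contained in S contains every
    element of S. *)
Lemma subspace_vspace (S : V -> Prop) : S 0 ->
  (forall a x y, S x -> S y -> S (a *: x + y)) ->
  exists U : {vspace V}, forall v, v \in U <-> S v.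
Proof.
move=> S0 SL.
pose Q k := `[< exists U : {vspace V}, \dim U = k /\ forall v, v \in U -> S v >].
have Q0 : exists k, Q k.
  exists 0; apply/asboolP; exists 0%VS; split; first exact: dimv0.
  by move=> v; rewrite memv0 => /eqP ->.
have Qb k : Q k -> (k <= \dim {:V})%N.
  by move=> /asboolP[U [<- _]]; apply: dimvS; apply: subvf.
case: (ex_maxnP Q0 Qb) => k /asboolP[U [dU US]] kmax.
exists U => v; split; first exact: US.
move=> Sv; apply: contraT => vU.
have : Q (\dim (U + <[v]>)).
  apply/asboolP; exists (U + <[v]>)%VS; split=> // w /memv_addP[u uU [w' /vlineP[a ->] ->]].
  by rewrite addrC; apply: SL => //; apply: US.
move/kmax; rewrite -dU leqNgt => /negP[].
rewrite ltn_neqAle dimvS ?addvSl // andbT.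
rewrite eqn_leq dimvS ?addvSl //= -ltnNge ltnNge.
have : ~~ (U + <[v]> <= U)%VS by rewrite subv_add subvv memvE in vU *.
by apply: contra => dd; rewrite -(eqP (_ : U == (U + <[v]>)%VS)) // eqEdim addvSl.
Qed.

(** Pairing with a basis of S is injective on the span of S and x0, so this
    span is not larger than S. *)
Lemma nondegenerate_subspace (B : V -> V -> C) (S : V -> Prop) (x0 : V) :
  (forall a x y z, B (a *: x + y) z = a * B x z + B y z) ->
  (forall a x y z, B z (a *: x + y) = a * B z x + B z y) ->
  S 0 -> (forall a x y, S x -> S y -> S (a *: x + y)) ->
  (forall a s, S s -> (forall z, S z -> B (s + a *: x0) z = 0) -> s + a *: x0 = 0) ->
  S x0.
Proof.
move=> Bl Br S0 SL nd; have [U US] := subspace_vspace S0 SL.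
apply/US; apply: contraT => xU.
pose b := vbasis U.
pose phi (v : V) : 'rV[C]_(\dim U) := \row_i B v b`_i.
have phi_lin : linear phi.
  by move=> a x y; apply/rowP=> i; rewrite !mxE Bl.
pose L : {linear V -> 'rV[C]_(\dim U)} := HB.pack phi (GRing.isLinear.Build _ _ _ _ phi phi_lin).
pose W := (U + <[x0]>)%VS.
have B0 z : B z 0 = 0.
  by have := Br 1 0 0 z; rewrite scale1r addr0 mul1r => e; apply: (@addrI _ (B z 0));
    rewrite addr0 -e.
have ker0 : (W :&: lker (linfun L))%VS = 0%VS.
  apply/eqP; rewrite -subv0; apply/subvP => w; rewrite memv_cap memv0 memv_ker lfunE /=.
  case/andP=> /memv_addP[s sU [w' /vlineP[a ->] ->]] /eqP/rowP L0.
  apply/eqP/nd; first exact/US.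
  move=> z /US zU; rewrite (coord_vbasis zU).
  elim/big_ind: _ => [|z1 z2 e1 e2|i _]; first exact: B0.
    by rewrite -[z1]scale1r Br e1 e2 mulr0 addr0.
  by have := L0 i; rewrite !mxE => e; rewrite -[X in B _ X]addr0 Br e B0 mulr0 addr0.
have := limg_dim_eq ker0; have := dimvS (subvf (linfun L @: W)%VS).
rewrite dimvf /dim /= mul1n => le1 e1.
have : (\dim W <= \dim U)%N by rewrite -e1.
have : ~~ (W <= U)%VS by rewrite /W subv_add subvv -memvE.
move=> nWU le2; case/negP: nWU.
suff -> : W = U by [].
by apply/esym/eqP; rewrite eqEdim addvSl.
Qed.

End NondegenerateSubspaces.

(** * Fullness of evaluation *)

Section Fullness.
Variables (C : numFieldType) (m : nat).
Hypothesis m2 : (2 <= m)%N.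
Local Notation H := (Hom C m).
Local Notation word := (seq 'I_m).
Local Notation tp := (tpow C m).
Implicit Types y : word -> C.
Local Notation id_ := (hid C m).
Local Notation "f ∘ g" := (hcomp f g) (at level 40, left associativity).

Definition coef n (x : tp n) (u : word) : C :=
  \sum_(t : {ffun 'I_n -> 'I_m}) (codom t == u)%:R * x t.
Definition tensor_of n (y : word -> C) : tp n := [ffun t : {ffun 'I_n -> 'I_m} => y (codom t)].

Lemma codom_inj n : injective (fun t : {ffun 'I_n -> 'I_m} => codom t).
Proof.
move=> s t st; apply/ffunP=> i.
by have := congr1 (fun u => nth (s i) u i) st; rewrite /= !nth_codom.
Qed.

Lemma coef_codom n (x : tp n) (t : {ffun 'I_n -> 'I_m}) : coef x (codom t) = x t.
Proof.
rewrite /coef (bigD1 t) //= eqxx mul1r big1 ?addr0 // => s.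
by rewrite (inj_eq (@codom_inj n)) => /negbTE ->; rewrite mul0r.
Qed.

Lemma coef_tensor_of n y u : size u = n -> coef (tensor_of n y) u = y u.
Proof. by move=> un; have [t ->] := word_codom un; rewrite coef_codom ffunE. Qed.

Lemma coefL n a (x y : tp n) u : coef (a *: x + y) u = a * coef x u + coef y u.
Proof.
rewrite /coef mulr_sumr -big_split; apply: eq_bigr => t _ /=.
by rewrite !ffunE mulrDr mulrCA.
Qed.

Lemma coef_ext n (x y : tp n) : (forall u, size u = n -> coef x u = coef y u) -> x = y.
Proof.
by move=> e; apply/ffunP=> t; rewrite -!coef_codom e // size_codom card_ord.
Qed.

Lemma tensor_of_ext n y y' : (forall u, size u = n -> y u = y' u) -> tensor_of n y = tensor_of n y'.
Proof. by move=> e; apply/ffunP=> t; rewrite !ffunE e // size_codom card_ord. Qed.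

Lemma coef0 n u : coef (0 : tp n) u = 0.
Proof. by rewrite /coef big1 // => t _; rewrite ffunE mulr0. Qed.

Definition hact i j (f : H i j) (x : tp i) : tp j := tensor_of j (heval f (coef x)).

Lemma hact_linear i j (f : H i j) : linear (hact f).
Proof.
move=> a x y; apply/ffunP=> t; rewrite !ffunE.
rewrite -[RHS]/(a * heval f (coef x) (codom t) + heval f (coef y) (codom t)) -hevalZ -hevalD.
by apply: eq_heval => v _; rewrite coefL.
Qed.
HB.instance Definition _ i j (f : H i j) :=
  GRing.isLinear.Build C (tp i) (tp j) _ (hact f) (hact_linear f).

Lemma SO_inv_heval i j (f : H i j) y : SO_inv i y -> SO_inv j (heval f y).
Proof.
move=> iy g gSO u uj.
transitivity (word_sum i (fun w => word_sum j (fun v => tcoef g u v * kernel (rep f) v w) * y w)).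
  under eq_word_sum => v _ do rewrite -word_sum_mull.
  rewrite word_sum_exch; apply: eq_word_sum => w _; rewrite -word_sum_mulr;
    apply: eq_word_sum => v _.
  by rewrite mulrA.
transitivity (word_sum i (fun w => word_sum i (fun v => kernel (rep f) u v * tcoef g v w) * y w)).
  by apply: eq_word_sum => w wi; rewrite term_equivariant.
under eq_word_sum => v _ do rewrite -word_sum_mulr.
rewrite word_sum_exch; apply: eq_word_sum => w wi; rewrite -(iy g gSO w wi) -word_sum_mull.
by apply: eq_word_sum => v _; rewrite mulrA.
Qed.

Lemma eq_SO_inv n y y' : (forall u, size u = n -> y u = y' u) -> SO_inv n y -> SO_inv n y'.
Proof.
move=> e iy g gSO u un; rewrite -(e u un) -(iy g gSO u un).
by apply: eq_word_sum => v vn; rewrite e.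
Qed.

Lemma SO_invL n a y y' : SO_inv n y -> SO_inv n y' -> SO_inv n (fun u => a * y u + y' u).
Proof.
move=> iy iy' g gSO u un; rewrite -(iy g gSO u un) -(iy' g gSO u un) -word_sum_mull -word_sumD.
by apply: eq_word_sum => v _; rewrite mulrDr mulrCA.
Qed.

(** [vanishing] for the invariant tensors orthogonal to all diagrams.
    Stability under diagrams holds because reflection is adjunction. *)
Lemma SO_inv_orthogonal n (x : tp n) : SO_inv n (coef x) ->
  (forall g : H 0 n, word_sum n (fun u => coef x u * heval g (fun=> 1) u) = 0) -> x = 0.
Proof.
move=> ix px.
pose K n (x : tp n) := SO_inv n (coef x) /\
  forall g : H 0 n, word_sum n (fun u => coef x u * heval g (fun=> 1) u) = 0.
have : K n x by [].
apply: (@vanishing C m tp (fun i j (f : H i j) => hact f) _ _ _ _ K) => {n x ix px}.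
- move=> i j k f g x; apply: tensor_of_ext => u uk; rewrite heval_comp //.
  by apply: eq_heval => v vj; rewrite coef_tensor_of.
- by move=> i x; apply: coef_ext => u ui; rewrite /= coef_tensor_of // heval_id.
- move=> i j f g x; apply/ffunP=> t; rewrite !ffunE heval_add //.
  by rewrite size_codom card_ord.
- move=> i j a f x; apply/ffunP=> t; rewrite !ffunE heval_scale //.
  by rewrite size_codom card_ord.
- move=> k x y [ix px] [iy py]; have e u : coef (x - y) u = -1 * coef y u + coef x u.
    by rewrite addrC -scaleN1r coefL.
  split.
    by apply: (@eq_SO_inv _ (fun u => -1 * coef y u + coef x u)); [move=> u _;
      rewrite e|apply: SO_invL].
  move=> g; under eq_word_sum => u _ do rewrite e mulrDl -mulrA.
  by rewrite word_sumD word_sum_mull px py mulr0 addr0.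
- move=> i j f x [ix px]; split.
    apply: (eq_SO_inv _ (SO_inv_heval f ix)) => u uj; by rewrite coef_tensor_of.
  move=> g; rewrite -(px (hstar f ∘ g)).
  transitivity (word_sum j (fun u => heval f (coef x) u * heval g (fun=> 1) u)).
    by apply: eq_word_sum => u uj; rewrite coef_tensor_of.
  by rewrite heval_adjoint; apply: eq_word_sum => v vi; rewrite heval_comp.
- move=> x [_ /(_ (id_ 0))]; rewrite /= heval_id // mulr1 => x0.
  by apply: coef_ext => [[|//]] _; rewrite x0 coef0.
- move=> k x [ix _]; apply: coef_ext => u uk; rewrite coefL /= coef_tensor_of // coef0.
  exact: SO_inv_casimir.
- exact: ltnW.
Qed.

(** An invariant tensor y and the diagrams span a space of invariants in which
    nothing but 0 is orthogonal to the diagrams; so y does not enlarge their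
    span. *)
Theorem SO_inv_is_diagram n y : SO_inv n y ->
  exists g : H 0 n, forall u, size u = n -> y u = heval g (fun=> 1) u.
Proof.
move=> iy.
pose S (x : tp n) := exists g : H 0 n, forall u, size u = n -> coef x u = heval g (fun=> 1) u.
pose B (x z : tp n) := word_sum n (fun u => coef x u * coef z u).
have SL a x z : S x -> S z -> S (a *: x + z).
  move=> [g xg] [h zh]; exists (a *: g + h) => u un.
  by rewrite coefL heval_add // heval_scale // xg // zh.
have Sinv x : S x -> SO_inv n (coef x).
  move=> [g xg]; apply: (@eq_SO_inv _ (heval g (fun=> 1))); first by move=> u un; rewrite xg.
  apply: SO_inv_heval => h _ [|//] _; by rewrite /= mulr1.
have : S (tensor_of n y).
  apply: (nondegenerate_subspace (B := B)) => //.
  - move=> a x x' z; rewrite /B -word_sum_mull -word_sumD; apply: eq_word_sum => u _.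
    by rewrite coefL mulrDl mulrA.
  - move=> a x x' z; rewrite /B -word_sum_mull -word_sumD; apply: eq_word_sum => u _.
    by rewrite coefL mulrDr mulrCA.
  - by exists 0 => u un; rewrite heval_0 // coef0.
  move=> a s Ss Bs; apply: SO_inv_orthogonal.
    apply: (@eq_SO_inv _ (fun u => a * coef (tensor_of n y) u + coef s u)).
      by move=> u _; rewrite [s + _]addrC coefL.
    apply: SO_invL; last exact: Sinv.
    by apply: (eq_SO_inv _ iy) => u un; rewrite coef_tensor_of.
  move=> g; rewrite -[RHS](Bs (tensor_of n (heval g (fun=> 1)))); last first.
    by exists g => u un; rewrite coef_tensor_of.
  by apply: eq_word_sum => u un; rewrite coef_tensor_of.
by move=> [g yg]; exists g => u un; rewrite -yg // coef_tensor_of.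
Qed.

(** Invariance of a linear map, stated for its coefficients as a tensor in
    both arguments; the dual representation is the original one since g is
    orthogonal. *)
Definition SO_inv2 i j (k : word -> word -> C) := forall g, SO_std g -> forall u v,
  size u = j -> size v = i ->
  word_sum j (fun w => word_sum i (fun w' => tcoef g u w * tcoef g v w' * k w w')) = k u v.

(** The inputs are turned into outputs one at a time, and a cap turns them
    back. *)
Theorem equivariant_is_diagram i j (k : word -> word -> C) : SO_inv2 i j k ->
  exists f : H i j, forall u v, size u = j -> size v = i -> kernel (rep f) u v = k u v.
Proof.
elim: i j k => [|i IH] j k ik.
  have iy : SO_inv j (fun u => k u [::]).
    move=> g gSO u uj; rewrite -[RHS](ik g gSO u [::] uj erefl); apply: eq_word_sum => w _ /=.
    by rewrite mulr1.
  have [g gE] := SO_inv_is_diagram iy; exists g => u [|//] uj _.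
  by rewrite gE // /heval /eval /= mulr1.
(* The first letter of the input becomes the first letter of the output. *)
pose k' (u v : word) := if u is c :: u' then k u' (c :: v) else 0.
have ik' : SO_inv2 i j.+1 k'.
  move=> g gSO [|c u] // v [uj] vi; rewrite -[RHS](ik g gSO u (c :: v) uj (congr1 S vi)).
  rewrite /= -word_sum_sum; apply: eq_word_sum => w wj; apply: eq_bigr => d _.
  by apply: eq_word_sum => w' _; rewrite !mulrA [g c d * _]mulrC.
have [f' fk'] := IH _ _ ik'.
exists (cap0 C m j ∘ lpad f') => u v uj; case: v => // c v [vi].
rewrite -(eval_delta _ _ (congr1 S vi : size (c :: v) = i.+1)).
rewrite -/(heval _ _ _) heval_comp // heval_cap0 //.
under eq_bigr => a _ do rewrite heval_lpad /= ?uj //.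
rewrite (bigD1 c) //= big1 ?addr0 => [|a ac]; last first.
  rewrite /heval /eval (eq_word_sum (G' := fun=> 0)) ?word_sum0 // => w _.
  by rewrite eqseq_cons eq_sym (negbTE ac) mulr0.
transitivity (heval f' (fun w => (v == w)%:R) (c :: u)).
  by apply: eq_heval => w _; rewrite eqseq_cons eqxx.
by rewrite /heval eval_delta // fk' //= uj.
Qed.

End Fullness.

(** * The action of matrices on tensor powers *)

Section MatrixAction.
Variables (C : numFieldType) (m : nat).
Local Notation word := (seq 'I_m).
Local Notation tp := (tpow C m).
Implicit Types y : word -> C.

Lemma coef_tact n g (x : tp n) u : size u = n ->
  coef (tact g x) u = word_sum n (fun v => tcoef g u v * coef x v).
Proof.
move=> un; have [t ->] := word_codom un; rewrite coef_codom ffunE word_sum_ffun.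
by apply: eq_bigr => s _; rewrite tcoef_codom coef_codom.
Qed.

Lemma tactM n g h (x : tp n) : tact (g *m h) x = tact g (tact h x).
Proof.
apply: coef_ext => u un; rewrite !coef_tact //.
transitivity (word_sum n (fun v => word_sum n (fun w => tcoef g u w * tcoef h w v * coef x v))).
  by apply: eq_word_sum => v vn; rewrite (tcoefM _ _ _ un) word_sum_mulr.
rewrite word_sum_exch; apply: eq_word_sum => w wn; rewrite coef_tact // -word_sum_mull.
by apply: eq_word_sum => v _; rewrite mulrA.
Qed.

Lemma tact1 n (x : tp n) : tact 1%:M x = x.
Proof.
apply: coef_ext => u un; rewrite coef_tact //.
rewrite -[RHS](word_sum_delta (coef x) un); apply: eq_word_sum => v vn.
by rewrite (tcoef1 _ un vn).
Qed.

Lemma tact_linear n g : linear (@tact C m n g).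
Proof.
move=> a x y; apply: coef_ext => u un; rewrite coef_tact // coefL !coef_tact //.
rewrite -word_sum_mull -word_sumD; apply: eq_word_sum => v _.
by rewrite coefL mulrDr mulrCA.
Qed.
HB.instance Definition _ n g := GRing.isLinear.Build C (tp n) (tp n) _ (@tact C m n g)
  (@tact_linear n g).

Lemma codom_split r s (t : {ffun 'I_(r + s) -> 'I_m}) :
  codom t = codom [ffun a => t (lshift s a)] ++ codom [ffun a => t (rshift r a)].
Proof.
have sz n (z : {ffun 'I_n -> 'I_m}) : size (codom z) = n by rewrite size_codom card_ord.
have sz2 : size (codom [ffun a => t (lshift s a)] ++ codom [ffun a => t (rshift r a)]) = (r + s)%N.
  by rewrite size_cat !sz.
case E: (codom t) => [|p l].
  by apply/esym/nilP; rewrite /nilp sz2 -(sz _ t) E.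
rewrite -E; apply: (@eq_from_nth _ p); first by rewrite sz sz2.
move=> i; rewrite sz => lt; move: (Ordinal lt) (erefl : nat_of_ord (Ordinal lt) = i) => o <-.
rewrite nth_codom nth_cat sz; case: (split_ordP o) => j ->.
  by rewrite /= nth_codom ffunE.
by rewrite /= addKn nth_codom ffunE.
Qed.

Lemma coef_tens r s (x : tp r) (y : tp s) u v : size u = r -> size v = s ->
  coef (tens x y) (u ++ v) = coef x u * coef y v.
Proof.
move=> ur vs; have [t e] : exists t : {ffun 'I_(r + s) -> 'I_m}, u ++ v = codom t.
  by apply: word_codom; rewrite size_cat ur vs.
rewrite e coef_codom ffunE; move: e; rewrite codom_split => /eqP.
rewrite eqseq_cat ?size_codom ?card_ord // => /andP[/eqP -> /eqP ->].
by rewrite !coef_codom.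
Qed.

Lemma tact_tens r s g (x : tp r) (y : tp s) : tact g (tens x y) = tens (tact g x) (tact g y).
Proof.
apply: coef_ext => u un; rewrite coef_tact // -(cat_take_drop r u).
have u1 : size (take r u) = r by rewrite size_takel // un leq_addr.
have u2 : size (drop r u) = s by rewrite size_drop un addKn.
rewrite coef_tens // !coef_tact // word_sum_cat -word_sum_mulr; apply: eq_word_sum => v vr.
rewrite -word_sum_mull; apply: eq_word_sum => w ws.
by rewrite tcoef_cat ?u1 // coef_tens // mulrACA.
Qed.

Lemma coef_pure2 (v w : 'cV[C]_m) a b : coef (pure2 v w) [:: a; b] = v a 0 * w b 0.
Proof.
have [t e] := @word_codom m 2 [:: a; b] erefl; rewrite e coef_codom ffunE.
have : codom t = [:: t ord0; t (fintype.lift ord0 ord0)].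
  have e0 : enum 'I_0 = [::] by apply/nilP; rewrite /nilp size_enum_ord.
  by rewrite codomE !enum_ordSl e0.
rewrite -e => -[-> ->].
by rewrite !big_ord_recl big_ord0 mulr1 !(tnth_nth v).
Qed.

Lemma coefZ n a (x : tp n) u : coef (a *: x) u = a * coef x u.
Proof. by rewrite -[a *: x]addr0 coefL coef0 addr0. Qed.

Lemma coefD n (x y : tp n) u : coef (x + y) u = coef x u + coef y u.
Proof. by rewrite -{1}[x]scale1r coefL mul1r. Qed.

Lemma coef_sum n I (r : seq I) (Q : pred I) (F : I -> tp n) u :
  coef (\sum_(i <- r | Q i) F i) u = \sum_(i <- r | Q i) coef (F i) u.
Proof. by apply: (big_morph (fun x => coef x u)) => [x y|]; rewrite ?coefD ?coef0. Qed.

Lemma coef_unit : coef (unit_tensor C m) [::] = 1.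
Proof.
by have [t e] := @word_codom m 0 [::] erefl; rewrite e coef_codom ffunE.
Qed.

Lemma tact_pure2 g (v w : 'cV[C]_m) : tact g (pure2 v w) = pure2 (g *m v) (g *m w).
Proof.
apply: coef_ext => [[|a [|b []]]] // _; rewrite coef_tact // coef_pure2 !mxE mulr_suml.
apply: eq_bigr => c _; rewrite mulr_sumr; apply: eq_bigr => d _.
by rewrite /= mulr1 coef_pure2 mulrACA.
Qed.

Definition basis n (t : word) : tp n := tensor_of n (fun u => (t == u)%:R).

Lemma basis_expansion n (x : tp n) : x = \sum_(t : {ffun 'I_n -> 'I_m}) x t *: basis n (codom t).
Proof.
apply: coef_ext => u un; rewrite coef_sum; apply: eq_bigr => t _.
by rewrite coefZ coef_tensor_of // mulrC.
Qed.

Lemma basis_tens r s u v : size u = r -> size v = s ->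
  basis (r + s) (u ++ v) = tens (basis r u) (basis s v).
Proof.
move=> ur vs; apply: coef_ext => w wn; rewrite coef_tensor_of // -(cat_take_drop r w).
have w1 : size (take r w) = r by rewrite size_takel // wn leq_addr.
have w2 : size (drop r w) = s by rewrite size_drop wn addKn.
rewrite coef_tens // !coef_tensor_of // eqseq_cat ?ur ?w1 //.
by rewrite -mulnb natrM.
Qed.

Lemma basis_pure2 a b : basis 2 [:: a; b] = pure2 (delta_mx a 0) (delta_mx b 0).
Proof.
apply: coef_ext => [[|c [|d []]]] // _;
  rewrite coef_tensor_of // coef_pure2 !mxE !eqseq_cons !eqxx !andbT.
by rewrite -mulnb natrM [c == a]eq_sym [d == b]eq_sym.
Qed.

Lemma basis0 : basis 0 [::] = unit_tensor C m.
Proof. by apply: coef_ext => [[|//]] _; rewrite coef_tensor_of // coef_unit. Qed.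

Lemma eq_on_basis n k (f g : {linear tp n -> tp k}) :
  (forall u, size u = n -> f (basis n u) = g (basis n u)) -> f =1 g.
Proof.
move=> fg x; rewrite (basis_expansion x) !linear_sum; apply: eq_bigr => t _.
by rewrite !linearZ /= fg // size_codom card_ord.
Qed.

End MatrixAction.

(** * The functor and its inverse *)

Section Main.
Variables (C : numFieldType) (m : nat).
Hypothesis m2 : (2 <= m)%N.
Local Notation T := (term C m).
Local Notation tp := (tpow C m).
Variables (form : {symmetric 'cV[C]_m}) (e : 'I_m -> 'cV[C]_m).
Hypothesis e_orth : forall i j, form (e i) (e j) = (i == j)%:R.

Definition gram : 'M[C]_m := \matrix_(i, j) form (delta_mx i 0) (delta_mx j 0).
Definition frame : 'M[C]_m := \matrix_(i, j) e j i 0.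

Lemma formE v w : form v w = (v^T *m gram *m w) 0 0.
Proof.
have ex (u : 'cV[C]_m) : u = \sum_i u i 0 *: delta_mx i 0.
  by rewrite {1}[u]matrix_sum_delta; apply: eq_bigr => i _; rewrite big_ord1.
rewrite {1}(ex w) linear_sumr mxE; apply: eq_bigr => j _ /=.
rewrite linearZr_LR /= mulrC; congr (_ * _).
rewrite {1}(ex v) linear_sumlz mxE; apply: eq_bigr => i _ /=.
by rewrite linearZl_LR /= !mxE.
Qed.

Local Notation E := frame.
Local Notation Ei := (invmx frame).

Lemma mx_entryE (M : 'M[C]_m) i j :
  ((delta_mx i 0 : 'cV_m)^T *m M *m (delta_mx j 0 : 'cV_m)) 0 0 = M i j.
Proof. by rewrite trmx_delta -rowE -colE !mxE. Qed.

Lemma frame_gram : E^T *m gram *m E = 1%:M.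
Proof.
apply/matrixP=> i j; rewrite [RHS]mxE -e_orth formE.
have ce k : e k = E *m delta_mx k 0.
  by apply/colP => l; rewrite -colE !mxE.
by rewrite !ce trmx_mul -(mx_entryE _ i j) !mulmxA.
Qed.

Lemma frame_unit : E \in unitmx.
Proof. by case/mulmx1_unit: frame_gram. Qed.

Lemma frameK : Ei *m E = 1%:M. Proof. exact: mulVmx frame_unit. Qed.

Lemma frameVK : E *m Ei = 1%:M. Proof. exact: mulmxV frame_unit. Qed.

Lemma gramE : gram = Ei^T *m Ei.
Proof.
rewrite -[LHS]mulmx1 -frameVK -[gram in LHS]mul1mx -[X in X *m gram](trmx1 C m) -frameVK trmx_mul.
by rewrite -!mulmxA (mulmxA _ gram) (mulmxA _ _ Ei) frame_gram mul1mx.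
Qed.

Lemma form_frame v w : form (E *m v) (E *m w) = \sum_i v i 0 * w i 0.
Proof.
rewrite formE trmx_mul !mulmxA -(mulmxA _ E^T) -(mulmxA _ (E^T *m gram)) frame_gram mulmx1.
by rewrite mxE; apply: eq_bigr => i _; rewrite mxE.
Qed.

Lemma SO_gram g : SO form g -> g^T *m gram *m g = gram.
Proof.
move=> [fg _]; apply/matrixP=> i j; rewrite [RHS]mxE -fg formE.
by rewrite -(mx_entryE _ i j) trmx_mul !mulmxA.
Qed.

Lemma SO_conj g : SO form g -> SO_std (Ei *m g *m E).
Proof.
move=> gSO; have gg := SO_gram gSO; case: gSO => _ dg; split; last first.
  by rewrite !det_mulmx dg mulr1 -det_mulmx frameK det1.
rewrite !trmx_mul -!mulmxA (mulmxA Ei^T) -gramE (mulmxA g^T) (mulmxA (g^T *m gram)) gg.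
by rewrite mulmxA frame_gram.
Qed.

Lemma SO_std_conj h : SO_std h -> SO form (E *m h *m Ei).
Proof.
move=> [hh dh]; split; last first.
  by rewrite !det_mulmx dh mulr1 -det_mulmx frameVK det1.
move=> v w; rewrite -!mulmxA form_frame formE gramE.
transitivity (((h *m (Ei *m v))^T *m (h *m (Ei *m w))) 0 0).
  by rewrite [RHS]mxE; apply: eq_bigr => i _; congr (_ * _); rewrite [RHS]mxE.
rewrite !trmx_mul -!mulmxA (mulmxA h^T) hh mul1mx; by rewrite !mulmxA.
Qed.

(** Evaluation in the coordinates with respect to e, where the form is the
    standard one. *)
Definition frame_eval r s (f : T r s) (x : tp r) : tp s :=
  tact E (tensor_of s (eval f (coef (tact Ei x)))).

Lemma frame_eval_linear r s (f : T r s) : linear (frame_eval f).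
Proof.
move=> a x y; rewrite /frame_eval -linearP; congr (tact _ _); apply/ffunP=> t.
rewrite !ffunE -[RHS]/(a * eval f (coef (tact Ei x)) (codom t) + eval f (coef (tact Ei y)) (codom
  t)).
by rewrite -evalZ -evalD; apply: eq_eval => v _; rewrite linearP coefL.
Qed.
HB.instance Definition _ r s (f : T r s) :=
  GRing.isLinear.Build C (tp r) (tp s) _ (frame_eval f) (frame_eval_linear f).

Lemma tactK r (x : tp r) : tact Ei (tact E x) = x.
Proof. by rewrite -tactM frameK tact1. Qed.

Lemma tactVK r (x : tp r) : tact E (tact Ei x) = x.
Proof. by rewrite -tactM frameVK tact1. Qed.

Lemma eval_tact r s (f : T r s) h (x : tp r) u : SO_std h -> size u = s ->
  eval f (coef (tact h x)) u = word_sum s (fun v => tcoef h u v * eval f (coef x) v).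
Proof.
move=> Sh us; transitivity (word_sum r (fun v => word_sum s (fun w => tcoef h u w * kernel f w v) *
  coef x v)).
  transitivity (word_sum r (fun v => word_sum r (fun w => kernel f u v * (tcoef h v w * coef x
    w)))).
    by apply: eq_word_sum => v vr; rewrite coef_tact // word_sum_mull.
  rewrite word_sum_exch; apply: eq_word_sum => w wr;
    rewrite (term_equivariant f Sh) // -word_sum_mulr.
  by apply: eq_word_sum => v _; rewrite mulrA.
under eq_word_sum => v _ do rewrite -word_sum_mulr.
rewrite word_sum_exch; apply: eq_word_sum => w _; rewrite -word_sum_mull; apply: eq_word_sum => v _.
by rewrite mulrA.
Qed.

Lemma frame_eval_SO r s (f : T r s) g : SO form g -> forall x,
  frame_eval f (tact g x) = tact g (frame_eval f x).
Proof.
move=> gSO x; have Sh := SO_conj gSO; rewrite /frame_eval.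
have -> : tact Ei (tact g x) = tact (Ei *m g *m E) (tact Ei x).
  by rewrite !tactM tactVK.
rewrite -[RHS]tactM; have -> : g *m E = E *m (Ei *m g *m E) by rewrite !mulmxA frameVK mul1mx.
rewrite [RHS]tactM; apply: (congr1 (tact E)); apply: coef_ext => u us.
rewrite coef_tensor_of // eval_tact // coef_tact //; apply: eq_word_sum => v vs;
  by rewrite coef_tensor_of.
Qed.

Definition Fhom r s (f : T r s) : SOhom form r s :=
  SOHom (sohom := [the {linear tp r -> tp s} of frame_eval f]) (@frame_eval_SO r s f).

Local Notation Br := (enhanced_brauer m (m%:R : C)).
Local Notation Tc := (tensor_category form).

Lemma Fhom_heq r s (f g : T r s) : eqv m%:R f g -> frame_eval f =1 frame_eval g.
Proof.
move=> fg x; rewrite /frame_eval; apply: (congr1 (tact E)); apply: tensor_of_ext => u us.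
exact: soundness.
Qed.

Lemma Fhom_functor : @is_functor Br Tc (fun r : nat => r) Fhom.
Proof.
split=> [r s f f' ff|r|r s t f g].
- exact: Fhom_heq.
- move=> x; rewrite /= /frame_eval -[RHS]tactVK; apply: (congr1 (tact E)).
  by apply: coef_ext => u us; rewrite coef_tensor_of // eval_Idn.
- move=> x; rewrite /= /frame_eval tactK; apply: (congr1 (tact E)); apply: tensor_of_ext => u us.
  by rewrite eval_Comp; apply: eq_eval => v vs; rewrite coef_tensor_of.
Qed.

Lemma Fhom_linear_tensor : is_linear_tensor_functor Fhom.
Proof.
split=> [r s f g x|r s a f x|r s r' s' f g x y]; rewrite /= /frame_eval.
- rewrite -linearD; apply: (congr1 (tact E)); apply: coef_ext => u us.
  by rewrite coefD !coef_tensor_of // eval_Add.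
- rewrite -linearZ; apply: (congr1 (tact E)); apply: coef_ext => u us.
  by rewrite coefZ !coef_tensor_of // eval_Scale.
- rewrite -tact_tens; apply: (congr1 (tact E)); apply: coef_ext => u us.
  have u1 : size (take s u) = s by rewrite size_takel // us leq_addr.
  have u2 : size (drop s u) = s' by rewrite size_drop us addKn.
  rewrite coef_tensor_of // -[in RHS](cat_take_drop s u) coef_tens // !coef_tensor_of // eval_Tens.
  transitivity (eval f (fun v => eval g (coef (tact Ei y)) (drop s u) * coef (tact Ei x) v) (take s
    u)).
    apply: eq_eval => v vr; rewrite mulrC -evalZ; apply: eq_eval => w ws.
    by rewrite tact_tens coef_tens.
  by rewrite evalZ mulrC.
Qed.

Lemma Fhom_values : has_generator_values e Fhom.
Proof.
split; rewrite /= /frame_eval.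
- move=> v; rewrite -[RHS]tactVK; apply: (congr1 (tact E)).
  by apply: coef_ext => u us; rewrite coef_tensor_of // eval_Idn.
- move=> v w; rewrite tact_pure2 -[RHS]tactVK tact_pure2; apply: (congr1 (tact E)).
  apply: coef_ext => [[|a [|b []]]] // _.
  by rewrite coef_tensor_of // eval_X !coef_pure2 mulrC.
- move=> v w; apply: coef_ext => [[|//]] _;
  rewrite tact_pure2 coef_tact //= mul1r coef_tensor_of //.
  rewrite eval_A coefZ coef_unit mulr1 -[v in RHS]mul1mx -[w in RHS]mul1mx -frameVK -!mulmxA
    form_frame.
  by apply: eq_bigr => a _; rewrite coef_pure2.
- apply: coef_ext => [[|a [|b []]]] // _; rewrite coef_tact // coef_sum /=.
  apply: eq_bigr => c _; rewrite (bigD1 c) //= coef_tensor_of // eval_U eqxx big1 ?addr0;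
    last first.
    by move=> d; rewrite coef_tensor_of // eval_U eq_sym => /negbTE ->; rewrite mul0r mulr0.
  by rewrite coef_tact //= coef_unit !mulr1 coef_pure2 !mxE.
- apply/ffunP=> t; rewrite -coef_codom; have st : size (codom t) = m by rewrite size_codom card_ord.
  rewrite coef_tact //.
  transitivity (word_sum m (fun v => tcoef E (codom t) v * \det (letter_mx C v))).
    apply: eq_word_sum => v vm; rewrite coef_tensor_of // /eval /= coef_tact //= coef_unit.
    by rewrite !mulr1.
  rewrite det_tcoef // /Lambda /antisymmetrise ffunE ffunE.
  rewrite -[RHS]/(m`!%:R * ((m`!%:R)^-1 * _)) mulrA divff ?mul1r; last first.
    by rewrite pnatr_eq0 -lt0n fact_gt0.
  rewrite -det_tr sum_ffunE; apply: eq_bigr => s _; rewrite !ffunE.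
  rewrite -[RHS]/((-1) ^+ s * _); congr (_ * _); apply: eq_bigr => i _.
  rewrite !mxE ffunE (bigD1 (t (s i))) //= big1 ?addr0; last first.
    by move=> j; rewrite letter_mx_codom mxE eq_sym => /negbTE ->; rewrite mul0r.
  by rewrite letter_mx_codom !mxE eqxx mul1r.
Qed.

Section Uniqueness.
Variables F1 F2 : forall r s : nat, T r s -> SOhom form r s.
Hypotheses (fun1 : @is_functor Br Tc (fun r : nat => r) F1)
           (fun2 : @is_functor Br Tc (fun r : nat => r) F2).
Hypotheses (lt1 : is_linear_tensor_functor F1) (lt2 : is_linear_tensor_functor F2).
Hypotheses (gv1 : has_generator_values e F1) (gv2 : has_generator_values e F2).
Definition agree r s (f : T r s) := F1 f =1 F2 f.

Lemma agree_basis r s (f : T r s) :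
  (forall u, size u = r -> F1 f (basis C r u) = F2 f (basis C r u)) -> agree f.
Proof. exact: eq_on_basis. Qed.

Lemma agree_Idn n : agree (Idn n).
Proof.
by move=> x; rewrite (fm_id fun1 n x) (fm_id fun2 n x).
Qed.

Lemma agree_Comp r s t (f : T s t) (g : T r s) : agree f -> agree g -> agree (Comp f g).
Proof.
move=> Af Ag x; rewrite (fm_comp fun1 f g x) (fm_comp fun2 f g x) /=.
by rewrite Ag Af.
Qed.

Lemma agree_Tens r s r' s' (f : T r s) (g : T r' s') : agree f -> agree g -> agree (Tens f g).
Proof.
move=> Af Ag; apply: agree_basis => u us.
rewrite -(cat_take_drop r u) basis_tens; last 2 first.
- by rewrite size_takel // us leq_addr.
- by rewrite size_drop us addKn.
by rewrite (lt_tens lt1) (lt_tens lt2) Af Ag.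
Qed.

Lemma agree_cast i j i' j' (ei : i = i') (ej : j = j') (f : T i j) :
  agree f -> agree (castt ei ej f).
Proof. by case: _ / ei; case: _ / ej. Qed.

Lemma agree_U : agree gU.
Proof. by apply: agree_basis => [[|//]] _; rewrite basis0 (gv_U gv1) (gv_U gv2). Qed.

Lemma agree_D : agree gD.
Proof. by apply: agree_basis => [[|//]] _; rewrite basis0 (gv_D gv1) (gv_D gv2). Qed.

Lemma agree_A : agree gA.
Proof.
apply: agree_basis => [[|a [|b []]]] // _.
by rewrite basis_pure2 (gv_A gv1) (gv_A gv2).
Qed.

Lemma agree_X : agree gX.
Proof.
apply: agree_basis => [[|a [|b []]]] // _.
by rewrite basis_pure2 (gv_X gv1) (gv_X gv2).
Qed.

Lemma agree_cross n : agree (cross C m n).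
Proof.
elim: n => [|n IH]; first exact: agree_Idn.
exact (agree_Comp (agree_Tens (@agree_Idn 1) IH) (agree_Tens agree_X (@agree_Idn n))).
Qed.

Lemma agree_caps n : agree (caps C m n).
Proof.
elim: n => [|n IH]; first exact: agree_Idn.
have A1 := agree_Tens (@agree_Idn n) (agree_Tens agree_A (@agree_Idn n)).
have A2 := agree_cast erefl (esym (addnA n 1 n.+1)) (agree_Tens (@agree_cross n) (@agree_Idn n.+1)).
exact (agree_Comp IH (agree_Comp A1 A2)).
Qed.

(** The bending relation expresses the reflection of Delta_m by Delta_m and
    caps, so that its value is forced. *)
Lemma agree_Ds : agree gDs.
Proof.
have b := eqv_bend (m%:R : C) (gD : T 0 m).
move=> x; rewrite (fm_heq fun1 b x) (fm_heq fun2 b x).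
exact: (agree_Comp (@agree_caps m) (agree_Tens agree_D (@agree_Idn m))).
Qed.

Lemma F_Zero (F : forall r s : nat, T r s -> SOhom form r s) r s x :
  @is_functor Br Tc (fun r : nat => r) F -> is_linear_tensor_functor F -> F r s (Zero C m r s) x =
    0.
Proof.
move=> fF lF; rewrite -(fm_heq fF (eqv_AddN (m%:R : C) (Zero C m r s)) x).
by rewrite (lt_add lF) (lt_scale lF) scaleN1r addNr.
Qed.

Lemma agree_all r s (f : T r s) : agree f.
Proof.
elim: f => [n||||||? ? ? f IHf g IHg|? ? ? ? f IHf g IHg|i' j'|i' j' f IHf g IHg|i' j' c f IHf].
- exact: agree_Idn.
- exact: agree_U.
- exact: agree_A.
- exact: agree_X.
- exact: agree_D.
- exact: agree_Ds.
- exact: agree_Comp.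
- exact: agree_Tens.
- by move=> x; rewrite !F_Zero.
- by move=> x; rewrite (lt_add lt1) (lt_add lt2) IHf IHg.
- by move=> x; rewrite (lt_scale lt1) (lt_scale lt2) IHf.
Qed.

End Uniqueness.

Lemma Fhom_faithful r s (f g : T r s) : frame_eval f =1 frame_eval g -> eqv m%:R f g.
Proof.
move=> fg; apply/clsP/eqP; rewrite -subr_eq0; apply/eqP; apply: heval_faithful => // y u us.
rewrite -scaleN1r heval_add // heval_scale // !heval_cls // mulN1r.
have /(congr1 (fun x => coef (tact Ei x) u)) := fg (tact E (tensor_of r y)).
rewrite /frame_eval !tactK !coef_tensor_of // => fgu.
rewrite (eq_eval f (y' := coef (tensor_of r y))) => [|v vr]; last by rewrite coef_tensor_of.
rewrite fgu (eq_eval g (y' := y)) ?subrr // => v vr; by rewrite coef_tensor_of.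
Qed.

(** In the coordinates with respect to e, equivariance of phi is invariance of
    its coefficients in both arguments, because the inverse of an orthogonal
    matrix is its transpose. *)
Lemma Fhom_full r s (phi : SOhom form r s) : exists f : T r s, frame_eval f =1 phi.
Proof.
pose phi0 x := tact Ei (phi (tact E x)).
have phi0Z a x : phi0 (a *: x) = a *: phi0 x by rewrite /phi0 !linearZ.
have phi0h h x : SO_std h -> phi0 (tact h x) = tact h (phi0 x).
  move=> Sh; have gSO := SO_std_conj Sh; rewrite /phi0.
  have -> : tact E (tact h x) = tact (E *m h *m Ei) (tact E x).
    by rewrite -!tactM -(mulmxA _ Ei E) frameK mulmx1.
  by rewrite sohomP // -!tactM !mulmxA frameK mul1mx.
have phi0_exp x u : coef (phi0 x) u = word_sum r (fun w => coef x w * coef (phi0 (basis C r w)) u).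
  rewrite {1}(basis_expansion x) word_sum_ffun /phi0 !linear_sum coef_sum; apply: eq_bigr => t _.
  by rewrite !linearZ coefZ coef_codom.
pose k u v := coef (phi0 (basis C r v)) u.
have ik : SO_inv2 r s k.
  move=> h Sh u v us vr.
  transitivity (word_sum s (fun w => tcoef h u w * coef (phi0 (tact h^T (basis C r v))) w)).
    apply: eq_word_sum => w ws; rewrite phi0_exp -word_sum_mull; apply: eq_word_sum => w' wr.
    rewrite -mulrA; congr (_ * (_ * _)); rewrite coef_tact //.
    rewrite -tcoef_tr -(word_sum_delta (tcoef h^T w') vr); apply: eq_word_sum => x xr.
    by rewrite coef_tensor_of // mulrC.
  rewrite -coef_tact // -phi0h // -tactM; case: Sh => hh _.
  by rewrite (mulmx1C hh) tact1.
have [f fk] := equivariant_is_diagram m2 ik; exists (rep f) => x.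
rewrite /frame_eval -[RHS]tactVK; apply: (congr1 (tact E)); apply: coef_ext => u us.
rewrite coef_tensor_of // -[in RHS](tactVK x) -/(phi0 _) phi0_exp; apply: eq_word_sum => v vr.
by rewrite fk // mulrC.
Qed.

(** The functor is bijective on morphisms up to the relations and the identity
    on objects, so a choice of preimages is an inverse. *)
Lemma Fhom_equivalence : is_equivalence (Functor Fhom_functor).
Proof.
pose Gm (r s : nat) (phi : SOhom form r s) : T r s := sval (cid (Fhom_full phi)).
have GmE r s (phi : SOhom form r s) : frame_eval (Gm r s phi) =1 phi.
  exact: (svalP (cid (Fhom_full phi))).
have Gf : @is_functor Tc Br (fun r : nat => r) Gm.
  split=> [r s f f' ff|r|r s t f g]; apply: Fhom_faithful => x.
  - by rewrite !GmE.
  - by rewrite GmE (fm_id Fhom_functor r x).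
  - by rewrite GmE (fm_comp Fhom_functor (Gm s t f) (Gm r s g) x) /= !GmE.
exists (Functor Gf); split.
  constructor; refine (@NatIso Br Br (functor_comp (Functor Gf) (Functor Fhom_functor))
    (functor_id Br) (fun r : nat => @Idn C m r) (fun r : nat => @Idn C m r) _ _ _).
  - move=> r s f /=; apply: Fhom_faithful => x.
    have := fm_comp Fhom_functor (Idn s) (Gm r s (Fhom f)) x.
    have := fm_comp Fhom_functor f (Idn r) x.
    rewrite /= => -> ->; have := fm_id Fhom_functor r x;
      have := fm_id Fhom_functor s (frame_eval f x).
    by rewrite /= GmE => /= -> ->.
  - by move=> r; apply: eqv_Comp1l.
  - by move=> r; apply: eqv_Comp1l.
constructor; refine (@NatIso Tc Tc (functor_comp (Functor Fhom_functor) (Functor Gf))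
  (functor_id Tc) (fun r : nat => SOhom_id form r) (fun r : nat => SOhom_id form r) _ _ _).
- by move=> r s f x /=; rewrite GmE.
- by [].
- by [].
Qed.

End Main.

Local Open Scope complex_scope.

Theorem theorem6p1 (R : realType) (m : nat) (m_ge2 : (2 <= m)%N)
    (form : {symmetric 'cV[R[i]]_m}) (form_nondeg : nondegenerate form)
    (e : 'I_m -> 'cV[R[i]]_m)
    (e_orthonormal : forall i j, form (e i) (e j) = (i == j)%:R) :
  exists (F : forall r s : nat, term R[i] m r s -> SOhom form r s)
         (F_functor : @is_functor (enhanced_brauer m (m%:R : R[i]))
                        (tensor_category form) (fun r : nat => r) F),
    [/\ is_linear_tensor_functor F,
        has_generator_values e F,
        forall F' : (forall r s : nat, term R[i] m r s -> SOhom form r s),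
          @is_functor (enhanced_brauer m (m%:R : R[i]))
            (tensor_category form) (fun r : nat => r) F' ->
          is_linear_tensor_functor F' -> has_generator_values e F' ->
          forall r s (f : term R[i] m r s), F' r s f =1 F r s f
      & is_equivalence (Functor F_functor)].
Proof.
exists (Fhom e_orthonormal), (Fhom_functor e_orthonormal); split.
- exact: Fhom_linear_tensor.
- exact: Fhom_values.
- move=> F' fF lF gF r s f.
  exact: (agree_all fF (Fhom_functor e_orthonormal) lF (Fhom_linear_tensor e_orthonormal) gF
    (Fhom_values e_orthonormal)).
- exact: Fhom_equivalence.
Qed.
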